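(* For each of the five degeneration processes $P_J\to P_K$ with $(J,K)\in\{(VI,V),(V,IV),(V,III),(IV,II),(III,II)\}$ between Painlevé systems, let $W_J,W_K$ be the corresponding Bäcklund transformation groups (given explicitly in the context), and let $\alpha=\alpha(A,\varepsilon)$, $t=t(\varepsilon,T)$, $q=q(A,\varepsilon,T,Q,P)$, $p=p(A,\varepsilon,T,Q,P)$ be the corresponding change of parameters and variables. Then one can choose a subgroup $W_{J\to K}$ of $W_J$, acting (through this change of parameters and variables) on the field $E_{J\to K}$ of functions of $A,\varepsilon,T,Q,P$, such that $W_{J\to K}$ converges to $W_K$ as $\varepsilon\to0$. Explicitly: if $s^K_0,\dots,s^K_n$ are the standard generators of $W_K$, there are elements $S_0,\dots,S_n\in W_J$ generating a subgroup $W_{J\to K}=\langle S_0,\dots,S_n\rangle$, and an action of $W_{J\to K}$ on $E_{J\to K}$ by field automorphisms extending its action on $K_J\subset E_{J\to K}$, such that for every $i=0,\dots,n$ and as $\varepsilon\to 0$, $$S_i(A_j)\to s^K_i(\alpha_j)\ (j=0,\dots,n),\quad S_i(T)\to s^K_i(t),\quad S_i(Q)\to s^K_i(q),\quad S_i(P)\to s^K_i(p),$$ where on the right-hand sides $(\alpha_0,\dots,\alpha_n,t,q,p)$ is replaced by $(A_0,\dots,A_n,T,Q,P)$.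
   Context: **Bäcklund transformation groups.** For $J\in\{VI,V,IV,III,II\}$ let $K_J=\mathbf C(\alpha,t,q,p)$ be the field of rational functions in $t,q,p$ and parameters $\alpha=(\alpha_0,\alpha_1,\dots)$ subject to the single linear normalization given below. $W_J$ is the group of $\mathbf C$-automorphisms of $K_J$ generated by the $s_i=s_i^J$ listed below (a lift of the affine Weyl group of the indicated type; it is the Bäcklund transformation group of the $J$-th Painlevé system $P_J$). Generators (variables not mentioned are fixed; in particular $s_i(t)=t$ except for $s_1$ when $J=III$): - $J=VI$ (type $D_4^{(1)}$; $\alpha_0+\alpha_1+2\alpha_2+\alpha_3+\alpha_4=1$). For $i\in\{0,1,3,4\}$: $s_i(\alpha_i)=-\alpha_i$, $s_i(\alpha_2)=\alpha_2+\alpha_i$. $s_2(\alpha_2)=-\alpha_2$, $s_2(\alpha_j)=\alpha_j+\alpha_2$ for $j\in\{0,1,3,4\}$. Further $s_0(p)=p-\frac{\alpha_0}{q-t}$, $s_2(q)=q+\frac{\alpha_2}{p}$, $s_3(p)=p-\frac{\alpha_3}{q-1}$, $s_4(p)=p-\frac{\alpha_4}{q}$; $s_1$ fixes $q,p$. - $J=V$ (type $A_3^{(1)}$; $\alpha_0+\alpha_1+\alpha_2+\alpha_3=1$; indices mod 4). $s_i(\alpha_i)=-\alpha_i$, $s_i(\alpha_{i\pm1})=\alpha_{i\pm1}+\alpha_i$. Further $s_0(q)=q+\frac{\alpha_0}{p+t}$, $s_1(p)=p-\frac{\alpha_1}{q}$, $s_2(q)=q+\frac{\alpha_2}{p}$,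 $s_3(p)=p-\frac{\alpha_3}{q-1}$. - $J=IV$ (type $A_2^{(1)}$; $\alpha_0+\alpha_1+\alpha_2=1$). $s_i(\alpha_i)=-\alpha_i$, $s_i(\alpha_j)=\alpha_j+\alpha_i$ for $j\ne i$. Further $s_0(q)=q+\frac{2\alpha_0}{2p-q-2t}$, $s_0(p)=p+\frac{\alpha_0}{2p-q-2t}$, $s_1(p)=p-\frac{\alpha_1}{q}$, $s_2(q)=q+\frac{\alpha_2}{p}$. - $J=III$ (type $C_2^{(1)}$; $\alpha_0+2\alpha_1+\alpha_2=1$). $s_0$: $\alpha_0\mapsto-\alpha_0$, $\alpha_1\mapsto\alpha_1+\alpha_0$, $q\mapsto q+\frac{\alpha_0}{p}$. $s_1$: $\alpha_0\mapsto\alpha_0+2\alpha_1$, $\alpha_1\mapsto-\alpha_1$, $\alpha_2\mapsto\alpha_2+2\alpha_1$, $t\mapsto -t$, $p\mapsto p-\frac{2\alpha_1}{q}+\frac{t}{q^2}$. $s_2$: $\alpha_1\mapsto\alpha_1+\alpha_2$, $\alpha_2\mapsto-\alpha_2$, $q\mapsto q+\frac{\alpha_2}{p-1}$. - $J=II$ (type $A_1^{(1)}$; $\alpha_0+\alpha_1=1$). $s_0$: $\alpha_0\mapsto-\alpha_0$, $\alpha_1\mapsto\alpha_1+2\alpha_0$, $q\mapsto q+\frac{\alpha_0}{p-2q^2-t}$, $p\mapsto p+\frac{4\alpha_0q}{p-2q^2-t}+\frac{2\alpha_0^2}{(p-2q^2-t)^2}$. $s_1$: $\alpha_0\mapsto\alpha_0+2\alpha_1$,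 $\alpha_1\mapsto-\alpha_1$, $q\mapsto q+\frac{\alpha_1}{p}$. **Degeneration processes.** The new parameters $A=(A_0,\dots,A_n)$ satisfy the normalization of the parameters for $K$ (with $\alpha_j$ replaced by $A_j$), and $\varepsilon$ is an additional parameter. The changes of parameters and variables are: - $VI\to V$: $\alpha_0=\varepsilon^{-1}$, $\alpha_1=A_3$, $\alpha_2=A_2$, $\alpha_3=A_0-A_2-\varepsilon^{-1}$, $\alpha_4=A_1$; $t=1+\varepsilon T$, $(q-1)(Q-1)=1$, $(q-1)p+(Q-1)P=-A_2$. - $V\to IV$: $\alpha_0=A_0+\frac12\varepsilon^{-2}$, $\alpha_1=A_1$, $\alpha_2=A_2$, $\alpha_3=-\frac12\varepsilon^{-2}$; $t=\frac12\varepsilon^{-2}(1+2\varepsilon T)$, $q=-\frac{\varepsilon Q}{1-\varepsilon Q}$, $p=-\varepsilon^{-1}(1-\varepsilon Q)[P-\varepsilon(A_2+QP)]$. - $V\to III$: $\alpha_0=A_2$, $\alpha_1=\varepsilon^{-1}$, $\alpha_2=A_0$, $\alpha_3=2A_1-\varepsilon^{-1}$; $t=-\varepsilon T$, $q=1+\frac{Q}{\varepsilon T}$, $p=\varepsilon TP$. - $IV\to II$: $\alpha_0=A_0-\frac14\varepsilon^{-6}$, $\alpha_1=\frac14\varepsilon^{-6}$, $\alpha_2=A_1$; $t=-\frac1{\sqrt2}\varepsilon^{-3}(1-\varepsilon^4T)$, $q=\frac1{\sqrt2}\varepsilon^{-3}(1+2\varepsilon^2Q)$, $p=\frac1{\sqrt2}\varepsilon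 P$. - $III\to II$: $\alpha_0=A_1$, $\alpha_1=\frac14\varepsilon^{-3}$, $\alpha_2=A_0-\frac12\varepsilon^{-3}$; $t=-\tau^2$, $q=-\frac{\tau}{x}$, $p=\frac{x}{\tau}(A_1+xy)$, where $\tau=\frac{1+\varepsilon^2T}{4\varepsilon^3}$, $x=1+2\varepsilon Q$, $y=\frac{P}{2\varepsilon}$. **The field $E_{J\to K}$.** For $(J,K)=(VI,V),(V,III)$, where the change is birational, $E_{J\to K}=\mathbf C(A,\varepsilon,T,Q,P)$. For the other three cases $E_{J\to K}$ is the field of rational functions of $T,Q,P$ whose coefficients are formal power series in the parameters; concretely, the fraction field of $\mathbf C[A][[\varepsilon]][T,Q,P]$, where $\mathbf C[A]$ is the polynomial ring in the $A_j$ modulo their normalization. The change of parameters and variables embeds $K_J$ in $E_{J\to K}$. **Convergence.** An element $f\in E_{J\to K}$ converges to $g\in\mathbf C(A,T,Q,P)$ as $\varepsilon\to0$ (written $f\to g$) if $f=N/D$ with $N,D$ polynomials in $T,Q,P$ whose coefficients are power series in $\varepsilon$ over $\mathbf C[A]$, convergent for each fixed $A$ and all sufficiently small $\varepsilon$, with $D|_{\varepsilon=0}\neq0$ and $N|_{\varepsilon=0}/D|_{\varepsilon=0}=g$; thus, for fixed generic $A,T,Q,P$, the value of $f$ tends to that of $g$. *)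

(* Defs.v *)
From HB Require Import structures.
From mathcomp Require Import all_boot all_order all_algebra.
From mathcomp Require Import complex mpoly.
From mathcomp Require Import boolp reals classical_sets filter.
From mathcomp Require Import normed_module sequences.
Set Implicit Arguments.
Unset Strict Implicit.
Unset Printing Implicit Defensive.
Import Order.TTheory GRing.Theory Num.Theory.
Import numFieldNormedType.Exports.
Local Open Scope ring_scope.

(** * Formal power series in one variable *)

Record fps (A : Type) := Fps { fps_coef :> nat -> A }.

HB.instance Definition _ (A : Type) := gen_eqMixin (fps A).
HB.instance Definition _ (A : Type) := gen_choiceMixin (fps A).

Lemma fpsP (A : Type) (f g : fps A) : fps_coef f =1 fps_coef g -> f = g.
Proof. by case: f g => [f] [g] /= /funext ->. Qed.

Section FpsRing.
Variable A : comNzRingType.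
Implicit Types f g h : fps A.

Definition fps_const (a : A) : fps A := Fps (fun k => if k == 0%N then a else 0).
Definition fps_var : fps A := Fps (fun k => (k == 1%N)%:R).
Definition fps_poly (p : {poly A}) : fps A := Fps (fun k => p`_k).

Definition fps_opp f : fps A := Fps (fun k => - f k).
Definition fps_add f g : fps A := Fps (fun k => f k + g k).
Definition fps_mul f g : fps A := Fps (fun k => \sum_(i < k.+1) f i * g (k - i)%N).

Fact fps_addA : associative fps_add.
Proof. by move=> f g h; apply: fpsP => k /=; rewrite addrA. Qed.
Fact fps_addC : commutative fps_add.
Proof. by move=> f g; apply: fpsP => k /=; rewrite addrC. Qed.
Fact fps_add0 : left_id (fps_const 0) fps_add.
Proof. by move=> f; apply: fpsP => k /=; rewrite if_same add0r. Qed.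
Fact fps_addN : left_inverse (fps_const 0) fps_opp fps_add.
Proof. by move=> f; apply: fpsP => k /=; rewrite if_same addNr. Qed.

HB.instance Definition _ :=
  GRing.isZmodule.Build (fps A) fps_addA fps_addC fps_add0 fps_addN.

Let trunc n f : {poly A} := \poly_(i < n) f i.

Let coef_trunc n f k : (k < n)%N -> (trunc n f)`_k = f k.
Proof. by move=> kn; rewrite coef_poly kn. Qed.

Let coef_fps_mul n f g k : (k < n)%N ->
  fps_mul f g k = (trunc n f * trunc n g)`_k.
Proof.
move=> kn; rewrite coefM; apply: eq_bigr => i _.
by rewrite !coef_trunc // (leq_ltn_trans _ kn) ?leq_subr // -ltnS.
Qed.

Fact fps_mulA : associative fps_mul.
Proof.
move=> f g h; apply: fpsP => k.
rewrite !(@coef_fps_mul k.+1) //.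
transitivity ((trunc k.+1 f * (trunc k.+1 g * trunc k.+1 h))`_k).
  rewrite coefM [RHS]coefM; apply: eq_bigr => i _; congr (_ * _).
  by rewrite coef_trunc ?ltnS ?leq_subr // (@coef_fps_mul k.+1) ?ltnS ?leq_subr.
rewrite mulrA coefM [RHS]coefM; apply: eq_bigr => i _; congr (_ * _).
by rewrite [RHS]coef_trunc // (@coef_fps_mul k.+1).
Qed.
Fact fps_mulC : commutative fps_mul.
Proof. by move=> f g; apply: fpsP => k; rewrite !(@coef_fps_mul k.+1) // mulrC. Qed.
Fact fps_mul1 : left_id (fps_const 1) fps_mul.
Proof.
move=> f; apply: fpsP => k /=; rewrite big_ord_recl /= mul1r subn0.
by rewrite big1 ?addr0 // => i _; rewrite mul0r.
Qed.
Fact fps_mulDl : left_distributive fps_mul fps_add.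
Proof.
move=> f g h; apply: fpsP => k /=; rewrite -big_split /=.
by apply: eq_bigr => i _; rewrite mulrDl.
Qed.
Fact fps_one_neq0 : fps_const 1 != 0.
Proof.
apply/eqP => /(congr1 (fun f : fps A => f 0%N)) /= /eqP.
by rewrite oner_eq0.
Qed.

HB.instance Definition _ := GRing.Zmodule_isComNzRing.Build (fps A)
  fps_mulA fps_mulC fps_mul1 fps_mulDl fps_one_neq0.

Definition fps_unit : {pred fps A} := fun f => `[< exists g, g * f = 1 >].
Definition fps_inv f : fps A :=
  if pselect (exists g, g * f = 1) is left h then projT1 (cid h) else f.

Fact fps_mulVx : {in fps_unit, left_inverse 1 fps_inv *%R}.
Proof.
move=> f /asboolP hf; rewrite /fps_inv; case: pselect => // h.
by case: (cid h).
Qed.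
Fact fps_unitPl f g : g * f = 1 -> fps_unit f.
Proof. by move=> gf; apply/asboolP; exists g. Qed.
Fact fps_invr_out : {in [predC fps_unit], fps_inv =1 id}.
Proof.
move=> f; rewrite inE => /negP hf; rewrite /fps_inv; case: pselect => // h.
by case: hf; apply/asboolP.
Qed.

HB.instance Definition _ := GRing.ComNzRing_hasMulInverse.Build (fps A)
  fps_mulVx fps_unitPl fps_invr_out.

End FpsRing.

Section FpsIdomain.
Variable A : idomainType.

Let fps_val (f : fps A) : f != 0 ->
  exists2 n, f n != 0 & forall k, (k < n)%N -> f k = 0.
Proof.
move=> f0; have ex : exists n, f n != 0.
  apply: contrapT => /forallNP h; case/eqP: f0; apply: fpsP => k /=.
  by rewrite if_same; apply/eqP/negPn/negP/h.
case: (ex_minnP ex) => n fn nmin; exists n => // k kn.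
by apply/eqP/negPn/negP => /nmin; rewrite leqNgt kn.
Qed.

Fact fps_integral : GRing.integral_domain_axiom (fps A).
Proof.
move=> f g fg; apply/norP => -[/fps_val[m fm mmin] /fps_val[n gn nmin]].
have := congr1 (fun h : fps A => h (m + n)%N) fg.
rewrite /= (bigD1 (inord m)) //= inordK ?ltnS ?leq_addr // addKn big1.
  by rewrite addr0 if_same => /eqP; rewrite mulf_eq0 (negPf fm) (negPf gn).
move=> i; rewrite -val_eqE /= inordK ?ltnS ?leq_addr // neq_ltn => /orP[im|mi].
  by rewrite mmin // mul0r.
by rewrite nmin ?mulr0 // ltn_subLR ?ltn_add2r // -ltnS.
Qed.

HB.instance Definition _ :=
  GRing.ComUnitRing_isIntegral.Build (fps A) fps_integral.

End FpsIdomain.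

(** * Rational function fields *)

Definition Cplx (R : realType) : numClosedFieldType := R[i].

(* [ratfun B] is the fraction field of B[t, q, p], resp. of B[T, Q, P]. *)
Definition ratfun (B : idomainType) : fieldType := {fraction {mpoly B[3]}}.

Section RatFun.
Variable B : idomainType.

Definition ratfun_of (x : {mpoly B[3]}) : ratfun B := @FracField.tofrac _ x.
Definition coefF (b : B) : ratfun B := ratfun_of b%:MP.
Definition var_t : ratfun B := ratfun_of 'X_(@Ordinal 3 0 isT).
Definition var_q : ratfun B := ratfun_of 'X_(@Ordinal 3 1 isT).
Definition var_p : ratfun B := ratfun_of 'X_(@Ordinal 3 2 isT).
End RatFun.

(** * Groups of field automorphisms *)

Definition field_automorphism (F : fieldType) (w : F -> F) : Prop :=
  [/\ zmod_morphism w, monoid_morphism w & bijective w].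

Inductive generated (F : Type) (X : (F -> F) -> Prop) : (F -> F) -> Prop :=
| generated_gen w : X w -> generated X w
| generated_one : generated X id
| generated_mul v w : generated X v -> generated X w -> generated X (v \o w)
| generated_inv v w : generated X v -> cancel v w -> cancel w v ->
    generated X w.

Definition acts_by_automorphisms (F L : fieldType) (G : (F -> F) -> Prop)
    (rho : (F -> F) -> L -> L) : Prop :=
  [/\ forall w, G w -> field_automorphism (rho w),
      rho id = id
    & forall v w, G v -> G w -> rho (v \o w) = rho v \o rho w].

(** * The Painlevé systems and their Bäcklund transformations *)

Inductive painleve := PVI | PV | PIV | PIII | PII.

(* The parameters are alpha_0, ..., alpha_n with n = rank J. *)
Definition rank (J : painleve) : nat :=
  match J with PVI => 4 | PV => 3 | PIV => 2 | PIII => 2 | PII => 1 end.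

(* The normalization is \sum_j (mark J j) * alpha_j = 1; mark J 0 = 1. *)
Definition mark (J : painleve) (j : nat) : nat :=
  nth 0%N match J with
          | PVI => [:: 1; 1; 2; 1; 1]
          | PV => [:: 1; 1; 1; 1]
          | PIV => [:: 1; 1; 1]
          | PIII => [:: 1; 2; 1]
          | PII => [:: 1; 1]
          end%N j.

(* s_i(alpha_j) = alpha_j - (cartan J i j) * alpha_i. *)
Definition cartan (J : painleve) (i j : nat) : int :=
  nth 0 (nth [::] match J with
    | PVI => [:: [:: 2; 0; -1; 0; 0];
                 [:: 0; 2; -1; 0; 0];
                 [:: -1; -1; 2; -1; -1];
                 [:: 0; 0; -1; 2; 0];
                 [:: 0; 0; -1; 0; 2]]
    | PV => [:: [:: 2; -1; 0; -1];
                [:: -1; 2; -1; 0];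
                [:: 0; -1; 2; -1];
                [:: -1; 0; -1; 2]]
    | PIV => [:: [:: 2; -1; -1];
                 [:: -1; 2; -1];
                 [:: -1; -1; 2]]
    | PIII => [:: [:: 2; -1; 0];
                  [:: -2; 2; -2];
                  [:: 0; -1; 2]]
    | PII => [:: [:: 2; -2];
                 [:: -2; 2]]
    end i) j.

(* The images of (t, q, p) under s_i, where a = alpha_i. *)
Definition s_tqp (F : fieldType) (J : painleve) (i : nat) (a t q p : F) :
    F * F * F :=
  match J, i with
  | PVI, 0%N => (t, q, p - a / (q - t))
  | PVI, 1%N => (t, q, p)
  | PVI, 2%N => (t, q + a / p, p)
  | PVI, 3%N => (t, q, p - a / (q - 1))
  | PVI, 4%N => (t, q, p - a / q)
  | PV, 0%N => (t, q + a / (p + t), p)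
  | PV, 1%N => (t, q, p - a / q)
  | PV, 2%N => (t, q + a / p, p)
  | PV, 3%N => (t, q, p - a / (q - 1))
  | PIV, 0%N =>
      let f := 2 * p - q - 2 * t in (t, q + 2 * a / f, p + a / f)
  | PIV, 1%N => (t, q, p - a / q)
  | PIV, 2%N => (t, q + a / p, p)
  | PIII, 0%N => (t, q + a / p, p)
  | PIII, 1%N => (- t, q, p - 2 * a / q + t / q ^+ 2)
  | PIII, 2%N => (t, q + a / (p - 1), p)
  | PII, 0%N =>
      let f := p - 2 * q ^+ 2 - t in
      (t, q + a / f, p + 4 * a * q / f + 2 * a ^+ 2 / f ^+ 2)
  | PII, 1%N => (t, q + a / p, p)
  | _, _ => (t, q, p)
  end.

Section Painleve.
Variable R : realType.
Local Notation C := (Cplx R).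

(* The polynomial ring in alpha_0, ..., alpha_n modulo the normalization,
   realized as the polynomial ring in alpha_1, ..., alpha_n by eliminating
   alpha_0. *)
Definition paramRing (J : painleve) : idomainType := {mpoly C[rank J]}.

Definition param (J : painleve) (j : 'I_(rank J).+1) : paramRing J :=
  if unlift ord0 j is Some k then 'X_k
  else 1 - \sum_(k < rank J) 'X_k *+ mark J k.+1.

Lemma param_normalization (J : painleve) :
  \sum_(j < (rank J).+1) param j *+ mark J j = 1.
Proof.
rewrite big_ord_recl [X in _ + X](_ : _ = \sum_(k < rank J) 'X_k *+ mark J k.+1).
  by rewrite /param unlift_none; case: J => /=; rewrite mulr1n subrK.
by apply: eq_bigr => k _; rewrite /param liftK.
Qed.

Definition K (J : painleve) : fieldType := ratfun (paramRing J).

Definition alpha (J : painleve) (j : 'I_(rank J).+1) : K J := coefF (param j).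

Definition s_param (J : painleve) (i j : 'I_(rank J).+1) : K J :=
  alpha j - alpha i *~ cartan J i j.

Definition fixes_C (J : painleve) (w : K J -> K J) : Prop :=
  forall c : C, w (coefF (c%:MP : paramRing J)) = coefF (c%:MP : paramRing J).

(* [is_s i s] : s is the C-automorphism s_i of K J. *)
Definition is_s (J : painleve) (i : 'I_(rank J).+1) (s : K J -> K J) : Prop :=
  [/\ field_automorphism s, fixes_C s,
      forall j, s (alpha j) = s_param i j
    & (s (var_t _), s (var_q _), s (var_p _)) = s_tqp J i (alpha i) (var_t _) (var_q _) (var_p _)].

Definition W (J : painleve) : (K J -> K J) -> Prop :=
  generated (fun s => exists i, is_s i s).

End Painleve.

(** * Degeneration processes *)

Inductive degeneration := VI_V | V_IV | V_III | IV_II | III_II.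

Definition source (d : degeneration) : painleve :=
  match d with
  | VI_V => PVI | V_IV => PV | V_III => PV | IV_II => PIV | III_II => PIII
  end.

Definition target (d : degeneration) : painleve :=
  match d with
  | VI_V => PV | V_IV => PIV | V_III => PIII | IV_II => PII | III_II => PII
  end.

Definition birational (d : degeneration) : bool :=
  match d with VI_V | V_III => true | _ => false end.

Section Degeneration.
Variable R : realType.
Local Notation C := (Cplx R).
Variable d : degeneration.
Local Notation CA := (paramRing R (target d)).

(* C[A][eps] in the birational cases, C[A][[eps]] otherwise. *)
Definition epsRing : idomainType :=
  if birational d then {poly CA} : idomainType else fps CA.

Definition eps_const (a : CA) : epsRing :=
  if birational d as b return (if b then {poly CA} : idomainType else fps CA)
  then a%:P else fps_const a.

Definition eps_var : epsRing :=
  if birational d as b return (if b then {poly CA} : idomainType else fps CA)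
  then 'X else fps_var CA.

Definition eps_series : epsRing -> fps CA :=
  if birational d as b
    return ((if b then {poly CA} : idomainType else fps CA) -> fps CA)
  then @fps_poly CA else id.

(* In the birational cases this is C(A, eps, T, Q, P) as the fraction field of
   C[A][eps][T, Q, P]. *)
Definition E : fieldType := ratfun epsRing.

Definition constE (c : C) : E := coefF (eps_const c%:MP).
Definition A_ (j : 'I_(rank (target d)).+1) : E := coefF (eps_const (param R j)).
Definition eps : E := coefF eps_var.
Definition T_ : E := var_t _.
Definition Q_ : E := var_q _.
Definition P_ : E := var_p _.

(* The relations between the old parameters al = [:: alpha_0; alpha_1; ...] and
   variables t, q, p and the new ones. *)
Definition change (al : seq E) (t q p : E) : Prop :=
  let A (j : nat) : E := A_ (inord j) in
  let e := eps in let T := T_ in let Q := Q_ in let P := P_ in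
  let r2 := constE (sqrtC 2) in
  match d with
  | VI_V =>
      [/\ al = [:: e^-1; A 3%N; A 2%N; A 0%N - A 2%N - e^-1; A 1%N],
          t = 1 + e * T,
          (q - 1) * (Q - 1) = 1
        & (q - 1) * p + (Q - 1) * P = - A 2%N]
  | V_IV =>
      [/\ al = [:: A 0%N + 2^-1 * e ^- 2; A 1%N; A 2%N; - (2^-1 * e ^- 2)],
          t = 2^-1 * e ^- 2 * (1 + 2 * e * T),
          q = - (e * Q / (1 - e * Q))
        & p = - (e^-1 * (1 - e * Q) * (P - e * (A 2%N + Q * P)))]
  | V_III =>
      [/\ al = [:: A 2%N; e^-1; A 0%N; 2 * A 1%N - e^-1],
          t = - (e * T),
          q = 1 + Q / (e * T)
        & p = e * T * P]
  | IV_II =>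
      [/\ al = [:: A 0%N - 4^-1 * e ^- 6; 4^-1 * e ^- 6; A 1%N],
          t = - (r2^-1 * e ^- 3 * (1 - e ^+ 4 * T)),
          q = r2^-1 * e ^- 3 * (1 + 2 * e ^+ 2 * Q)
        & p = r2^-1 * e * P]
  | III_II =>
      let tau := (1 + e ^+ 2 * T) / (4 * e ^+ 3) in
      let x := 1 + 2 * e * Q in
      let y := P / (2 * e) in
      [/\ al = [:: A 1%N; 4^-1 * e ^- 3; A 0%N - 2^-1 * e ^- 3],
          t = - tau ^+ 2,
          q = - (tau / x)
        & p = x / tau * (A 1%N + x * y)]
  end.

Definition is_change_of_variables (iota : K R (source d) -> E) : Prop :=
  (forall c : C, iota (coefF (c%:MP : paramRing R (source d))) = constE c) /\
  change [seq iota (alpha R j) | j <- enum 'I_(rank (source d)).+1]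
    (iota (var_t _)) (iota (var_q _)) (iota (var_p _)).

(* Convergence for every fixed value of A_1, ..., A_n (A_0 being eliminated) and
   all sufficiently small eps. *)
Definition eps_convergent (u : fps CA) : Prop :=
  forall a : 'I_(rank (target d)) -> C, exists2 r : C, 0 < r &
    forall z : C, `|z| < r ->
      cvgn (series (fun k => (u k : {mpoly C[rank (target d)]}).@[a] * z ^+ k)).

Definition at_eps0 (N : {mpoly (fps CA)[3]}) : {mpoly CA[3]} :=
  map_mpoly (fun u : fps CA => u 0%N) N.

(* [f = N / D] inside the fraction field of C[A][[eps]][T, Q, P], into which E is
   embedded by [eps_series]. *)
Definition is_quotient (f : E) (N D : {mpoly (fps CA)[3]}) : Prop :=
  exists n m : {mpoly epsRing[3]},
    [/\ m != 0, f = ratfun_of n / ratfun_of m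
      & map_mpoly eps_series n * D = N * map_mpoly eps_series m].

Definition converges (f : E) (g : K R (target d)) : Prop :=
  exists N D : {mpoly (fps CA)[3]},
    [/\ forall m, eps_convergent N@_m /\ eps_convergent D@_m,
        is_quotient f N D, at_eps0 D != 0
      & ratfun_of (at_eps0 N) / ratfun_of (at_eps0 D) = g].

End Degeneration.

(* Main.v *)
Require Import Defs.
From HB Require Import structures.
From mathcomp Require Import all_boot all_order all_algebra.
From mathcomp Require Import complex mpoly.
From mathcomp Require Import boolp reals classical_sets filter.
From mathcomp Require Import normed_module sequences.
From mathcomp Require Import complete_normed_module pseudometric_normed_Zmodule num_normedtype.
From mathcomp Require Import ring.
Set Implicit Arguments.
Unset Strict Implicit.
Unset Printing Implicit Defensive.
Import Order.TTheory GRing.Theory Num.Theory.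
Local Open Scope ring_scope.

(** Each generator of W_K comes from the reflection S_i of W_J attached to the combination
    of old parameters that equals A_i.  Acting on the old parameters, S_i maps eps^-N to
    eps^-N + c A_i for an integer c, with N = 1, 2, 1, 6, 3 (except that it maps eps to
    -eps for s_1 in V -> III), so that off the birational cases it has to multiply eps by
    the power series U = (1 + c A_i eps^N)^(-1/N).  This choice of the N-th root has
    coefficients of at most geometric growth, makes the lift of S_i to
    C[A][[eps]](T, Q, P) an involution, and is preserved by composition, whence an action
    of the group.  For III -> II the square root tau of -t is fixed by the lifts.

    Written in the new variables, S_i becomes a rational expression in A, eps, U, T, Q, P
    without pole at eps = 0.  Taking limits is a partial homomorphism from E to
    C(A, T, Q, P), and evaluating these expressions at eps = 0, U = 1 gives s_i.  Partial
    homomorphisms (specializations) also provide all the injectivity and nonvanishing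
    statements, by evaluation at numerical points. *)

(** * Fraction fields and specializations *)

(** Off the birational cases [iota] has symmetries: for V -> IV, changing the signs of eps, T, Q and
    P together fixes every old variable. An automorphism of K_J then has several extensions, and
    extensions chosen separately for the generators could break the relations of W_J. Hence the
    predicate [lifts], strict enough to leave one extension and stable under composition and
    inverses; rho is that unique lift, and no presentation of the group is needed. Fixing tau is
    consistent because both words for III -> II contain s_1 an even number of times and so fix t. A
    substitution extends to rational functions only if it kills no nonzero polynomial. Two arguments
    give this: a substitution that returns the generators when applied twice is injective (the s_i
    and their lifts), and so is a change of variables that reaches every numerical point outside a
    hypersurface ([iota]). On the parameters A the S_i act exactly as the s_i; only T, Q, P need a
    limit, and the closed forms [newS_*] exhibit the cancellation of the negative powers of eps. *)

Definition rmorph_of (R S : pzRingType) (f : R -> S)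
    (fB : zmod_morphism f) (fM : monoid_morphism f) : {rmorphism R -> S} :=
  HB.pack_for (GRing.RMorphism.type R S) f (GRing.isZmodMorphism.Build R S f fB)
    (GRing.isMonoidMorphism.Build R S f fM).

Definition fracField (P : idomainType) : fieldType := {fraction P}.
Definition toFrac (P : idomainType) : {rmorphism P -> fracField P} :=
  @FracField.tofrac P.

Lemma toFrac_eq (P : idomainType) (x y : P) : (toFrac P x == toFrac P y) = (x == y).
Proof. exact: tofrac_eq. Qed.

Lemma toFrac_eq0 (P : idomainType) (x : P) : (toFrac P x == 0) = (x == 0).
Proof. exact: tofrac_eq0. Qed.

Lemma fracE (P : idomainType) (x : fracField P) :
  exists2 nd : P * P, nd.2 != 0 & x = toFrac P nd.1 / toFrac P nd.2.
Proof.
have : exists y : {ratio P}, \pi_({fraction P})%qT y = x.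
  by exists (repr x); rewrite reprK.
case=> y <-; exists (\n_y, \d_y) => /=; first exact: denom_ratioP.
have d0 : toFrac P \d_y != 0 by rewrite toFrac_eq0 denom_ratioP.
apply: (mulIf d0); rewrite divfK // /toFrac /=; unlock FracField.tofrac.
rewrite -[LHS]FracField.pi_mul; apply/eqmodP; rewrite /= FracField.equivfE.
rewrite /FracField.mulf !numden_Ratio ?mulf_neq0 ?oner_eq0 ?denom_ratioP //.
by rewrite !mulr1 mulrC.
Qed.

Section FracLift.
Variables (P : idomainType) (F : fieldType) (h : {rmorphism P -> F}).
Hypothesis h_inj : forall x, h x = 0 -> x = 0.
Local Notation tofrac := (toFrac P).

Let num x := (s2val (cid2 (@fracE P x))).1.
Let den x := (s2val (cid2 (@fracE P x))).2.
Let den0 x : den x != 0.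
Proof. exact: (s2valP (cid2 (@fracE P x))). Qed.
Let numdenE x : x = tofrac (num x) / tofrac (den x).
Proof. exact: (s2valP' (cid2 (@fracE P x))). Qed.
Let h0 x : x != 0 -> h x != 0.
Proof. by apply: contra_neq => /h_inj. Qed.
Let lift x := h (num x) / h (den x).

Let liftE n d : d != 0 -> lift (tofrac n / tofrac d) = h n / h d.
Proof.
move=> d0; set x := tofrac n / _; have := numdenE x.
rewrite /x => /eqP; rewrite eqr_div ?toFrac_eq0 ?den0 // -!rmorphM toFrac_eq => /eqP e.
by apply/eqP; rewrite /lift eqr_div ?h0 ?den0 // -!rmorphM -e.
Qed.

Lemma frac_lift : exists H : {rmorphism fracField P -> F},
  forall x, H (tofrac x) = h x.
Proof.
have liftP x : lift (tofrac x) = h x.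
  by have := liftE x (oner_neq0 P); rewrite !rmorph1 !divr1.
have tf0 d : d != 0 -> tofrac d != 0 by rewrite toFrac_eq0.
have add : zmod_morphism lift.
  move=> x y; case: (fracE x) => -[n d] /= d0 ->; case: (fracE y) => -[n' d'] /= d'0 ->.
  rewrite -mulNr addf_div ?tf0 // -rmorphN -!rmorphM -rmorphD liftE ?mulf_neq0 //.
  by rewrite !liftE // -mulNr addf_div ?h0 // -rmorphN -!rmorphM -rmorphD.
have mul : monoid_morphism lift.
  split=> [|x y]; first by rewrite -(rmorph1 tofrac) liftP rmorph1.
  case: (fracE x) => -[n d] /= d0 ->; case: (fracE y) => -[n' d'] /= d'0 ->.
  by rewrite mulf_div -!rmorphM liftE ?mulf_neq0 // !liftE // mulf_div -!rmorphM.
by exists (rmorph_of add mul).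
Qed.
End FracLift.

(** * Morphisms out of polynomial rings, and points where a polynomial does not vanish *)

Lemma mpoly_rmorph_ext n (R : comNzRingType) (S : nzRingType)
    (f g : {rmorphism {mpoly R[n]} -> S}) :
  (forall c, f c%:MP = g c%:MP) -> (forall i, f 'X_i = g 'X_i) -> f =1 g.
Proof.
move=> fgC fgX p; rewrite [p]mpolyE !rmorph_sum; apply: eq_bigr => m _.
rewrite -mul_mpolyC !rmorphM fgC mpolyXE_id !rmorph_prod; congr (_ * _).
by apply: eq_bigr => i _; rewrite !rmorphXn fgX.
Qed.

Lemma poly_rmorph_ext (R : nzRingType) (S : nzRingType)
    (f g : {rmorphism {poly R} -> S}) :
  (forall c, f c%:P = g c%:P) -> f 'X = g 'X -> f =1 g.
Proof.
move=> fgC fgX p; rewrite -[p]coefK poly_def !rmorph_sum; apply: eq_bigr => i _.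
by rewrite -mul_polyC !rmorphM fgC !rmorphXn fgX.
Qed.

Lemma mmapXU n (R S : nzRingType) (f : {rmorphism R -> S}) (h : 'I_n -> S) i :
  mmap f h 'X_i = h i.
Proof. by rewrite mmapX mmap1U. Qed.

Lemma poly_nat_point (R : idomainType) (p : {poly R}) :
  (forall n, n.+1%:R != 0 :> R) -> p != 0 -> exists n : nat, p.[n%:R] != 0.
Proof.
move=> char0 p0; apply: contrapT => /forallNP h.
have natI : injective (fun n : nat => n%:R : R).
  have le i j : (i <= j)%N -> i%:R = j%:R :> R -> i = j.
    move=> ij /eqP; rewrite eq_sym -subr_eq0 -natrB //.
    case: (j - i)%N (subnK ij) => [|k] <- //.
    by rewrite (negPf (char0 k)).
  by move=> i j; case/orP: (leq_total i j) => ij; [|move/esym]; move=> /(le _ _ ij).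
pose rs : seq R := [seq i%:R | i <- iota 0 (size p)].
have rp : all (root p) rs.
  by apply/allP => x /mapP[i _ ->]; rewrite /root; have /negP := h i; rewrite negbK.
have := max_poly_roots p0 rp; rewrite map_inj_uniq ?iota_uniq // => /(_ isT).
by rewrite size_map size_iota ltnn.
Qed.

(** Induction on the number of variables: [uni] makes [p] univariate in the last variable, its
    leading coefficient survives at some natural point of the other variables, and the resulting
    univariate polynomial survives at some natural number. [wid] provides a left inverse of [uni],
    so that [uni p] is nonzero. *)
Lemma mpoly_nat_point (R : idomainType) n (p : {mpoly R[n]}) :
  (forall n, n.+1%:R != 0 :> R) -> p != 0 ->
  exists v : 'I_n -> nat, p.@[fun i => (v i)%:R] != 0.
Proof.
move=> char0; elim: n p => [|n IH] p p0.
  exists (fun=> 0%N).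
  have e : p = (p.@[fun=> 0%:R])%:MP.
    have := @mpoly_rmorph_ext 0 R {mpoly R[0]} idfun
      (mpolyC 0 (R:=R) \o meval (fun=> 0%:R)) => /(_ _ _ p); apply.
    - by move=> c /=; rewrite mevalC.
    - by case.
  by apply: contra_neq p0 => e0; rewrite e e0 mpolyC0.
pose X (i : 'I_n.+1) : {poly {mpoly R[n]}} :=
  if unlift ord_max i is Some j then ('X_j)%:P else 'X.
pose uni := mmap (polyC \o @mpolyC n R) X : {rmorphism {mpoly R[n.+1]} -> _}.
pose wid := mmap (@mpolyC n.+1 R) (fun j : 'I_n => 'X_(lift ord_max j)) : {rmorphism _ -> {mpoly R[n.+1]}}.
have uniK q : (map_poly wid (uni q)).['X_ord_max] = q.
  have := @mpoly_rmorph_ext _ _ _ (horner_eval 'X_ord_max \o map_poly wid \o uni)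
     idfun => /(_ _ _ q); apply.
  - by move=> c; rewrite /= /uni mmapC /= map_polyC /= /horner_eval hornerC /wid mmapC.
  - move=> i; rewrite /= /uni mmapXU /X /horner_eval.
    case: unliftP => [j|] -> /=; last by rewrite map_polyX hornerX.
    by rewrite map_polyC hornerC /= /wid mmapXU.
have u0 : uni p != 0.
  by apply: contra_neq p0 => u0; rewrite -(uniK p) u0 rmorph0 horner0.
have [v hv] : exists v : 'I_n -> nat, (lead_coef (uni p)).@[fun i => (v i)%:R] != 0.
  by apply: IH; rewrite lead_coef_eq0.
pose ev := meval (fun i => (v i)%:R) : {rmorphism {mpoly R[n]} -> R}.
have [x hx] : exists x : nat, (map_poly ev (uni p)).[x%:R] != 0.
  apply: poly_nat_point => //; apply: contra_neq hv => /polyP/(_ (size (uni p)).-1).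
  by rewrite coef_map coef0.
exists (fun i => if unlift ord_max i is Some j then v j else x).
set v' := fun i => _; suff -> : p.@[v'] = (map_poly ev (uni p)).[x%:R] by [].
apply/esym; apply: (@mpoly_rmorph_ext _ _ _
  (horner_eval x%:R \o map_poly ev \o uni) (meval v')).
- by move=> c; rewrite /= /uni mmapC /= map_polyC /= /horner_eval hornerC /ev; rewrite [LHS]mevalC [RHS]mevalC.
- move=> i; rewrite /= /uni mmapXU /X /horner_eval [RHS]mevalXU /v'.
  case: unliftP => [j _|_] /=; last by rewrite map_polyX hornerX.
  by rewrite map_polyC hornerC /= /ev [LHS]mevalXU.
Qed.

(** [spec_sub] carves out the subring on which the target map is meaningful: everything for
    evaluations, coefficients of bounded growth for limits. [spec_ker] makes the value induced on
    fractions independent of the chosen numerator and denominator. *)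
Record specData (L F : fieldType) := SpecData {
  spec_ring : comNzRingType;
  spec_sub : spec_ring -> Prop;
  spec_src : {rmorphism spec_ring -> L};
  spec_tgt : {rmorphism spec_ring -> F};
  spec_sub1 : spec_sub 1;
  spec_subB : forall x y, spec_sub x -> spec_sub y -> spec_sub (x - y);
  spec_subM : forall x y, spec_sub x -> spec_sub y -> spec_sub (x * y);
  spec_ker : forall x, spec_sub x -> spec_src x = 0 -> spec_tgt x = 0 }.

Arguments spec_ring {L F}.
Arguments spec_sub {L F}.
Arguments spec_src {L F}.
Arguments spec_tgt {L F}.

(* A partial homomorphism L --> F, defined on the localisation of a subring. *)
Definition spec (L F : fieldType) (D : specData L F) (f : L) (g : F) : Prop :=
  exists n m, [/\ spec_sub D n /\ spec_sub D m, spec_tgt D m != 0,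
    f = spec_src D n / spec_src D m & g = spec_tgt D n / spec_tgt D m].

Section Spec.
Variables (L F : fieldType) (D : specData L F).
Local Notation sub := (spec_sub D).
Local Notation src := (spec_src D).
Local Notation tgt := (spec_tgt D).
Local Notation spec := (spec D).

Let sub0 : sub 0.
Proof. by rewrite -(subrr 1); apply: spec_subB; apply: spec_sub1. Qed.
Let subN x : sub x -> sub (- x).
Proof. by move=> xs; rewrite -sub0r; apply: spec_subB. Qed.
Let subD x y : sub x -> sub y -> sub (x + y).
Proof. by move=> xs ys; rewrite -[y]opprK; apply: spec_subB => //; apply: subN. Qed.

Let src_neq0 x : sub x -> tgt x != 0 -> src x != 0.
Proof. by move=> xs; apply: contra_neq => /(spec_ker xs). Qed.

Lemma spec_of x : sub x -> spec (src x) (tgt x).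
Proof.
move=> xs; exists x, 1; split; first by split=> //; apply: spec_sub1.
- by rewrite rmorph1 oner_neq0.
- by rewrite rmorph1 divr1.
- by rewrite rmorph1 divr1.
Qed.

Lemma specN f g : spec f g -> spec (- f) (- g).
Proof.
move=> [n [m [[ns ms] m0 -> ->]]]; exists (- n), m.
by rewrite !rmorphN !mulNr; split=> //; split=> //; apply: subN.
Qed.

Lemma specD f g f' g' : spec f g -> spec f' g' -> spec (f + f') (g + g').
Proof.
move=> [n [m [[ns ms] m0 -> ->]]] [n' [m' [[ns' ms'] m'0 -> ->]]].
exists (n * m' + n' * m), (m * m'); split.
- by split; [apply: subD|]; apply: spec_subM.
- by rewrite rmorphM mulf_neq0.
- by rewrite addf_div ?src_neq0 // rmorphD !rmorphM.
- by rewrite addf_div // rmorphD !rmorphM.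
Qed.

Lemma specM f g f' g' : spec f g -> spec f' g' -> spec (f * f') (g * g').
Proof.
move=> [n [m [[ns ms] m0 -> ->]]] [n' [m' [[ns' ms'] m'0 -> ->]]].
exists (n * n'), (m * m'); split.
- by split; apply: spec_subM.
- by rewrite rmorphM mulf_neq0.
- by rewrite mulf_div !rmorphM.
- by rewrite mulf_div !rmorphM.
Qed.

Lemma specV f g : g != 0 -> spec f g -> spec f^-1 g^-1.
Proof.
move=> g0 [n [m [[ns ms] m0 -> ge]]]; move: g0; rewrite ge.
rewrite mulf_eq0 invr_eq0 (negPf m0) orbF => n0.
by exists m, n; rewrite !invf_div.
Qed.

Lemma spec1 : spec 1 1.
Proof. by have := spec_of (spec_sub1 D); rewrite !rmorph1. Qed.

Lemma spec0 : spec 0 0.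
Proof. by have := spec_of sub0; rewrite !rmorph0. Qed.

Lemma specX f g n : spec f g -> spec (f ^+ n) (g ^+ n).
Proof.
move=> fg; elim: n => [|n IH]; first exact: spec1.
by rewrite !exprS; apply: specM.
Qed.

Lemma spec_nat n : spec n%:R n%:R.
Proof.
elim: n => [|n IH]; first exact: spec0.
by rewrite -!natr1; apply: specD => //; apply: spec1.
Qed.

Lemma specMn f g n : spec f g -> spec (f *+ n) (g *+ n).
Proof. by move=> fg; rewrite -mulr_natr -[g *+ n]mulr_natr; apply: specM fg (spec_nat n). Qed.

Lemma specMz f g z : spec f g -> spec (f *~ z) (g *~ z).
Proof. by move=> fg; case: z => n; [|apply: specN]; apply: specMn. Qed.

Lemma spec_sum I (r : seq I) (f : I -> L) (g : I -> F) :
  (forall i, spec (f i) (g i)) -> spec (\sum_(i <- r) f i) (\sum_(i <- r) g i).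
Proof.
move=> fg; elim: r => [|i r IH]; first by rewrite !big_nil; apply: spec0.
by rewrite !big_cons; apply: specD.
Qed.

Lemma spec_prod I (r : seq I) (f : I -> L) (g : I -> F) :
  (forall i, spec (f i) (g i)) -> spec (\prod_(i <- r) f i) (\prod_(i <- r) g i).
Proof.
move=> fg; elim: r => [|i r IH]; first by rewrite !big_nil; apply: spec1.
by rewrite !big_cons; apply: specM.
Qed.

Lemma spec_mmap n (B : nzRingType) (c : {rmorphism B -> L}) (c' : {rmorphism B -> F})
    (h : 'I_n -> L) (h' : 'I_n -> F) (p : {mpoly B[n]}) :
  (forall b, spec (c b) (c' b)) -> (forall i, spec (h i) (h' i)) ->
  spec (mmap c h p) (mmap c' h' p).
Proof.
move=> cs hs; apply: spec_sum => m; apply: specM => //.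
by apply: spec_prod => i; apply: specX.
Qed.

Lemma spec_eq0 g : spec 0 g -> g = 0.
Proof.
move=> [n [m [[ns ms] m0 /esym/eqP + ->]]].
rewrite mulf_eq0 invr_eq0 (negPf (src_neq0 ms m0)) orbF => /eqP/(spec_ker ns) ->.
by rewrite mul0r.
Qed.

(** The standard way below to show that a denominator is nonzero: it suffices that one
    specialization of it is. *)
Lemma spec_neq0 f g : spec f g -> g != 0 -> f != 0.
Proof. by move=> fg; apply: contra_neq => f0; apply: spec_eq0; rewrite -f0. Qed.

End Spec.

Ltac spec_step := first
  [ assumption | apply: specD | apply: specN | apply: specM | apply: specV
  | apply: specX | apply: spec_nat | apply: spec1 | apply: spec0
  | apply: specMz | apply: specMn ].
Ltac spec_tac := repeat spec_step.

Section SpecFrac.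
Variables (P : idomainType) (F : fieldType) (k : {rmorphism P -> F}).

Lemma frac_spec_ker (x : P) : True -> toFrac P x = 0 -> k x = 0.
Proof. by move=> _ /eqP; rewrite toFrac_eq0 => /eqP ->; rewrite rmorph0. Qed.

Definition fracSpec : specData (fracField P) F :=
  @SpecData _ _ P (fun=> True) (toFrac P) k I (fun _ _ _ _ => I) (fun _ _ _ _ => I)
    frac_spec_ker.

Lemma fracSpec_of x : spec fracSpec (toFrac P x) (k x).
Proof. exact: (@spec_of _ _ fracSpec x I). Qed.

Lemma fracSpec_lift (H : {rmorphism fracField P -> F}) :
  (forall x, H (toFrac P x) = k x) ->
  forall f g, spec fracSpec f g -> H f = g.
Proof. by move=> HE _ _ [n [m [_ _ -> ->]]]; rewrite fmorph_div !HE. Qed.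

End SpecFrac.

Definition vec3 (F : Type) (t q p : F) (i : 'I_3) : F :=
  match val i with 0%N => t | 1%N => q | _ => p end.

Lemma spec_vec3 (L F : fieldType) (D : specData L F) t q p t' q' p' i :
  spec D t t' -> spec D q q' -> spec D p p' ->
  spec D (vec3 t q p i) (vec3 t' q' p' i).
Proof. by case: i => -[|[|?]] ?. Qed.

(** * Substitutions into rational functions of t, q, p *)

Section RatFunTheory.
Variable B : idomainType.
Local Notation KB := (ratfun B).
Local Notation PB := {mpoly B[3]}.

Lemma ratfun_ofE x : ratfun_of x = toFrac PB x. Proof. by []. Qed.

Definition coefR : {rmorphism B -> KB} :=
  toFrac PB \o @mpolyC 3 B : {rmorphism B -> fracField PB}.

Lemma coefRE b : coefR b = coefF b. Proof. by []. Qed.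

Lemma coefF_inj : injective (@coefF B).
Proof.
move=> x y /eqP; rewrite /coefF !ratfun_ofE toFrac_eq => /eqP e.
have := congr1 (mcoeff 0%MM) e; by rewrite !mcoeffC eqxx !mulr1.
Qed.

Lemma mmap_ratfun (p : PB) :
  mmap coefR (vec3 (var_t B) (var_q B) (var_p B)) p = ratfun_of p.
Proof.
apply: (@mpoly_rmorph_ext 3 B KB (mmap coefR _) (toFrac PB : {rmorphism PB -> KB})).
- by move=> c; rewrite [LHS]mmapC.
- move=> i; rewrite [LHS]mmapXU.
  by case: i => -[|[|[|?]]] //= h; rewrite /vec3 /=; congr (toFrac PB 'X__);
    apply: val_inj.
Qed.

Section Rational.
Variables (F : fieldType) (c : {rmorphism B -> F}) (t q p : F).

Definition evalR : {rmorphism PB -> F} := mmap c (vec3 t q p).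
Definition evalSpec : specData KB F := fracSpec evalR.

Lemma evalSpec_coef b : spec evalSpec (coefF b) (c b).
Proof. by have := fracSpec_of evalR b%:MP; rewrite /= mmapC. Qed.
Lemma evalSpec_t : spec evalSpec (var_t B) t.
Proof. by have := fracSpec_of evalR 'X_(@Ordinal 3 0 isT); rewrite /= mmapXU. Qed.
Lemma evalSpec_q : spec evalSpec (var_q B) q.
Proof. by have := fracSpec_of evalR 'X_(@Ordinal 3 1 isT); rewrite /= mmapXU. Qed.
Lemma evalSpec_p : spec evalSpec (var_p B) p.
Proof. by have := fracSpec_of evalR 'X_(@Ordinal 3 2 isT); rewrite /= mmapXU. Qed.

Lemma ratfun_lift : (forall x, evalR x = 0 -> x = 0) ->
  exists s : {rmorphism KB -> F},
    [/\ forall b, s (coefF b) = c b, s (var_t B) = t, s (var_q B) = q,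
        s (var_p B) = p & forall f g, spec evalSpec f g -> s f = g].
Proof.
move=> kI; have [s sE] := frac_lift kI; exists s.
have sP := @fracSpec_lift _ _ evalR s sE.
split=> // [b|||]; apply: sP.
- exact: evalSpec_coef.
- exact: evalSpec_t.
- exact: evalSpec_q.
- exact: evalSpec_p.
Qed.
End Rational.

(** The hypotheses say that substituting into the images of the generators gives the generators
    back. Since [spec] respects the operations, the image of any polynomial [x] specializes to [x].
    An [x] of image 0 is then 0 by [spec_eq0], so the substitution extends to fractions, and the
    same relation says that it squares to the identity. *)
Lemma ratfun_involution (c : {rmorphism B -> KB}) (t q p : KB) :
  let D := evalSpec c t q p in
  (forall b, spec D (c b) (coefF b)) -> spec D t (var_t B) ->
  spec D q (var_q B) -> spec D p (var_p B) ->
  exists s : {rmorphism KB -> KB},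
    [/\ forall b, s (coefF b) = c b, s (var_t B) = t /\ s (var_q B) = q,
        s (var_p B) = p, involutive s & forall f g, spec D f g -> s f = g].
Proof.
move=> D cD tD qD pD.
have kD x : spec D (evalR c t q p x) (toFrac PB x).
  rewrite -ratfun_ofE -mmap_ratfun; apply: spec_mmap => // i.
  exact: spec_vec3.
have [|s [sc st sq sp sP]] := @ratfun_lift _ c t q p.
  by move=> x x0; move: (kD x); rewrite x0 => /spec_eq0/eqP; rewrite toFrac_eq0 => /eqP.
exists s; split=> // f; case: (@fracE PB f) => -[n m] /= m0 ->.
have sk x : s (toFrac PB x) = evalR c t q p x by apply: sP; apply: fracSpec_of.
by rewrite !fmorph_div !sk !(sP _ _ (kD _)).
Qed.

End RatFunTheory.

(** * Bäcklund transformations *)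

Section Reflections.
Variable R : realType.
Local Notation C := (Cplx R).
Implicit Types J : painleve.

Definition constK J : {rmorphism C -> K R J} :=
  coefR (paramRing R J) \o @mpolyC (rank J) C : {rmorphism C -> K R J}.

Lemma constKE J c : constK J c = coefF (c%:MP : paramRing R J). Proof. by []. Qed.

Lemma natK_neq0 J n : n.+1%:R != 0 :> K R J.
Proof. by rewrite -(rmorph_nat (constK J)) fmorph_eq0 pnatr_eq0. Qed.

Lemma coef_mmap J (b : paramRing R J) :
  coefF b = mmap (constK J) (fun k => alpha R (lift ord0 k)) b.
Proof.
apply: (@mpoly_rmorph_ext _ C (K R J) (coefR (paramRing R J)) (mmap (constK J) _)).
- by move=> c; rewrite [RHS]mmapC.
- by move=> i; rewrite [RHS]mmapXU /alpha /param liftK.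
Qed.

Lemma alpha_normalization J :
  \sum_(j < (rank J).+1) alpha R j *+ mark J j = 1 :> K R J.
Proof.
rewrite -(rmorph1 (coefR (paramRing R J))) -(param_normalization R J) rmorph_sum.
by apply: eq_bigr => j _; rewrite rmorphMn.
Qed.

(** The marks lie in the kernel of the affine Cartan matrix; equivalently, s_i fixes the null root,
    which is why it respects the normalization. *)
Lemma mark_cartan J (i : 'I_(rank J).+1) :
  \sum_(j < (rank J).+1) cartan J i j *+ mark J j = 0.
Proof.
case: J i => -[i hi]; do 6?[case: i hi => [|i] hi //];
by rewrite /= !big_ord_recl big_ord0.
Qed.

Lemma cartan_diag J (i : 'I_(rank J).+1) : cartan J i i = 2.
Proof. by case: J i => -[i hi]; do 6?[case: i hi => [|i] hi //]. Qed.

Lemma mark0 J : mark J 0 = 1%N. Proof. by case: J. Qed.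

(** A substitution prescribes only alpha_1, ..., alpha_n; the eliminated alpha_0 gets the right
    image because the prescribed values are normalized and alpha_0 has mark 1. *)
Lemma param_image J (F : comNzRingType) (c : {rmorphism C -> F})
    (a : 'I_(rank J).+1 -> F) :
  \sum_(j < (rank J).+1) a j *+ mark J j = 1 ->
  forall j, mmap c (fun k => a (lift ord0 k)) (param R j : {mpoly C[rank J]}) = a j.
Proof.
move=> norm j; rewrite /param; case: unliftP => [k|] ->; first by rewrite mmapXU.
rewrite rmorphB rmorph1 rmorph_sum -norm big_ord_recl mark0 mulr1n.
rewrite [X in _ - X](eq_bigr (fun k => a (lift ord0 k) *+ mark J k.+1)) ?addrK //.
by move=> k _; rewrite rmorphMn /= mmapXU.
Qed.

Lemma s_param_normalization J (i : 'I_(rank J).+1) :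
  \sum_(j < (rank J).+1) s_param R i j *+ mark J j = 1.
Proof.
rewrite -[RHS](alpha_normalization J) -[RHS]subr0.
rewrite -[X in _ - X](mulr0z (alpha R i)) -(mark_cartan i) mulrz_sumr -sumrB.
by apply: eq_bigr => j _; rewrite mulrnBl -[X in _ = _ - _ *~ X]mulr_natr mulrzA natz -pmulrn.
Qed.

(** The function by which s_i divides, 1 if there is none. It is invariant under s_i ([s_tqp_den]),
    so that the shift with [- a] undoes the shift with [a]. *)
Definition s_den (F : fieldType) J (i : nat) (t q p : F) : F :=
  match J, i with
  | PVI, 0%N => q - t
  | PVI, 2%N => p
  | PVI, 3%N => q - 1
  | PVI, 4%N => q
  | PV, 0%N => p + t
  | PV, 1%N => q
  | PV, 2%N => p
  | PV, 3%N => q - 1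
  | PIV, 0%N => 2 * p - q - 2 * t
  | PIV, 1%N => q
  | PIV, 2%N => p
  | PIII, 0%N => p
  | PIII, 1%N => q
  | PIII, 2%N => p - 1
  | PII, 0%N => p - 2 * q ^+ 2 - t
  | PII, 1%N => p
  | _, _ => 1
  end.

Lemma s_tqp_den (F : fieldType) J i (a t q p : F) : s_den J i t q p != 0 ->
  s_den J i (s_tqp J i a t q p).1.1 (s_tqp J i a t q p).1.2 (s_tqp J i a t q p).2
  = s_den J i t q p.
Proof. by case: J; do 6?[case: i => [|i] //=]; rewrite /= => h; field. Qed.

Lemma s_tqp_inv (F : fieldType) J i (a t q p : F) : s_den J i t q p != 0 ->
  s_tqp J i (- a) (s_tqp J i a t q p).1.1 (s_tqp J i a t q p).1.2 (s_tqp J i a t q p).2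
  = (t, q, p).
Proof.
move=> h; have := s_tqp_den a h.
case: J h; do 6?[case: i => [|i] //=]; rewrite /= => h.
all: try by (move=> _; congr (_, _, _); field).
(* Where q and p both move, the denominator after the shift is not literally the old one; its
   invariance replaces it before [field] runs. *)
all: move=> ->; congr (_, _, _); field; by [].
Qed.

Lemma spec_s_tqp (L F : fieldType) (D : specData L F) J i a t q p a' t' q' p' :
  s_den J i t' q' p' != 0 ->
  spec D a a' -> spec D t t' -> spec D q q' -> spec D p p' ->
  [/\ spec D (s_tqp J i a t q p).1.1 (s_tqp J i a' t' q' p').1.1,
      spec D (s_tqp J i a t q p).1.2 (s_tqp J i a' t' q' p').1.2 &
      spec D (s_tqp J i a t q p).2 (s_tqp J i a' t' q' p').2].
Proof.
by case: J; do 6?[case: i => [|i] //=]; rewrite /= => h *; split;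
  spec_tac; rewrite ?expf_neq0.
Qed.

Lemma spec_s_den (L F : fieldType) (D : specData L F) J i t q p t' q' p' :
  spec D t t' -> spec D q q' -> spec D p p' ->
  spec D (s_den J i t q p) (s_den J i t' q' p').
Proof. by case: J; do 6?[case: i => [|i] //=]; rewrite /= => *; spec_tac. Qed.

(** At (t, q, p) = (0, 2, 5) the denominators take the values 1, 2, 4, 5, 8 and, for s_0 of P_II,
    -3, all nonzero in characteristic 0. *)
Lemma s_den_point (F : fieldType) J i : (forall n, n.+1%:R != 0 :> F) ->
  s_den J i (0 : F) 2 5 != 0.
Proof.
move=> char0.
have nz x n : x = n.+1%:R -> x != 0 :> F by move=> ->; apply: char0.
case: J; do 6?[case: i => [|i] //=]; rewrite /= ?oner_eq0 //.
all: first [apply: (nz _ 0%N); ring | apply: (nz _ 1%N); ring |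
  apply: (nz _ 3%N); ring | apply: (nz _ 4%N); ring | apply: (nz _ 7%N); ring |
  rewrite -oppr_eq0; apply: (nz _ 2%N); ring].
Qed.

Lemma s_den_neq0 J i :
  s_den J i (var_t (paramRing R J)) (var_q _) (var_p _) != 0.
Proof.
have := spec_s_den J i (evalSpec_t (coefR (paramRing R J)) 0 2 5)
  (evalSpec_q _ 0 2 5) (evalSpec_p _ 0 2 5).
by move/spec_neq0; apply; apply: s_den_point; apply: natK_neq0.
Qed.

Lemma rmorph_field_automorphism (F : fieldType) (s : {rmorphism F -> F}) :
  bijective s -> field_automorphism s.
Proof. by split=> //; [exact: raddfB|split; [exact: rmorph1|exact: rmorphM]]. Qed.

(** [is_s] only specifies s_i, so the automorphism has to be constructed. [ratfun_involution]
    applies: on the parameters because the diagonal Cartan entries are 2, on the variables by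
    [s_tqp_inv]. *)
Lemma s_exists J (i : 'I_(rank J).+1) :
  exists s : {rmorphism K R J -> K R J}, is_s i s /\ involutive s.
Proof.
pose t := var_t (paramRing R J); pose q := var_q (paramRing R J).
pose p := var_p (paramRing R J).
pose c := mmap (constK J) (fun k => s_param R i (lift ord0 k))
  : {rmorphism paramRing R J -> K R J}.
have cC a : c (a%:MP : {mpoly C[rank J]}) = constK J a by exact: mmapC.
have cE j : c (param R j) = s_param R i j.
  exact/param_image/s_param_normalization.
pose s3 := s_tqp J i (alpha R i) t q p.
pose D := evalSpec c s3.1.1 s3.1.2 s3.2.
have Da j : spec D (alpha R j) (s_param R i j).
  by rewrite -cE; apply: evalSpec_coef.
have sii : s_param R i i = - alpha R i.
  by rewrite /s_param cartan_diag mulrz_nat mulr2n opprD addrA subrr sub0r.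
have Ds j : spec D (s_param R i j) (alpha R j).
  have -> : alpha R j = s_param R i j - s_param R i i *~ cartan J i j.
    by rewrite sii /s_param mulNrz opprK subrK.
  by apply: specD => //; apply/specN/specMz.
have d0 := s_den_neq0 J i.
have [] := @spec_s_tqp _ _ D J i (alpha R i) t q p _ s3.1.1 s3.1.2 s3.2 _ (Da i)
  (evalSpec_t _ _ _ _) (evalSpec_q _ _ _ _) (evalSpec_p _ _ _ _).
  by rewrite s_tqp_den.
rewrite sii s_tqp_inv //= => Dt Dq Dp.
have [|s [sc [st sq] sp sK _]] := @ratfun_involution _ c s3.1.1 s3.1.2 s3.2 _ Dt Dq Dp.
  move=> b; rewrite coef_mmap; apply: spec_mmap => // a.
  by have := evalSpec_coef c s3.1.1 s3.1.2 s3.2 a%:MP; rewrite cC.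
exists s; split=> //; split.
- by apply: rmorph_field_automorphism; exists s.
- by move=> a; rewrite sc cC.
- by move=> j; rewrite sc cE.
- by rewrite st sq sp /s3; case: (s_tqp _ _ _ _ _ _) => -[].
Qed.

End Reflections.

(* The reflection in the combination of old parameters that the change of parameters
   equates with [A_i]; for [s_1] of [PIII], where [2 A_1] is the sum of two orthogonal
   roots, the product of the two reflections. *)
Definition S_word (d : degeneration) (i : nat) : seq nat :=
  nth [::] match d with
  | VI_V => [:: [:: 0; 3; 2; 3; 0]; [:: 4]; [:: 2]; [:: 1]]
  | V_IV => [:: [:: 0; 3; 0]; [:: 1]; [:: 2]]
  | V_III => [:: [:: 2]; [:: 1; 3]; [:: 0]]
  | IV_II => [:: [:: 0; 1; 0]; [:: 2]]
  | III_II => [:: [:: 1; 2; 1]; [:: 0]]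
  end%N i.

(** Closed forms for the words of several letters; [r] is the combination of old parameters that
    equals A_i (2 A_1 for V -> III), and every parameter moves by an integer multiple of [r], except
    for V -> III where the two orthogonal reflections contribute separately. *)
Definition S_al (F : fieldType) (d : degeneration) (i : nat) (a : nat -> F)
    (j : nat) : F :=
  match d, i with
  | VI_V, 0%N => let r := a 0%N + a 2%N + a 3%N in
      nth 0 [:: - (a 2%N + a 3%N); a 1%N + r; a 2%N; - (a 0%N + a 2%N); a 4%N + r] j
  | V_IV, 0%N => let r := a 0%N + a 3%N in
      nth 0 [:: - a 3%N; a 1%N + r; a 2%N + r; - a 0%N] j
  | V_III, 1%N => let r := a 1%N + a 3%N in
      nth 0 [:: a 0%N + r; - a 1%N; a 2%N + r; - a 3%N] j
  | IV_II, 0%N => let r := a 0%N + a 1%N in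
      nth 0 [:: - a 1%N; - a 0%N; a 2%N + 2 * r] j
  | III_II, 0%N => let r := 2 * a 1%N + a 2%N in
      nth 0 [:: a 0%N + 2 * r; - (a 1%N + a 2%N); a 2%N] j
  | _, _ => let n := head 0%N (S_word d i) in
      a j - a n *~ cartan (source d) n j
  end.

(** For V_IV and IV_II the nested fractions of the word are collected over a single denominator,
    which later makes the cancellation for small eps visible; the other formulas keep the shape of
    the composition. *)
Definition S_tqp (F : fieldType) (d : degeneration) (i : nat) (a : nat -> F)
    (t q p : F) : F * F * F :=
  match d, i with
  | VI_V, 0%N =>
      let r := a 0%N + a 2%N + a 3%N in
      let f := p - a 3%N / (q - 1) - a 0%N / (q - t) in
      let q' := q + r / f in
      (t, q', f - (a 0%N + a 2%N) / (q' - 1) - (a 2%N + a 3%N) / (q' - t))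
  | V_IV, 0%N =>
      let r := a 0%N + a 3%N in
      let f := p + t in let g := q - 1 in
      (t, q + r * g / (f * g - a 3%N), p - r * f / (f * g + a 0%N))
  | V_III, 1%N => (t, q, p - a 1%N / q - a 3%N / (q - 1))
  | IV_II, 0%N =>
      let r := a 0%N + a 1%N in
      let f := 2 * p - q - 2 * t in
      (t, q * (f * q + 2 * a 0%N) / (f * q - 2 * a 1%N),
       p + r * q / (f * q - 2 * a 1%N) - r * f / (f * q + 2 * a 0%N))
  | III_II, 0%N =>
      let r := 2 * a 1%N + a 2%N in
      let p' := p - 2 * a 1%N / q + t / q ^+ 2 in
      let q' := q + r / (p' - 1) in
      (t, q', p' - 2 * (a 1%N + a 2%N) / q' - t / q' ^+ 2)
  | _, _ => let n := head 0%N (S_word d i) in s_tqp (source d) n (a n) t q p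
  end.

(** The two words whose nested fractions are collected need the collected denominators to be
    nonzero; the other formulas mirror the composition term by term, hence [True]. *)
Definition S_nondeg (F : fieldType) (d : degeneration) (a : nat -> F) (t q p : F) : Prop :=
  match d with
  | V_IV => [/\ p + t != 0, q - 1 != 0, (p + t) * (q - 1) - a 3%N != 0
              & (p + t) * (q - 1) + a 0%N != 0]
  | IV_II => [/\ 2 * p - q - 2 * t != 0, q != 0,
                 (2 * p - q - 2 * t) * q - 2 * a 1%N != 0
               & (2 * p - q - 2 * t) * q + 2 * a 0%N != 0]
  | _ => True
  end.

Section Words.
Variables (F : fieldType) (d : degeneration).
Local Notation J := (source d).
Variables (s : nat -> {rmorphism F -> F}) (a : nat -> F) (t q p : F).
Hypothesis s_a : forall n j, (n <= rank J)%N -> (j <= rank J)%N ->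
  s n (a j) = a j - a n *~ cartan J n j.
Hypothesis s_v : forall n, (n <= rank J)%N ->
  (s n t, s n q, s n p) = s_tqp J n (a n) t q p.

Let Sw i x := foldr (fun n y => s n y) x (S_word d i).

Let mz (x : F) : (x *~ (-1) = - x) * (x *~ (- 2)%R = - (2 * x)) *
  (x *~ 2 = 2 * x) * (x *~ 0 = 0) * (x *~ 1 = x).
Proof. by rewrite !mulrNz mulr1z mulr0z mulrz_nat mulr_natl. Qed.

Lemma S_al_word i j : (i <= rank (target d))%N -> (j <= rank J)%N ->
  Sw i (a j) = S_al d i a j.
Proof.
rewrite /Sw; case: d s_a i j => sa i j.
all: do 6?[case: i => [|i] //]; move=> _.
all: try by move=> jr; rewrite /= sa.
all: do 6?[case: j => [|j] //]; move=> _.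
all: rewrite /S_al /=.
all: rewrite sa //=; do 5?[rewrite !(raddfB, raddfMz) /=; do ?rewrite sa //=].
all: rewrite ?mz; ring.
Qed.

Lemma S_tqp_word i : (i <= rank (target d))%N -> S_nondeg d a t q p ->
  (Sw i t, Sw i q, Sw i p) = S_tqp d i a t q p.
Proof.
have al := S_al_word; move: al; rewrite /Sw.
case: d s_a s_v i => sa sv i al.
all: do 6?[case: i => [|i] //]; move=> _ nd; rewrite /Sw /S_tqp /=.
all: try by apply: sv.
- have [s0t s0q s0p] := sv 0%N isT; have [s2t s2q s2p] := sv 2%N isT.
  have [s3t s3q s3p] := sv 3%N isT.
  have a32 : s 3%N (a 2%N) = a 2%N + a 3%N by rewrite sa //= mz; ring.
  have a02 : s 0%N (a 2%N) = a 2%N + a 0%N by rewrite sa //= mz; ring.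
  have a03 : s 0%N (a 3%N) = a 3%N by rewrite sa //= mz; ring.
  have a00 : s 0%N (a 0%N) = - a 0%N by rewrite sa //= mz; ring.
  have a30 : s 3%N (a 0%N) = a 0%N by rewrite sa //= mz; ring.
  have a33 : s 3%N (a 3%N) = - a 3%N by rewrite sa //= mz; ring.
  have a20 : s 2%N (a 0%N) = a 0%N + a 2%N by rewrite sa //= mz; ring.
  have a23 : s 2%N (a 3%N) = a 3%N + a 2%N by rewrite sa //= mz; ring.
  do 9?[rewrite ?(s0t, s2t, s3t, s0q, s2q, s3q, s0p, s2p, s3p, a32, a02, a03, a00, a30, a33, a20, a23)
    ?(fmorph_div, rmorphD, rmorphN, rmorph1)].
  have -> : a 2%N + a 0%N + a 3%N = a 0%N + a 2%N + a 3%N by ring.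
  have -> : p - a 0%N / (q - t) - a 3%N / (q - 1) = p - a 3%N / (q - 1) - a 0%N / (q - t) by ring.
  set f := p - _ - _; set q' := q + _.
  by congr (_, _, _); congr (_ - _ / _ - _ / _); ring.
- have [s0t s0q s0p] := sv 0%N isT; have [s3t s3q s3p] := sv 3%N isT.
  have a03 : s 0%N (a 3%N) = a 3%N + a 0%N by rewrite sa //= mz; ring.
  have a00 : s 0%N (a 0%N) = - a 0%N by rewrite sa //= mz; ring.
  have a30 : s 3%N (a 0%N) = a 0%N + a 3%N by rewrite sa //= mz; ring.
  have a33 : s 3%N (a 3%N) = - a 3%N by rewrite sa //= mz; ring.
  do 9?[rewrite ?(s0t, s3t, s0q, s3q, s0p, s3p, a03, a00, a30, a33)
    ?(fmorph_div, rmorphD, rmorphN, rmorph1)].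
  case: nd => n1 n2 n3 n4; congr (_, _, _); field; rewrite ?n1 ?n2 ?n3 ?n4 //=.
  apply/andP; split.
  + by rewrite (_ : _ + _ = (p + t) * (q - 1) + a 0%N) //; ring.
  + rewrite (_ : _ + _ = (p + t) * ((p + t) * (q - 1) - a 3%N)) ?mulf_neq0 //; ring.
- have [s1t s1q s1p] := sv 1%N isT; have [s3t s3q s3p] := sv 3%N isT.
  have a13 : s 1%N (a 3%N) = a 3%N by rewrite sa //= mz; ring.
  do 9?[rewrite ?(s1t, s3t, s1q, s3q, s1p, s3p, a13)
    ?(fmorph_div, rmorphD, rmorphN, rmorph1)].
  by [].
- have [s0t s0q s0p] := sv 0%N isT; have [s1t s1q s1p] := sv 1%N isT.
  have a01 : s 0%N (a 1%N) = a 1%N + a 0%N by rewrite sa //= mz; ring.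
  have a00 : s 0%N (a 0%N) = - a 0%N by rewrite sa //= mz; ring.
  have a10 : s 1%N (a 0%N) = a 0%N + a 1%N by rewrite sa //= mz; ring.
  have a11 : s 1%N (a 1%N) = - a 1%N by rewrite sa //= mz; ring.
  do 9?[rewrite ?(s0t, s1t, s0q, s1q, s0p, s1p, a01, a00, a10, a11)
    ?(fmorphV, rmorphD, rmorphN, rmorphM, rmorph1, rmorph_nat)].
  case: nd => n1 n2 n3 n4.
  have n4' : q * (2 * p - q - 2 * t) + 2 * a 0%N != 0 by rewrite [q * _]mulrC.
  have n3' : forall x, x = (2 * p - q - 2 * t) ^+ 2 *
      ((2 * p - q - 2 * t) * q - 2 * a 1%N) -> x != 0.
    by move=> _ ->; rewrite mulf_neq0 ?expf_neq0.
  congr (_, _, _); field; rewrite ?n1 ?n2 ?n3 ?n4 //=.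
  + by rewrite n4'; apply: n3'; ring.
  + by apply: n3'; ring.
- have [s1t s1q s1p] := sv 1%N isT; have [s2t s2q s2p] := sv 2%N isT.
  have a11 : s 1%N (a 1%N) = - a 1%N by rewrite sa //= mz; ring.
  have a12 : s 1%N (a 2%N) = 2 * a 1%N + a 2%N by rewrite sa //= mz; ring.
  have a21 : s 2%N (a 1%N) = a 1%N + a 2%N by rewrite sa //= mz; ring.
  do 9?[rewrite ?(s1t, s2t, s1q, s2q, s1p, s2p, a11, a12, a21)
    ?(fmorphV, rmorphD, rmorphN, rmorphM, rmorphXn, rmorph1, rmorph_nat)].
  congr (_, _, _).
  + by rewrite opprK.
  + by rewrite mulNr -expr2; congr (_ - _ / _ - _); ring.
Qed.

End Words.

(** * The generators of W_J and the words S_i as automorphisms of K_J *)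

Section PainleveEval.
Variables (R : realType) (J : painleve) (F : fieldType) (c : {rmorphism Cplx R -> F}).
Variables (a : nat -> F) (t q p : F).
Hypothesis a_normalization : \sum_(j < (rank J).+1) a j *+ mark J j = 1.

Definition paramEval : {rmorphism paramRing R J -> F} :=
  mmap c (fun k : 'I_(rank J) => a k.+1).

Definition painleveSpec : specData (K R J) F := evalSpec paramEval t q p.

Lemma paramEval_param j : paramEval (param R j) = a j.
Proof. exact: (@param_image R J F c (fun j => a j)). Qed.

Lemma painleveSpec_alpha j : spec painleveSpec (alpha R j) (a j).
Proof. by rewrite -paramEval_param; apply: evalSpec_coef. Qed.

End PainleveEval.

Definition al (R : realType) J (n : nat) : K R J := alpha R (inord n).

Section Generators.
Variable R : realType.
Implicit Types J : painleve.

Definition sK J (n : nat) : {rmorphism K R J -> K R J} :=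
  sval (cid (s_exists R (inord n : 'I_(rank J).+1))).

Lemma sKP J n : is_s (inord n) (sK J n).
Proof. by rewrite /sK; case: cid => s []. Qed.

Lemma sKK J n : involutive (sK J n).
Proof. by rewrite /sK; case: cid => s []. Qed.

Lemma sK_al J n j : (n <= rank J)%N -> (j <= rank J)%N ->
  sK J n (al R J j) = al R J j - al R J n *~ cartan J n j.
Proof.
by move=> nJ jJ; have [_ _ -> _] := sKP J n; rewrite /s_param !inordK.
Qed.

Lemma sK_tqp J n : (n <= rank J)%N ->
  (sK J n (var_t _), sK J n (var_q _), sK J n (var_p _)) =
  s_tqp J n (al R J n) (var_t _) (var_q _) (var_p _).
Proof. by move=> nJ; have [_ _ _ ->] := sKP J n; rewrite inordK. Qed.

Fixpoint wordK J (w : seq nat) : {rmorphism K R J -> K R J} :=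
  if w is n :: w' then sK J n \o wordK J w' else idfun.

Lemma wordKE J w x : wordK J w x = foldr (fun n y => sK J n y) x w.
Proof. by elim: w => //= n w ->. Qed.

Lemma wordK_const J w z : wordK J w (constK R J z) = constK R J z.
Proof. by elim: w => //= n w ->; have [_ ->] := sKP J n. Qed.

Lemma W_wordK J w : W (wordK J w).
Proof.
elim: w => [|n w IH] /=; first exact: generated_one.
by apply: generated_mul => //; apply: generated_gen; exists (inord n); apply: sKP.
Qed.

Lemma wordK_rev J w : cancel (wordK J w) (wordK J (rev w)).
Proof.
move=> x; rewrite !wordKE; elim: w => //= n w IH.
by rewrite rev_cons foldr_rcons sKK IH.
Qed.

Lemma wordK_aut J w : bijective (wordK J w).
Proof.
exists (wordK J (rev w)); first exact: wordK_rev.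
by move=> x; rewrite -{1}[w]revK; apply: wordK_rev.
Qed.

Definition degK d (i : nat) : {rmorphism K R (source d) -> K R (source d)} :=
  wordK (source d) (S_word d i).

Lemma degK_al d i j : (i <= rank (target d))%N -> (j <= rank (source d))%N ->
  degK d i (al R (source d) j) = S_al d i (al R (source d)) j.
Proof.
move=> ir jr; rewrite /degK wordKE.
by apply: (S_al_word (s := sK (source d)) (@sK_al (source d))).
Qed.

(** Tested at alpha_0 = 1, the other parameters 0 and (t, q, p) = (0, 2, 5): the values are 5, 1, 5,
    6 for P_V and 8, 2, 16, 18 for P_IV. *)
Lemma degK_nondeg d :
  S_nondeg d (al R (source d)) (var_t _) (var_q _) (var_p _).
Proof.
have sp J : let D := @painleveSpec R J _ idfun (fun n => (n == 0%N)%:R) 0 2 5 in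
    [/\ forall n, (n <= rank J)%N -> spec D (al R J n) (n == 0%N)%:R,
     spec D (var_t _) 0, spec D (var_q _) 2 & spec D (var_p _) 5].
  move=> D; split; [|exact: evalSpec_t|exact: evalSpec_q|exact: evalSpec_p].
  move=> n nJ; have := @painleveSpec_alpha R J _ idfun (fun n => (n == 0%N)%:R) 0 2 5 _ (inord n).
  rewrite inordK //; apply; rewrite big_ord_recl mark0 big1 ?addr0 //.
  by move=> i _; rewrite mul0rn.
have nz n x : x = n.+1%:R -> x != 0 :> Cplx R by move=> ->; rewrite pnatr_eq0.
have gen (L : fieldType) (D : specData L (Cplx R)) (f : L) (g : Cplx R) n :
  spec D f g -> g = n.+1%:R -> f != 0.
  by move=> fg gn; apply: (spec_neq0 fg); apply: nz gn.
case: d => //=.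
- have [sa] := sp PV; move: (sa 0%N isT) (sa 3%N isT) => {sa} /=.
  move: (al _ _ _) (al _ _ _) (var_t _) (var_q _) (var_p _) => a3 a0 t q p.
  set D := painleveSpec _ _ _ _ _ _ => sa0 sa3 st sq sp'; split.
  + by apply: (@gen _ D _ (5 + 0) 4%N); [spec_tac|ring].
  + by apply: (@gen _ D _ (2 - 1) 0%N); [spec_tac|ring].
  + by apply: (@gen _ D _ ((5 + 0) * (2 - 1) - 0) 4%N); [spec_tac|ring].
  + by apply: (@gen _ D _ ((5 + 0) * (2 - 1) + 1) 5%N); [spec_tac|ring].
- have [sa] := sp PIV; move: (sa 0%N isT) (sa 1%N isT) => {sa} /=.
  move: (al _ _ _) (al _ _ _) (var_t _) (var_q _) (var_p _) => a3 a0 t q p.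
  set D := painleveSpec _ _ _ _ _ _ => sa0 sa3 st sq sp'; split.
  + by apply: (@gen _ D _ (2 * 5 - 2 - 2 * 0) 7%N); [spec_tac|ring].
  + by apply: (@gen _ D _ 2 1%N); [spec_tac|ring].
  + by apply: (@gen _ D _ ((2 * 5 - 2 - 2 * 0) * 2 - 2 * 0) 15%N); [spec_tac|ring].
  + by apply: (@gen _ D _ ((2 * 5 - 2 - 2 * 0) * 2 + 2 * 1) 17%N); [spec_tac|ring].
Qed.

Lemma degK_tqp d i : (i <= rank (target d))%N ->
  (degK d i (var_t _), degK d i (var_q _), degK d i (var_p _)) =
  S_tqp d i (al R (source d)) (var_t _) (var_q _) (var_p _).
Proof.
move=> ir; rewrite /degK !wordKE.
apply: (S_tqp_word (s := sK (source d)) (@sK_al (source d)) (@sK_tqp (source d)) ir).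
exact: degK_nondeg.
Qed.

(** Off the birational cases all words are palindromes, and reversing a word inverts it because its
    letters are involutions. *)
Lemma degK_involutive d i : ~~ birational d -> (i <= rank (target d))%N ->
  involutive (degK d i).
Proof.
move=> db ir x; rewrite -{2}(@wordK_rev _ (S_word d i) x); congr (wordK _ _ _).
by case: d db ir {x} => //= _; do 4?[case: i => [|i] //].
Qed.

End Generators.

(** * The changes of variables *)

Ltac nz_tac := rewrite /=;
  repeat match goal with |- is_true (_ && _) => apply/andP; split end;
  rewrite ?oppr_eq0 ?oner_eq0 ?mulf_neq0 ?oppr_eq0 ?oner_eq0 //; try assumption.

Section ChangeOfVariables.
Variables (F : fieldType) (d : degeneration).
Implicit Types (A a : nat -> F) (e tau t q p T Q P : F).

Definition old_al A e : seq F :=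
  match d with
  | VI_V => [:: e^-1; A 3%N; A 2%N; A 0%N - A 2%N - e^-1; A 1%N]
  | V_IV => [:: A 0%N + 2^-1 * e ^- 2; A 1%N; A 2%N; - (2^-1 * e ^- 2)]
  | V_III => [:: A 2%N; e^-1; A 0%N; 2 * A 1%N - e^-1]
  | IV_II => [:: A 0%N - 4^-1 * e ^- 6; 4^-1 * e ^- 6; A 1%N]
  | III_II => [:: A 1%N; 4^-1 * e ^- 3; A 0%N - 2^-1 * e ^- 3]
  end.

Lemma size_old_al A e : size (old_al A e) = (rank (source d)).+1.
Proof. by rewrite /old_al; case: d. Qed.

(* [tau_of] is the square root of [- t] introduced by III_II, a dummy otherwise. *)
Definition tau_of e T : F :=
  if d is III_II then (1 + e ^+ 2 * T) / (4 * e ^+ 3) else 1.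

Definition tau_rel tau t : Prop :=
  if d is III_II then t = - tau ^+ 2 else tau = 1.

Definition old_tqp A e T Q P (r2 : F) : F * F * F :=
  match d with
  | VI_V => (1 + e * T, 1 + (Q - 1)^-1, (- A 2%N - (Q - 1) * P) * (Q - 1))
  | V_IV => (2^-1 * e ^- 2 * (1 + 2 * e * T), - (e * Q / (1 - e * Q)),
             - (e^-1 * (1 - e * Q) * (P - e * (A 2%N + Q * P))))
  | V_III => (- (e * T), 1 + Q / (e * T), e * T * P)
  | IV_II => (- (r2^-1 * e ^- 3 * (1 - e ^+ 4 * T)),
              r2^-1 * e ^- 3 * (1 + 2 * e ^+ 2 * Q), r2^-1 * e * P)
  | III_II =>
      let tau := (1 + e ^+ 2 * T) / (4 * e ^+ 3) in
      let x := 1 + 2 * e * Q in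
      let y := P / (2 * e) in
      (- tau ^+ 2, - (tau / x), x / tau * (A 1%N + x * y))
  end.

Definition old_ok e T Q : bool :=
  (e != 0) && match d with
  | VI_V => Q - 1 != 0
  | V_IV => 1 - e * Q != 0
  | V_III => T != 0
  | IV_II => true
  | III_II => (1 + 2 * e * Q != 0) && (1 + e ^+ 2 * T != 0)
  end.

(** Inverse of [old_tqp]. For III_II the new T is rational in tau but not in t, hence tau is an
    argument alongside t. *)
Definition new_tqp A e tau t q p (r2 : F) : F * F * F :=
  match d with
  | VI_V => ((t - 1) / e, 1 + (q - 1)^-1, (- A 2%N - (q - 1) * p) * (q - 1))
  | V_IV => ((2 * e ^+ 2 * t - 1) / (2 * e), q / (e * (q - 1)),
             e * (1 - q) * (A 2%N - p * (1 - q)))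
  | V_III => (- (t / e), - ((q - 1) * t), - (p / t))
  | IV_II => ((1 + r2 * e ^+ 3 * t) / e ^+ 4, (r2 * e ^+ 3 * q - 1) / (2 * e ^+ 2),
              r2 * p / e)
  | III_II => ((4 * e ^+ 3 * tau - 1) / e ^+ 2, (- (tau / q) - 1) / (2 * e),
               2 * e * (p * q + A 1%N) * q / tau)
  end.

Definition new_ok e tau t q : bool :=
  (e != 0) && match d with
  | VI_V | V_IV => q - 1 != 0
  | V_III => t != 0
  | IV_II => true
  | III_II => (q != 0) && (tau != 0)
  end.

Lemma old_newK A e tau t q p (r2 : F) : 2 != 0 :> F -> r2 ^+ 2 = 2 ->
  new_ok e tau t q -> tau_rel tau t ->
  let n := new_tqp A e tau t q p r2 in
  [/\ old_tqp A e n.1.1 n.1.2 n.2 r2 = (t, q, p), old_ok e n.1.1 n.1.2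
    & tau_of e n.1.1 = tau].
Proof.
move=> n2 r22; have r20 : r2 != 0.
  by apply: contra_neq n2 => r20; rewrite -r22 r20 expr0n.
have n4 : 4 != 0 :> F by have -> : 4 = 2 * 2 :> F; [ring|rewrite mulf_neq0].
rewrite /new_ok /old_ok /tau_of /tau_rel /old_tqp /new_tqp.
case: d => /= /andP[e0].
- move=> q1 tauE; rewrite addrAC subrr add0r e0 invr_eq0 q1; split=> //.
  by congr (_, _, _); field; nz_tac.
- move=> q1 tauE; have e1 : 1 - e * (q / (e * (q - 1))) = - (q - 1)^-1.
    by field; nz_tac.
  rewrite e1 oppr_eq0 invr_eq0 q1 e0; split=> //.
  by congr (_, _, _); field; nz_tac.
- move=> t0 tauE; rewrite e0 oppr_eq0 mulf_neq0 ?invr_eq0 //; split=> //.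
  by congr (_, _, _); field; nz_tac.
- move=> _ tauE; rewrite e0; split=> //.
  by congr (_, _, _); field; nz_tac.
- move=> /andP[q0 tau0] tE.
  have -> : 1 + 2 * e * ((- (tau / q) - 1) / (2 * e)) = - (tau / q).
    by field; nz_tac.
  have -> : 1 + e ^+ 2 * ((4 * e ^+ 3 * tau - 1) / e ^+ 2) = 4 * e ^+ 3 * tau.
    by field; nz_tac.
  rewrite e0 oppr_eq0 !mulf_neq0 ?invr_eq0 ?expf_neq0 //; split=> //; last first.
    by field; nz_tac.
  by congr (_, _, _); [rewrite tE| |]; field; nz_tac.
Qed.

Lemma new_oldK A e T Q P (r2 : F) : 2 != 0 :> F -> r2 ^+ 2 = 2 -> old_ok e T Q ->
  let o := old_tqp A e T Q P r2 in
  [/\ new_tqp A e (tau_of e T) o.1.1 o.1.2 o.2 r2 = (T, Q, P),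
      new_ok e (tau_of e T) o.1.1 o.1.2 & tau_rel (tau_of e T) o.1.1].
Proof.
move=> n2 r22; have r20 : r2 != 0.
  by apply: contra_neq n2 => r20; rewrite -r22 r20 expr0n.
have n4 : 4 != 0 :> F by have -> : 4 = 2 * 2 :> F; [ring|rewrite mulf_neq0].
rewrite /new_ok /old_ok /tau_of /tau_rel /old_tqp /new_tqp.
case: d => /= /andP[e0].
- move=> q1; rewrite [1 + (Q - 1)^-1]addrC addrK e0 invr_eq0 q1; split=> //.
  by congr (_, _, _); field; nz_tac.
- move=> q1; have e1 : - (e * Q / (1 - e * Q)) - 1 = - (1 - e * Q)^-1.
    by field; nz_tac.
  rewrite e1 oppr_eq0 invr_eq0 q1 e0; split=> //.
  by congr (_, _, _); field; nz_tac.
- move=> t0; rewrite e0 oppr_eq0 mulf_neq0 //; split=> //.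
  by congr (_, _, _); field; nz_tac.
- move=> _; rewrite e0; split=> //.
  by congr (_, _, _); field: r22; nz_tac.
- move=> /andP[x0 tau0].
  rewrite e0 oppr_eq0 !mulf_neq0 ?invr_eq0 ?mulf_neq0 ?expf_neq0 //; split=> //.
  by congr (_, _, _); field; nz_tac.
Qed.

Definition new_A a (j : nat) : F :=
  nth 0 match d with
  | VI_V => [:: a 0%N + a 2%N + a 3%N; a 4%N; a 2%N; a 1%N]
  | V_IV => [:: a 0%N + a 3%N; a 1%N; a 2%N]
  | V_III => [:: a 2%N; 2^-1 * (a 1%N + a 3%N); a 0%N]
  | IV_II => [:: a 0%N + a 1%N; a 2%N]
  | III_II => [:: 2 * a 1%N + a 2%N; a 0%N]
  end j.

Definition eps_order : nat :=
  match d with VI_V | V_III => 1 | V_IV => 2 | IV_II => 6 | III_II => 3 end.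

(* The value of [e ^- eps_order] in terms of the old parameters. *)
Definition eps_inv a : F :=
  match d with
  | VI_V => a 0%N
  | V_IV => - (2 * a 3%N)
  | V_III => a 1%N
  | IV_II | III_II => 4 * a 1%N
  end.

Lemma new_A_old A e j : 2 != 0 :> F -> (j <= rank (target d))%N ->
  new_A (nth 0 (old_al A e)) j = A j.
Proof.
move=> n2; have n4 : 4 != 0 :> F by have -> : 4 = 2 * 2 :> F; [ring|rewrite mulf_neq0].
have h4 : 4^-1 = 2^-1 * 2^-1 :> F by field; rewrite ?n2.
have h2 (x : F) : 2^-1 * (2 * x) = x by rewrite mulKf.
rewrite /new_A /old_al; case: d; do 5?[case: j => [|j] //]; move=> _ /=.
all: rewrite ?h4; try ring.
- by rewrite addrC subrK h2.
- by set x := e ^- 3; field; nz_tac.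
Qed.

Lemma old_al_new a e j : 2 != 0 :> F ->
  \sum_(i < (rank (source d)).+1) a i *+ mark (source d) i = 1 ->
  e^-1 ^+ eps_order = eps_inv a -> (j <= rank (source d))%N ->
  nth 0 (old_al (new_A a) e) j = a j.
Proof.
move=> n2; have n4 : 4 != 0 :> F by have -> : 4 = 2 * 2 :> F; [ring|rewrite mulf_neq0].
have h4 (x : F) : 4^-1 * (4 * x) = x by rewrite mulKf.
have h2 (x : F) : 2^-1 * (2 * x) = x by rewrite mulKf.
have h24 (x : F) : 2^-1 * (4 * x) = 2 * x by rewrite -[X in _ = X]h2; congr (_ * _); ring.
rewrite /eps_inv /eps_order /new_A /old_al; case: d => /=.
all: do ?rewrite big_ord_recl; rewrite big_ord0 /mark /= => norm.
all: rewrite ?exprVn ?expr1 => ->.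
all: do 5?[case: j => [|j] //]; move=> _ /=.
all: rewrite ?mulrN ?h2 ?h4 ?h24 ?mulVKf //; try ring.
Qed.

Lemma old_normalization A e : 2 != 0 :> F ->
  \sum_(i < (rank (target d)).+1) A i *+ mark (target d) i = 1 ->
  \sum_(i < (rank (source d)).+1) nth 0 (old_al A e) i *+ mark (source d) i = 1.
Proof.
move=> n2; rewrite /old_al; case: d => /=.
all: do ?rewrite big_ord_recl; rewrite big_ord0 /mark /= => norm.
all: do ?rewrite big_ord_recl; rewrite big_ord0 /mark /=.
all: rewrite -[RHS]norm; try ring.
have n4 : 4 != 0 :> F by have -> : 4 = 2 * 2 :> F; [ring|rewrite mulf_neq0].
have -> : 4^-1 = 2^-1 * 2^-1 :> F by field; nz_tac.
by rewrite /bump /=; set x := e ^- 3; field; nz_tac.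
Qed.

Lemma new_normalization a : 2 != 0 :> F ->
  \sum_(i < (rank (source d)).+1) a i *+ mark (source d) i = 1 ->
  \sum_(i < (rank (target d)).+1) new_A a i *+ mark (target d) i = 1.
Proof.
move=> n2; rewrite /new_A; case: d => /=.
all: do ?rewrite big_ord_recl; rewrite big_ord0 /mark /= => norm.
all: do ?rewrite big_ord_recl; rewrite big_ord0 /mark /=.
all: rewrite -[RHS]norm; try ring.
by rewrite /bump /=; field; nz_tac.
Qed.

End ChangeOfVariables.

Section ChangeSpec.
Variables (L F : fieldType) (D : specData L F) (d : degeneration).
Hypothesis F2 : 2 != 0 :> F.
Variables (A : nat -> L) (A' : nat -> F).
Hypothesis AA' : forall j, (j <= rank (target d))%N -> spec D (A j) (A' j).

Let F4 : 4 != 0 :> F.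
Proof. by have -> : 4 = 2 * 2 :> F; [ring|rewrite mulf_neq0]. Qed.

Lemma spec_old_al e e' j : spec D e e' -> e' != 0 ->
  spec D (nth 0 (old_al d A e) j) (nth 0 (old_al d A' e') j).
Proof.
move: AA'; rewrite /old_al; case: d => /= AA ee e0.
all: do 6?[case: j => [|j] //=]; rewrite ?nth_nil.
all: rewrite ?expf_neq0; spec_tac; rewrite ?expf_neq0 //; by apply: AA.
Qed.

Lemma spec_old_tqp e T Q P r2 e' T' Q' P' r2' :
  r2' != 0 -> old_ok d e' T' Q' ->
  spec D e e' -> spec D T T' -> spec D Q Q' -> spec D P P' -> spec D r2 r2' ->
  let o := old_tqp d A e T Q P r2 in let o' := old_tqp d A' e' T' Q' P' r2' in
  [/\ spec D o.1.1 o'.1.1, spec D o.1.2 o'.1.2 & spec D o.2 o'.2].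
Proof.
move=> r0; rewrite /old_ok /old_tqp; case: d AA' => /= AA /andP[e0 ok] ee TT QQ PP rr.
all: try (case/andP: ok => ok ok').
all: split; spec_tac; try by apply: AA.
all: by rewrite ?mulf_neq0 ?invr_eq0 ?mulf_neq0 ?expf_neq0.
Qed.

Lemma spec_tau_of e T e' T' : e' != 0 -> spec D e e' -> spec D T T' ->
  spec D (tau_of d e T) (tau_of d e' T').
Proof.
move=> e0 ee TT; rewrite /tau_of; case: d => /=; spec_tac.
by rewrite mulf_neq0 ?expf_neq0.
Qed.

Lemma spec_new_tqp e tau t q p r2 e' tau' t' q' p' r2' :
  new_ok d e' tau' t' q' ->
  spec D e e' -> spec D tau tau' -> spec D t t' -> spec D q q' -> spec D p p' ->
  spec D r2 r2' ->
  let n := new_tqp d A e tau t q p r2 in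
  let n' := new_tqp d A' e' tau' t' q' p' r2' in
  [/\ spec D n.1.1 n'.1.1, spec D n.1.2 n'.1.2 & spec D n.2 n'.2].
Proof.
rewrite /new_ok /new_tqp; case: d AA' => /= AA /andP[e0 ok] *.
all: try (case/andP: ok => ok ok').
all: split; spec_tac; try by apply: AA.
all: by rewrite ?mulf_neq0 ?invr_eq0 ?mulf_neq0 ?expf_neq0.
Qed.
End ChangeSpec.

(** * The field of the new variables and its numerical points *)

Section FpsPoly.
Variable A : comNzRingType.

Fact fps_poly_zmod_morphism : zmod_morphism (@fps_poly A).
Proof. by move=> p q; apply: fpsP => k /=; rewrite coefB. Qed.

Fact fps_poly_monoid_morphism : monoid_morphism (@fps_poly A).
Proof.
split=> [|p q]; apply: fpsP => k /=; last by rewrite coefM.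
by rewrite coef1; case: k.
Qed.

Definition fpsPoly : {rmorphism {poly A} -> fps A} :=
  rmorph_of fps_poly_zmod_morphism fps_poly_monoid_morphism.

Lemma fpsPoly_inj p : fpsPoly p = 0 -> p = 0.
Proof.
move=> p0; apply/polyP => k; rewrite coef0.
by have := congr1 (fun f : fps A => f k) p0; rewrite /= if_same.
Qed.

Lemma fpsPolyC a : fpsPoly a%:P = fps_const a.
Proof. by apply: fpsP => k /=; rewrite coefC. Qed.

Lemma fpsPolyX : fpsPoly 'X = fps_var A.
Proof. by apply: fpsP => k /=; rewrite coefX. Qed.

End FpsPoly.

Section TargetField.
Variables (R : realType) (d : degeneration).
Local Notation C := (Cplx R).
Local Notation CA := (paramRing R (target d)).
Local Notation B := (epsRing R d).
Local Notation EE := (E R d).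

(** C[A][eps] embeds into [epsRing] in all five cases, so whatever is polynomial in eps can be
    treated uniformly. *)
Definition epsPoly : {rmorphism {poly CA} -> B} :=
  if birational d as b
    return {rmorphism {poly CA} -> (if b then {poly CA} : idomainType else fps CA)}
  then idfun else fpsPoly CA.

Lemma epsPoly_inj p : epsPoly p = 0 -> p = 0.
Proof.
rewrite /epsPoly /epsRing; case: (birational d) p => //= p.
exact: fpsPoly_inj.
Qed.

Lemma epsPolyC a : epsPoly a%:P = eps_const a.
Proof.
rewrite /epsPoly /eps_const /epsRing; case: (birational d) => //=.
exact: fpsPolyC.
Qed.

Lemma epsPolyX : epsPoly 'X = eps_var R d.
Proof.
rewrite /epsPoly /eps_var /epsRing; case: (birational d) => //=.
exact: fpsPolyX.
Qed.

Definition polyE : {rmorphism {poly CA} -> EE} :=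
  coefR B \o epsPoly : {rmorphism {poly CA} -> ratfun B}.

Lemma polyE_C a : polyE a%:P = coefF (eps_const a).
Proof. by rewrite -epsPolyC. Qed.

Lemma polyE_X : polyE 'X = eps R d.
Proof. by rewrite /eps -epsPolyX. Qed.

Lemma polyE_inj p : polyE p = 0 -> p = 0.
Proof.
rewrite -(rmorph0 polyE) => /(@coefF_inj B); rewrite rmorph0; exact: epsPoly_inj.
Qed.

Definition cE : {rmorphism C -> EE} :=
  polyE \o (polyC \o @mpolyC (rank (target d)) C) : {rmorphism C -> EE}.

Lemma cE_E c : cE c = constE d c. Proof. exact: polyE_C. Qed.

Definition AE (n : nat) : EE := A_ R (inord n).

Lemma AE_ord (j : 'I_(rank (target d)).+1) : AE j = A_ R j. Proof. by rewrite /AE inord_val. Qed.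

Lemma A_polyE (j : 'I_(rank (target d)).+1) : A_ R j = polyE (param R j)%:P.
Proof. by rewrite polyE_C. Qed.

Lemma natE_neq0 n : n.+1%:R != 0 :> EE.
Proof. by rewrite -(rmorph_nat cE) fmorph_eq0 pnatr_eq0. Qed.

Lemma A_normalization : \sum_(j < (rank (target d)).+1) AE j *+ mark (target d) j = 1.
Proof.
rewrite -(rmorph1 polyE) -[1 in RHS]polyC1 -(param_normalization R (target d)).
rewrite !rmorph_sum; apply: eq_bigr => j _.
by rewrite AE_ord A_polyE !rmorphMn.
Qed.

Lemma eps_neq0 : eps R d != 0.
Proof.
by rewrite -polyE_X; apply/eqP => /polyE_inj/eqP; rewrite polyX_eq0.
Qed.

Definition srcE : {rmorphism {mpoly {poly CA}[3]} -> EE} :=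
  mmap polyE (vec3 (T_ R d) (Q_ R d) (P_ R d)).

Lemma srcE_inj x : srcE x = 0 -> x = 0.
Proof.
have -> : srcE x = toFrac {mpoly B[3]} (map_mpoly epsPoly x).
  pose f : {rmorphism {mpoly {poly CA}[3]} -> EE} :=
    (toFrac {mpoly B[3]} \o map_mpoly epsPoly : {rmorphism _ -> ratfun B}).
  apply: (@mpoly_rmorph_ext _ _ _ srcE f).
  - by move=> c; rewrite /f /= map_mpolyC [LHS]mmapC.
  - move=> i; rewrite /f /= map_mpolyX [LHS]mmapXU.
    by case: i => -[|[|[|?]]] //= h; rewrite /vec3 /=; congr (toFrac {mpoly B[3]} 'X__);
      apply: val_inj.
move/eqP; rewrite toFrac_eq0 => /eqP/mpolyP x0; apply/mpolyP => m.
by have := x0 m; rewrite !mcoeff0 mcoeff_map_mpoly => /epsPoly_inj.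
Qed.

Section Point.
Variables (a : nat -> C) (e T Q P : C).
Hypothesis a_norm : \sum_(j < (rank (target d)).+1) a j *+ mark (target d) j = 1.

Definition pointEval : {rmorphism {mpoly {poly CA}[3]} -> C} :=
  mmap (horner_eval e \o map_poly (paramEval (target d) idfun a)) (vec3 T Q P).

(** Evaluation at numerical A, eps, T, Q, P, defined on quotients of polynomials in eps only,
    because a formal series has no value at a nonzero eps. This is enough: the change of variables
    is rational in eps. *)
Definition pointSpec : specData EE C :=
  @SpecData _ _ {mpoly {poly CA}[3]} (fun=> True) srcE pointEval I
    (fun _ _ _ _ => I) (fun _ _ _ _ => I)
    (fun x _ x0 => etrans (congr1 pointEval (srcE_inj x0)) (rmorph0 _)).

Let pointSpec_of x : spec pointSpec (srcE x) (pointEval x).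
Proof. exact: (@spec_of _ _ pointSpec x I). Qed.

Let pointSpec_C c : spec pointSpec (polyE c) (map_poly (paramEval (target d) idfun a) c).[e].
Proof. by have := pointSpec_of c%:MP; rewrite [srcE _]mmapC [pointEval _]mmapC. Qed.

Lemma pointSpec_A (j : 'I_(rank (target d)).+1) : spec pointSpec (A_ R j) (a j).
Proof.
rewrite -[a j](paramEval_param idfun a_norm) A_polyE.
by have := pointSpec_C (param R j)%:P; rewrite map_polyC hornerC.
Qed.

Lemma pointSpec_const c : spec pointSpec (cE c) c.
Proof.
by have := pointSpec_C (c%:MP)%:P; rewrite map_polyC hornerC [X in spec _ _ X]mmapC.
Qed.

Lemma pointSpec_eps : spec pointSpec (eps R d) e.
Proof. by have := pointSpec_C 'X; rewrite map_polyX hornerX polyE_X. Qed.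

Lemma pointSpec_T : spec pointSpec (T_ R d) T.
Proof. by have := pointSpec_of 'X_(@Ordinal 3 0 isT); rewrite [srcE _]mmapXU [pointEval _]mmapXU. Qed.
Lemma pointSpec_Q : spec pointSpec (Q_ R d) Q.
Proof. by have := pointSpec_of 'X_(@Ordinal 3 1 isT); rewrite [srcE _]mmapXU [pointEval _]mmapXU. Qed.
Lemma pointSpec_P : spec pointSpec (P_ R d) P.
Proof. by have := pointSpec_of 'X_(@Ordinal 3 2 isT); rewrite [srcE _]mmapXU [pointEval _]mmapXU. Qed.
End Point.

End TargetField.

Section SourcePoint.
Variables (R : realType) (J : painleve).
Local Notation C := (Cplx R).
Local Notation B := (paramRing R J).

Definition numEval (a : nat -> C) (t q p : C) : {rmorphism {mpoly B[3]} -> C} :=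
  evalR (paramEval J idfun a) t q p.

(** [mpoly_nat_point] is used twice: for t, q, p over the ring of parameters, then for the free
    parameters in the value obtained. The normalization then determines [a 0]. *)
Lemma source_point (x : {mpoly B[3]}) : x != 0 ->
  exists (a : nat -> C) t q p, \sum_(j < (rank J).+1) a j *+ mark J j = 1 /\ numEval a t q p x != 0.
Proof.
move=> x0.
have [n|v vx] := mpoly_nat_point _ x0.
  by rewrite -(rmorph_nat (@mpolyC (rank J) C)) mpolyC_eq0 pnatr_eq0.
have [n|w wx] := mpoly_nat_point _ vx; first by rewrite pnatr_eq0.
pose a j : C := if j is k.+1 then oapp (fun i : 'I_(rank J) => (w i)%:R) 0 (insub k)
  else 1 - \sum_(k < rank J) (w k)%:R *+ mark J k.+1.
have aw (k : 'I_(rank J)) : a k.+1 = (w k)%:R by rewrite /a valK.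
exists a, (v (@Ordinal 3 0 isT))%:R, (v (@Ordinal 3 1 isT))%:R, (v (@Ordinal 3 2 isT))%:R.
split.
  rewrite big_ord_recl mark0 /= [X in _ + X](eq_bigr (fun k : 'I_(rank J) => (w k)%:R *+ mark J k.+1)).
    by rewrite subrK.
  by move=> k _; rewrite -aw.
suff -> : numEval a (v (@Ordinal 3 0 isT))%:R (v (@Ordinal 3 1 isT))%:R
   (v (@Ordinal 3 2 isT))%:R x = (x.@[fun i => (v i)%:R]).@[fun i => (w i)%:R] by [].
pose ev2 := meval (fun i => (w i)%:R) : {rmorphism B -> C}.
pose ev1 := meval (fun i => (v i)%:R) : {rmorphism {mpoly B[3]} -> B}.
apply: (@mpoly_rmorph_ext _ _ _ (numEval a _ _ _) (ev2 \o ev1)).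
- move=> c; rewrite [LHS]mmapC /= /ev1 [meval _ c%:MP]mevalC.
  exact: meval_eq aw.
- move=> i; rewrite [LHS]mmapXU /= /ev1 [meval _ 'X_i]mevalXU rmorph_nat /vec3.
  by case: i => -[|[|[|?]]] //= h; congr (_%:R); congr v; apply: val_inj.
Qed.

End SourcePoint.

Lemma change_old (R : realType) d :
  let r2 := constE d (sqrtC 2) in
  let o := old_tqp d (@AE R d) (eps R d) (T_ R d) (Q_ R d) (P_ R d) r2 in
  old_ok d (eps R d) (T_ R d) (Q_ R d) ->
  change (old_al d (@AE R d) (eps R d)) o.1.1 o.1.2 o.2.
Proof.
rewrite /change /old_tqp /old_al /old_ok /AE; case: d => /= /andP[e0 ok]; split=> //.
- by rewrite [1 + _]addrC addrK mulVf.
- by rewrite [1 + _]addrC addrK mulrC mulfK // subrK.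
Qed.

(** * The embedding of K_J given by the change of variables *)

Section Iota.
Variables (R : realType) (d : degeneration).
Local Notation C := (Cplx R).
Local Notation B := (paramRing R (source d)).

(* The locus where the change of variables cannot be inverted. *)
Definition excluded : {mpoly B[3]} :=
  let c j : {mpoly B[3]} := (param R (inord j : 'I_(rank (source d)).+1))%:MP in
  let t := 'X_(@Ordinal 3 0 isT) in let q := 'X_(@Ordinal 3 1 isT) in
  match d with
  | VI_V => c 0%N * (q - 1)
  | V_IV => c 3%N * (q - 1)
  | V_III => c 1%N * t
  | IV_II => c 1%N
  | III_II => c 1%N * (q * t)
  end.

Lemma numEval_excluded (a : nat -> C) (t q p : C) :
  \sum_(j < (rank (source d)).+1) a j *+ mark (source d) j = 1 ->
  numEval (source d) a t q p excluded = match d with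
  | VI_V => a 0%N * (q - 1)
  | V_IV => a 3%N * (q - 1)
  | V_III => a 1%N * t
  | IV_II => a 1%N
  | III_II => a 1%N * (q * t)
  end.
Proof.
move=> norm; rewrite /excluded.
have cE j : (j < (rank (source d)).+1)%N ->
    numEval (source d) a t q p (param R (inord j : 'I_(rank (source d)).+1))%:MP = a j.
  move=> jr; rewrite [LHS]mmapC -[in RHS](inordK jr).
  exact: (paramEval_param idfun norm).
have tE : numEval (source d) a t q p 'X_(@Ordinal 3 0 isT) = t by rewrite [LHS]mmapXU.
have qE : numEval (source d) a t q p 'X_(@Ordinal 3 1 isT) = q by rewrite [LHS]mmapXU.
move: cE tE qE; rewrite /numEval.
move: (evalR _ _ _ _) => f; case: (d) f => f cE tE qE; rewrite ?(rmorphM, rmorphB, rmorph1) ?cE //.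
all: by rewrite ?(rmorphM, rmorphB, rmorph1) ?tE ?qE.
Qed.

Lemma excluded_neq0 : excluded != 0.
Proof.
(* Normalized parameters at which [excluded] does not vanish when t = q = p = 2; for III_II the mark
   2 of alpha_1 is compensated by alpha_0 = -1. *)
pose a j : C := match d with
  | VI_V => (j == 0%N)%:R
  | V_IV => (j == 3%N)%:R
  | V_III | IV_II => (j == 1%N)%:R
  | III_II => nth 0 [:: -1; 1; 0] j
  end.
have norm : \sum_(j < (rank (source d)).+1) a j *+ mark (source d) j = 1.
  rewrite /a; case: (d) => /=; do ?rewrite big_ord_recl; rewrite big_ord0 /mark /=; ring.
have := @numEval_excluded a 2 2 2 norm; set g := match d with VI_V => _ | _ => _ end => e.
have g0 : g != 0.
  have two : 2 - 1 != 0 :> C by have -> : 2 - 1 = 1 :> C; [ring|rewrite oner_eq0].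
  by rewrite /g /a; case: (d) => /=; rewrite ?mul1r ?mulf_neq0 ?oner_eq0 ?pnatr_eq0.
by apply: contra_neq g0 => ex0; rewrite -e ex0 rmorph0.
Qed.

Let e := eps R d.
Let r2 : E R d := constE d (sqrtC 2).

Lemma sqrt2E : r2 ^+ 2 = 2.
Proof. by rewrite /r2 -cE_E -rmorphXn sqrtCK rmorph_nat. Qed.

Definition oldE := old_tqp d (@AE R d) e (T_ R d) (Q_ R d) (P_ R d) r2.
Definition oldA (j : nat) : E R d := nth 0 (old_al d (@AE R d) e) j.

Lemma oldA_normalization :
  \sum_(j < (rank (source d)).+1) oldA j *+ mark (source d) j = 1.
Proof. by apply: old_normalization; [exact: natE_neq0|exact: A_normalization]. Qed.

(** Numerical inversion of the change of variables. As C is algebraically closed, eps can be taken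
    as an N-th root and tau as a square root of -t; [new_A] and [new_tqp] give the remaining
    coordinates, and evaluating E there sends the old expressions to the given point. *)
Lemma old_point (a : nat -> C) (t q p : C) :
  \sum_(j < (rank (source d)).+1) a j *+ mark (source d) j = 1 ->
  numEval (source d) a t q p excluded != 0 ->
  exists D : specData (E R d) C, [/\ forall c, spec D (cE R d c) c,
    forall j, (j <= rank (source d))%N -> spec D (oldA j) (a j),
    spec D oldE.1.1 t, spec D oldE.1.2 q & spec D oldE.2 p].
Proof.
move=> norm; rewrite numEval_excluded // => ex0.
have n2 : 2 != 0 :> C by rewrite pnatr_eq0.
have inv0 : eps_inv d a != 0.
  move: ex0; rewrite /eps_inv; case: (d) => /=; rewrite ?mulf_eq0 ?negb_or => // h.
  all: try (by case/andP: h).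
  - by rewrite oppr_eq0 mulf_neq0 //; case/andP: h.
  - by rewrite h pnatr_eq0.
  - by rewrite pnatr_eq0; case/andP: h.
have [e' e0 eN] : exists2 e', e' != 0 & e'^-1 ^+ eps_order d = eps_inv d a.
  have N0 : (0 < eps_order d)%N by case: (d).
  exists ((eps_order d).-root (eps_inv d a))^-1; last by rewrite invrK rootCK.
  by rewrite invr_eq0 rootC_eq0.
have [tau tauE ok] : exists2 tau, tau_rel d tau t & new_ok d e' tau t q.
  move: ex0; rewrite /tau_rel /new_ok e0; case: (d) => /= h.
  - by exists 1 => //; move: h; rewrite mulf_eq0 negb_or => /andP[].
  - by exists 1 => //; move: h; rewrite mulf_eq0 negb_or => /andP[].
  - by exists 1 => //; move: h; rewrite mulf_eq0 negb_or => /andP[].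
  - by exists 1.
  - exists (sqrtC (- t)); first by rewrite sqrtCK opprK.
    by rewrite sqrtC_eq0 oppr_eq0; move: h; rewrite !mulf_eq0 !negb_or => /andP[].
have := old_newK (new_A d a) p n2 (sqrtCK 2) ok tauE.
set n := new_tqp _ _ _ _ _ _ _ _ => -[oldn okn _].
have normA := new_normalization n2 norm.
have sA j : (j <= rank (target d))%N ->
    spec (pointSpec d (new_A d a) e' n.1.1 n.1.2 n.2) (@AE R d j) (new_A d a j).
  by move=> jr; have := pointSpec_A e' n.1.1 n.1.2 n.2 normA (inord j); rewrite inordK.
exists (pointSpec d (new_A d a) e' n.1.1 n.1.2 n.2).
have sc := pointSpec_const d (new_A d a) e' n.1.1 n.1.2 n.2.
have se := pointSpec_eps d (new_A d a) e' n.1.1 n.1.2 n.2.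
have r20 : sqrtC 2 != 0 :> C by rewrite sqrtC_eq0.
have sr2 : spec (pointSpec d (new_A d a) e' n.1.1 n.1.2 n.2) r2 (sqrtC 2).
  by rewrite /r2 -cE_E.
have [s1 s2 s3] := spec_old_tqp n2 sA r20 okn se
  (pointSpec_T _ _ _ _ _ _) (pointSpec_Q _ _ _ _ _ _) (pointSpec_P _ _ _ _ _ _) sr2.
move: s1 s2 s3; rewrite oldn => s1 s2 s3; split=> //.
move=> j jr; rewrite -(old_al_new n2 norm eN jr).
exact: spec_old_al.
Qed.

Definition substitutes_old (iota : K R (source d) -> E R d) : Prop :=
  [/\ forall c, iota (constK R (source d) c) = cE R d c,
      forall j, (j <= rank (source d))%N -> iota (al R (source d) j) = oldA j,
      iota (var_t _) = oldE.1.1, iota (var_q _) = oldE.1.2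
    & iota (var_p _) = oldE.2].

(** A nonzero [x] killed by the substitution would vanish at every point provided by [old_point].
    But [x * excluded] is nonzero, hence nonzero at some normalized point, and [old_point] applies
    to that point. *)
Lemma iota_exists : exists iota : {rmorphism K R (source d) -> E R d},
  substitutes_old iota.
Proof.
pose c := paramEval (source d) (cE R d) oldA.
have [|s [sc st sq sp _]] := @ratfun_lift _ _ c oldE.1.1 oldE.1.2 oldE.2.
  move=> x ex; apply/eqP/negPn/negP => x0.
  have := mulf_neq0 x0 excluded_neq0 => /source_point[a [t [q [p [norm]]]]].
  rewrite rmorphM mulf_eq0 negb_or => /andP[x1 ex1].
  have [D [Dc Da Dt Dq Dp]] := old_point norm ex1.
  case/negP: x1; apply/eqP; apply: (@spec_eq0 _ _ D); rewrite -ex.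
  apply: spec_mmap => [b|i]; last exact: spec_vec3.
  by apply: spec_mmap => // k; apply: Da.
exists s; split=> // [z|j jr].
  by rewrite constKE sc [LHS]mmapC.
rewrite /al /alpha sc -[in RHS](inordK jr).
exact: (paramEval_param (cE R d) oldA_normalization).
Qed.

(** Tested at eps = T = P = 1 and Q = 3, where the conditions take the values 2, -2, 1 and, for
    III_II, 7 and 2. *)
Lemma old_okE : old_ok d e (T_ R d) (Q_ R d).
Proof.
pose a (j : nat) : C := (j == 0%N)%:R.
have norm : \sum_(j < (rank (target d)).+1) a j *+ mark (target d) j = 1.
  by rewrite big_ord_recl mark0 big1 ?addr0 // => i _; rewrite mul0rn.
rewrite /old_ok; apply/andP; split; first exact: eps_neq0.
have gen (L : fieldType) (D : specData L C) (x y z : L) :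
  spec D x 1 -> spec D y 1 -> spec D z 3 ->
  match d with VI_V => z - 1 != 0 | V_IV => 1 - x * z != 0 | V_III => y != 0
  | IV_II => true | III_II => (1 + 2 * x * z != 0) && (1 + x ^+ 2 * y != 0) end.
  move=> sx sy sz.
  have nz f g n : spec D f g -> g = n.+1%:R -> f != 0.
    by move=> fg gn; apply: (spec_neq0 fg); rewrite gn pnatr_eq0.
  case: (d) => //.
  - by apply: (@nz _ (3 - 1) 1%N); [spec_tac|ring].
  - by rewrite -oppr_eq0; apply: (@nz _ (- (1 - 1 * 3)) 1%N); [spec_tac|ring].
  - by apply: (@nz _ 1 0%N).
  - apply/andP; split.
    + by apply: (@nz _ (1 + 2 * 1 * 3) 6%N); [spec_tac|ring].
    + by apply: (@nz _ (1 + 1 ^+ 2 * 1) 1%N); [spec_tac|ring].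
exact: (gen _ _ _ _ _ (pointSpec_eps d a 1 1 3 1) (pointSpec_T d a 1 1 3 1) (pointSpec_Q d a 1 1 3 1)).
Qed.

Lemma iota_change (iota : {rmorphism K R (source d) -> E R d}) :
  substitutes_old iota ->
  is_change_of_variables iota.
Proof.
move=> [ic ia it iq ip]; split=> [c|]; first by rewrite -cE_E -ic.
have -> : [seq iota (alpha R j) | j <- enum 'I_(rank (source d)).+1] =
    old_al d (@AE R d) e.
  have sz := size_old_al d (@AE R d) e.
  apply: (@eq_from_nth _ 0); rewrite size_map size_enum_ord // => j jr.
  rewrite (nth_map ord0) ?size_enum_ord // -[RHS]ia //; congr (iota (alpha R _)).
  by apply: val_inj; rewrite /= nth_enum_ord // inordK.
rewrite it iq ip; apply: change_old; exact: old_okE.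
Qed.

End Iota.

(** * Convergence *)

Section ComplexSeries.
Import numFieldNormedType.Exports.
Variable R : realType.
Local Notation C := (Cplx R).
Local Open Scope complex_scope.
Local Notation Re := complex.Re.
Local Notation Im := complex.Im.

Let Im_rot (x : R[i]) : Im x = Re (x * - 'i%C).
Proof.
have ReN (y : R[i]) : Re (- y) = - Re y by case: y.
by rewrite mulrN ReN ReiNIm opprK.
Qed.

Let ReD (x y : R[i]) : Re (x + y) = Re x + Re y.
Proof. by case: x; case: y. Qed.

Let Re_sum (w : nat -> R[i]) n : Re (series w n) = series (fun k => Re (w k)) n.
Proof. by rewrite /series /= (big_morph (@Re R) ReD (erefl : Re 0 = 0)). Qed.

Let Re_cvg (w : nat -> R[i]) (M : R) :
  (forall k, `|w k| <= (M * 2^-1 ^+ k)%:C) -> cvgn (series (fun k => Re (w k))).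
Proof.
move=> wM; have Rle k : `|Re (w k)| <= M * 2^-1 ^+ k.
  by rewrite -lecR (le_trans (normc_ge_Re _)).
apply: normed_cvg; apply: (@series_le_cvg _ _ (geometric M 2^-1)) => [k|k|k|].
- exact: normr_ge0.
- by rewrite /geometric /= (le_trans (normr_ge0 _) (Rle k)).
- exact: Rle.
- by apply: is_cvg_geometric_series; rewrite ger0_norm ?invr_ge0 // invf_lt1 ?ltr1n.
Qed.

(** Real and imaginary parts are dominated by a geometric series of ratio 1/2 and converge
    separately; [Im_rot] reads the imaginary part as the real part of a rotated series, so that one
    real argument serves both. *)
Lemma complex_series_cvg (w : nat -> C) (M : R) :
  (forall k, `|w k| <= (M * 2^-1 ^+ k)%:C) -> cvgn (series w).
Proof.
move=> wM; have /cvg_ex[/= a ca] := Re_cvg wM.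
have /cvg_ex[/= b cb] : cvgn (series (fun k => Re (w k * - 'i%C))).
  by apply: (@Re_cvg _ M) => k; rewrite normrM normrN [X in _ * X]normc_def /= expr0n expr1n /= add0r sqrtr1 mulr1.
suff : (series w @ \oo --> (a +i* b : C))%classic by move=> h; apply: (cvgP _ h).
apply/cvgrPdist_lt => e e0.
have eE : e = (Re e)%:C by rewrite (RRe_real (gtr0_real e0)).
have e0' : 0 < Re e / 2 by rewrite divr_gt0 // -ltcR -eE.
move/cvgrPdist_lt: ca => /(_ _ e0') ca; move/cvgrPdist_lt: cb => /(_ _ e0') cb.
near=> n.
have an : `|a - Re (series w n)| < Re e / 2 by rewrite Re_sum; near: n.
have bn : `|b - Im (series w n)| < Re e / 2.
  rewrite Im_rot (_ : Re _ = series (fun k => Re (w k * - 'i%C)) n); first by near: n.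
  by rewrite -Re_sum /series /= mulr_suml.
have -> : (a +i* b : C) - series w n =
    (a - Re (series w n))%:C + 'i * (b - Im (series w n))%:C.
  case: (series w n) => x y; apply/eqP; rewrite eq_complex /=.
  by rewrite !(mul0r, mul1r, mulr0, subr0, addr0, add0r) !eqxx.
rewrite eE; apply: (le_lt_trans (ler_normD _ _)).
rewrite normrM !normc_def /= !expr0n /= expr1n !addr0 add0r sqrtr1 mul1r !sqrtr_sqr.
by rewrite -rmorphD /= ltcR [ltRHS]splitr ltrD.
Unshelve. all: by end_near.
Qed.

(** Positive radius of convergence at each [a]. The exponent k+1 lets a single constant replace a
    bound c r^k: one factor M absorbs c and bounds the term k = 0. *)
Definition bounded_growth (n : nat) (u : fps {mpoly C[n]}) : Prop :=
  forall a : 'I_n -> C, exists2 M : R, 0 <= M & forall k, `|(u k).@[a]| <= (M ^+ k.+1)%:C.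

Section Growth.
Variable n : nat.
Implicit Types u v : fps {mpoly C[n]}.

Lemma bounded_growth_ball u (a : 'I_n -> C) : bounded_growth u ->
  exists2 r : C, 0 < r & forall z : C, `|z| < r ->
    cvgn (series (fun k => (u k).@[a] * z ^+ k)).
Proof.
(* Below this radius the k-th term is at most M 2^-k; the summand 1 keeps the radius meaningful when
   M = 0. *)
move=> /(_ a)[M M0 uM]; exists (2^-1 / (M + 1))%:C.
  by rewrite ltcR divr_gt0 ?invr_gt0 ?ltr0n ?ltr_wpDl ?ltr01 //.
move=> z zr; apply: (@complex_series_cvg _ M) => k.
have M1 : 0 < M + 1 by rewrite ltr_wpDl ?ltr01.
have zE : `|z| = (Re `|z|)%:C by rewrite RRe_real // normr_real.
have z0 : 0 <= Re `|z| by rewrite -lecR -zE; exact: normr_ge0.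
have zM : Re `|z| * M <= 2^-1.
  move: zr; rewrite zE ltcR ltr_pdivlMr // => /ltW; apply: le_trans.
  by rewrite ler_wpM2l // lerDl.
rewrite normrM normrX.
apply: (@le_trans _ _ ((M ^+ k.+1)%:C * `|z| ^+ k)); first by rewrite ler_wpM2r ?exprn_ge0.
rewrite zE -rmorphXn -rmorphM /= lecR exprS -mulrA ler_wpM2l // -exprMn mulrC.
by rewrite lerXn2r ?nnegrE ?mulr_ge0 ?invr_ge0.
Qed.

Let addX_le (x y : R) k : 0 <= x -> 0 <= y -> x ^+ k.+1 + y ^+ k.+1 <= (x + y) ^+ k.+1.
Proof.
move=> x0 y0; elim: k => [|k IH]; first by rewrite !expr1.
rewrite [leRHS]exprS; apply: le_trans (ler_wpM2l (addr_ge0 x0 y0) IH).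
rewrite mulrDl !mulrDr -!exprS -addrA lerD2l addrA lerDr.
by rewrite addr_ge0 // mulr_ge0 ?exprn_ge0.
Qed.

Lemma sumX_le (x y : R) k : 0 <= x -> 0 <= y ->
  \sum_(i < k.+1) x ^+ i * y ^+ (k - i) <= (x + y) ^+ k.
Proof.
move=> x0 y0; rewrite addrC exprDn; apply: ler_sum => i _.
rewrite [leLHS]mulrC -[leLHS]mulr1n ler_wpMn2l ?mulr_ge0 ?exprn_ge0 //.
by rewrite bin_gt0 -ltnS.
Qed.

Lemma bounded_growthB u v :
  bounded_growth u -> bounded_growth v -> bounded_growth (u - v).
Proof.
move=> bu bv a; have [M M0 uM] := bu a; have [N N0 vN] := bv a.
exists (M + N) => [|k]; first exact: addr_ge0.
rewrite [(u - v) k](_ : _ = u k - v k) // mevalB; apply: (le_trans (ler_normB _ _)).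
apply: (le_trans (lerD (uM k) (vN k))).
by rewrite -rmorphD /= lecR addX_le.
Qed.

Lemma bounded_growthM u v :
  bounded_growth u -> bounded_growth v -> bounded_growth (u * v).
Proof.
move=> bu bv a; have [M M0 uM] := bu a; have [N N0 vN] := bv a.
(* The k-th coefficient of the product is bounded by M N sum_i M^i N^(k-i) <= M N (M + N)^k, and
   both M N and M + N are at most the chosen constant. *)
exists (M + N + M * N) => [|k]; first by rewrite !addr_ge0 ?mulr_ge0.
rewrite [(u * v) k](_ : _ = \sum_(i < k.+1) u i * v (k - i)%N) // raddf_sum /=.
apply: (@le_trans _ _ (M * N * (M + N) ^+ k)%:C); last first.
  have MN0 : 0 <= M + N by rewrite addr_ge0.
  have P0 : 0 <= M * N by rewrite mulr_ge0.
  rewrite lecR exprS ler_pM ?exprn_ge0 ?lerDr //.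
  by rewrite lerXn2r ?nnegrE ?lerDl ?addr_ge0.
apply: (@le_trans _ _ (M * N * \sum_(i < k.+1) M ^+ i * N ^+ (k - i))%:C); last first.
  by rewrite lecR ler_wpM2l ?mulr_ge0 // sumX_le.
apply: (le_trans (ler_norm_sum _ _ _)).
rewrite mulr_sumr rmorph_sum /=; apply: ler_sum => i _.
rewrite mevalM normrM mulrACA -!exprS rmorphM /=.
by rewrite ler_pM ?normr_ge0.
Qed.

Lemma bounded_growth_poly (p : {poly {mpoly C[n]}}) : bounded_growth (fps_poly p).
Proof.
move=> a; pose S : C := \sum_(i < size p) `|(p`_i).@[a]|.
have S0 : 0 <= S by apply: sumr_ge0 => i _; apply: normr_ge0.
have SE : S = (Re S)%:C by rewrite RRe_real // ger0_real.
have S0' : 0 <= Re S by rewrite -lecR -SE.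
exists (1 + Re S) => [|k]; first by rewrite addr_ge0.
apply: (@le_trans _ _ S); last first.
  rewrite [leLHS]SE lecR exprS -[leLHS]mulr1 ler_pM // ?lerDr //.
  by rewrite exprn_ege1 // lerDl.
case: (ltnP k (size p)) => kp; last first.
  by rewrite /= nth_default // meval0 normr0.
rewrite /S (bigD1 (Ordinal kp)) //= lerDl; apply: sumr_ge0 => i _; exact: normr_ge0.
Qed.

Lemma bounded_growth_sum I (r : seq I) (P : pred I) (f : I -> fps {mpoly C[n]}) :
  (forall i, bounded_growth (f i)) -> bounded_growth (\sum_(i <- r | P i) f i).
Proof.
have b0 : bounded_growth 0.
  by move=> a; exists 0 => // k; rewrite /= if_same meval0 normr0 expr0n.
move=> bf; apply: (big_ind (fun u => bounded_growth u)) => // u v bu bv.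
rewrite -[v]opprK; apply: bounded_growthB => //; rewrite -sub0r.
exact: bounded_growthB.
Qed.

End Growth.

End ComplexSeries.

Lemma map_mpoly_compE n (A B D : nzRingType) (f : {rmorphism A -> B})
    (g : {rmorphism B -> D}) (x : {mpoly A[n]}) :
  map_mpoly g (map_mpoly f x) = map_mpoly (g \o f) x.
Proof. by apply/mpolyP => m; rewrite !mcoeff_map_mpoly. Qed.

(** * Passage to eps = 0 as a specialization *)

Section Limits.
Variables (R : realType) (d : degeneration).
Local Notation C := (Cplx R).
Local Notation CA := (paramRing R (target d)).
Local Notation B := (epsRing R d).

Fact fps_eval0_zmod_morphism (A : comNzRingType) :
  zmod_morphism (fun u : fps A => u 0%N).
Proof. by []. Qed.

Fact fps_eval0_monoid_morphism (A : comNzRingType) :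
  monoid_morphism (fun u : fps A => u 0%N).
Proof. by split=> // u v; rewrite /= big_ord_recl big_ord0 addr0. Qed.

Definition fpsEval0 (A : comNzRingType) : {rmorphism fps A -> A} :=
  rmorph_of (@fps_eval0_zmod_morphism A) (@fps_eval0_monoid_morphism A).

Definition epsSeries : {rmorphism B -> fps CA} :=
  if birational d as b
    return {rmorphism (if b then {poly CA} : idomainType else fps CA) -> fps CA}
  then fpsPoly CA else idfun.

Lemma epsSeriesE b : epsSeries b = eps_series b.
Proof. by rewrite /epsSeries /eps_series /epsRing in b *; case: (birational d) b. Qed.

Lemma epsSeries_poly p : epsSeries (epsPoly R d p) = fpsPoly CA p.
Proof. by rewrite /epsSeries /epsPoly /epsRing; case: (birational d). Qed.

Definition growth (x : {mpoly B[3]}) : Prop :=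
  forall m, bounded_growth (epsSeries x@_m).

Lemma growthC b : bounded_growth (epsSeries b) -> growth b%:MP.
Proof.
move=> bb m; rewrite mcoeffC rmorphM; apply: bounded_growthM => //.
rewrite rmorph_nat -(rmorph_nat (fpsPoly CA)); exact: bounded_growth_poly.
Qed.

Fact growth1 : growth 1.
Proof.
rewrite -mpolyC1; apply: growthC; rewrite rmorph1 -(rmorph1 (fpsPoly CA)).
exact: bounded_growth_poly.
Qed.

Fact growthX i : growth 'X_i.
Proof.
move=> m; rewrite mcoeffX rmorph_nat -(rmorph_nat (fpsPoly CA)).
exact: bounded_growth_poly.
Qed.

Fact growthB x y : growth x -> growth y -> growth (x - y).
Proof. by move=> gx gy m; rewrite mcoeffB rmorphB; apply: bounded_growthB. Qed.

Fact growthM x y : growth x -> growth y -> growth (x * y).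
Proof.
move=> gx gy m; rewrite mcoeffM rmorph_sum; apply: bounded_growth_sum => k.
by rewrite rmorphM; apply: bounded_growthM.
Qed.

Definition eval0E : {rmorphism {mpoly B[3]} -> K R (target d)} :=
  toFrac {mpoly CA[3]} \o map_mpoly (fpsEval0 CA \o epsSeries)
  : {rmorphism _ -> ratfun CA}.

Fact eval0E_ker (x : {mpoly B[3]}) : growth x -> toFrac {mpoly B[3]} x = 0 -> eval0E x = 0.
Proof. by move=> _ /eqP; rewrite toFrac_eq0 => /eqP ->; rewrite rmorph0. Qed.

(** Coefficients are restricted to bounded growth and replaced by their constant terms in eps.
    Limits of rational expressions then follow from the rules for [spec], as soon as denominators
    have nonzero limits. *)
Definition limSpec : specData (E R d) (K R (target d)) :=
  @SpecData (ratfun B) _ {mpoly B[3]} growth (toFrac {mpoly B[3]}) eval0E growth1 growthB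
    growthM eval0E_ker.

Lemma limSpec_coef b : bounded_growth (epsSeries b) ->
  spec limSpec (coefF b) (coefF ((epsSeries b) 0%N)).
Proof.
move=> bb; have := @spec_of _ _ limSpec _ (growthC bb).
suff -> : spec_tgt limSpec b%:MP = coefF ((epsSeries b) 0%N) by [].
by congr (toFrac _ _); apply: map_mpolyC.
Qed.

Lemma limSpec_var i : spec limSpec (ratfun_of 'X_i) (ratfun_of 'X_i).
Proof.
have := @spec_of _ _ limSpec _ (growthX i).
suff -> : spec_tgt limSpec 'X_i = ratfun_of 'X_i by [].
by congr (toFrac _ _); apply: map_mpolyX.
Qed.

Lemma limSpec_T : spec limSpec (T_ R d) (var_t _). Proof. exact: limSpec_var. Qed.
Lemma limSpec_Q : spec limSpec (Q_ R d) (var_q _). Proof. exact: limSpec_var. Qed.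
Lemma limSpec_P : spec limSpec (P_ R d) (var_p _). Proof. exact: limSpec_var. Qed.

Lemma limSpec_poly (p : {poly CA}) : spec limSpec (polyE R d p) (coefF p`_0).
Proof.
have := @limSpec_coef (epsPoly R d p); rewrite epsSeries_poly; apply.
exact: bounded_growth_poly.
Qed.

Lemma limSpec_A (j : 'I_(rank (target d)).+1) : spec limSpec (A_ R j) (alpha R j).
Proof. by have := limSpec_poly (param R j)%:P; rewrite coefC -A_polyE. Qed.

Lemma limSpec_AE j : spec limSpec (AE R d j) (al R (target d) j).
Proof. exact: limSpec_A. Qed.

Lemma limSpec_eps : spec limSpec (eps R d) 0.
Proof. by have := limSpec_poly 'X; rewrite coefX polyE_X /coefF mpolyC0 /ratfun_of tofrac0. Qed.

Lemma bounded_growth_convergent (u : fps CA) : bounded_growth u -> eps_convergent u.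
Proof. by move=> gu a; have := bounded_growth_ball a gu. Qed.

(** One pair [n], [m] plays both parts in [converges]: it represents f as a fraction in E, and its
    expansion by [epsSeries] serves as N and D, so the cross-multiplied equation is trivial. *)
Lemma limSpec_converges f g : spec limSpec f g -> converges f g.
Proof.
move=> fg; have {fg} [n [m [[gn gm] m0 -> ->]]] : exists n m : {mpoly B[3]},
    [/\ growth n /\ growth m, eval0E m != 0, f = ratfun_of n / ratfun_of m
      & g = eval0E n / eval0E m] by exact: fg.
have hN (x : {mpoly B[3]}) k : (map_mpoly epsSeries x)@_k = epsSeries x@_k.
  exact: mcoeff_map_mpoly.
have e0 (x : {mpoly B[3]}) :
    at_eps0 (map_mpoly epsSeries x) = map_mpoly (fpsEval0 CA \o epsSeries) x.
  exact: (@map_mpoly_compE _ _ _ _ epsSeries (fpsEval0 CA)).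
have sE (x : {mpoly B[3]}) : map_mpoly (@eps_series R d) x = map_mpoly epsSeries x.
  by have -> : @eps_series R d = epsSeries by apply/funext => b; rewrite epsSeriesE.
exists (map_mpoly epsSeries n), (map_mpoly epsSeries m).
split.
- move=> k.
  have gn' : bounded_growth (map_mpoly epsSeries n)@_k := eq_ind_r (@bounded_growth R _) (gn k) (hN n k).
  have gm' : bounded_growth (map_mpoly epsSeries m)@_k := eq_ind_r (@bounded_growth R _) (gm k) (hN m k).
  by split; [exact: bounded_growth_convergent gn'|exact: bounded_growth_convergent gm'].
- exists n, m; split.
  + by apply: contra_neq m0 => ->; rewrite rmorph0.
  + by [].
  + exact: (congr2 *%R (sE n) (esym (sE m))).
- by apply: contra_neq m0 => h; rewrite /= -e0 h; apply: rmorph0.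
- exact: (congr2 (fun x y => ratfun_of x / ratfun_of y) (e0 n) (e0 m)).
Qed.

End Limits.

(** * Power series *)

Section FpsTheory.
Variable A : comNzRingType.
Implicit Types f g : fps A.

Lemma fps_coef_sum I (r : seq I) (P : pred I) (F : I -> fps A) n :
  (\sum_(i <- r | P i) F i) n = \sum_(i <- r | P i) F i n.
Proof.
apply: (big_morph (fun f : fps A => f n)) => //=.
by rewrite if_same.
Qed.

Lemma fps_coef0 n : (0 : fps A) n = 0. Proof. by rewrite /= if_same. Qed.
Lemma fps_coefM f g n : (f * g) n = \sum_(i < n.+1) f i * g (n - i)%N.
Proof. by []. Qed.

Lemma fps_coef0M f g : (f * g) 0%N = f 0%N * g 0%N.
Proof. by rewrite fps_coefM big_ord_recl big_ord0 addr0. Qed.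

Lemma fps_coefD f g n : (f + g) n = f n + g n. Proof. by []. Qed.
Lemma fps_coefN f n : (- f) n = - f n. Proof. by []. Qed.
Lemma fps_coef1 n : (1 : fps A) n = (n == 0%N)%:R.
Proof. by rewrite /=; case: n. Qed.

Lemma fps_coefCM a f n : (fps_const a * f) n = a * f n.
Proof.
rewrite fps_coefM big_ord_recl /= subn0 big1 ?addr0 // => i _.
by rewrite mul0r.
Qed.

Lemma fps_coefXM f n : (fps_var A * f) n = if n is k.+1 then f k else 0.
Proof.
rewrite fps_coefM big_ord_recl /= mul0r add0r; case: n => [|n]; first by rewrite big_ord0.
rewrite big_ord_recl /= mul1r subSS subn0 big1 ?addr0 // => i _.
by rewrite mul0r.
Qed.

Lemma fps_coefXnM k f n :
  (fps_var A ^+ k * f) n = if (k <= n)%N then f (n - k)%N else 0.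
Proof.
elim: k n => [|k IH] n; first by rewrite expr0 mul1r subn0.
by rewrite exprS -mulrA fps_coefXM; case: n => [|n] //; rewrite IH.
Qed.

Lemma fps_coefXn k n : (fps_var A ^+ k) n = (n == k)%:R.
Proof.
rewrite -[_ ^+ k]mulr1 fps_coefXnM fps_coef1.
case: leqP => kn; last by rewrite ltn_eqF.
by rewrite subn_eq0 [in RHS]eqn_leq kn andbT.
Qed.

Lemma fps_XnM n f : (forall k, (k < n)%N -> f k = 0) ->
  f = fps_var A ^+ n * Fps (fun k => f (n + k)%N).
Proof.
move=> f0; apply: fpsP => k; rewrite fps_coefXnM.
by case: leqP => [nk|/f0 //]; rewrite /= subnKC.
Qed.

Definition fps_deriv f : fps A := Fps (fun k => f k.+1 *+ k.+1).

Lemma fps_derivM f g :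
  fps_deriv (f * g) = fps_deriv f * g + f * fps_deriv g.
Proof.
apply: fpsP => k; rewrite fps_coefD -[LHS]/((f * g) k.+1 *+ k.+1).
rewrite !fps_coefM -sumrMnl.
transitivity (\sum_(i < k.+2) (f i *+ i) * g (k.+1 - i)%N +
              \sum_(i < k.+2) f i * (g (k.+1 - i)%N *+ (k.+1 - i))).
  rewrite -big_split; apply: eq_bigr => i _ /=.
  by rewrite mulrnAl mulrnAr -mulrnDr subnKC // -ltnS.
congr (_ + _).
  rewrite big_ord_recl mulr0n mul0r add0r; apply: eq_bigr => i _.
  by rewrite /= ?subSS.
rewrite big_ord_recr /= subnn mulr0n mulr0 addr0; apply: eq_bigr => i _.
by rewrite subSn // -ltnS.
Qed.

Lemma fps_derivX f n : fps_deriv (f ^+ n.+1) = f ^+ n * fps_deriv f *+ n.+1.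
Proof.
elim: n => [|n IH]; first by rewrite expr1 expr0 mul1r.
by rewrite exprS fps_derivM IH mulrnAr mulrA -exprS mulrC -mulrS.
Qed.

End FpsTheory.

Section Substitution.
Variables (A B : comNzRingType) (h : {rmorphism A -> fps B}) (v : fps B).
Hypothesis v0 : v 0%N = 0.

(** The composition f(v), with [h] applied to the coefficients. As v has no constant term, v^k
    starts at order k, and the sum for coefficient n may stop at k = n. *)
Definition fps_subst (f : fps A) : fps B :=
  Fps (fun n => \sum_(k < n.+1) (h (f k) * v ^+ k) n).

Let fps_substE f n : fps_subst f n = \sum_(k < n.+1) (h (f k) * v ^+ k) n.
Proof. by []. Qed.

Let vX_low (w : fps B) k n : (n < k)%N -> (w * v ^+ k) n = 0.
Proof.
have -> : v = fps_var B * Fps (fun k => v k.+1).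
  rewrite -[fps_var B]expr1; apply: fps_XnM => -[] //.
rewrite exprMn mulrCA => nk; rewrite fps_coefXnM.
by rewrite leqNgt nk.
Qed.

Let polyv : {rmorphism {poly A} -> fps B} := horner_eval v \o map_poly h.

Let polyv_coef (p : {poly A}) n : polyv p n = \sum_(k < n.+1) (h p`_k * v ^+ k) n.
Proof.
pose N := maxn (size p) n.+1.
have -> : polyv p = \sum_(k < N) h p`_k * v ^+ k.
  rewrite /= /horner_eval (@horner_coef_wide _ N).
    by apply: eq_bigr => i _; rewrite coef_map.
  by rewrite (leq_trans (size_poly _ _)) // leq_maxl.
rewrite fps_coef_sum [RHS](big_ord_widen N (fun k => (h p`_k * v ^+ k) n)) ?leq_maxr //.
rewrite [LHS](bigID (fun k : 'I_N => (k < n.+1)%N)) /= [X in _ + X]big1 ?addr0 // => i.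
by rewrite -leqNgt => ni; apply: vX_low.
Qed.

Lemma fps_subst_zmod_morphism : zmod_morphism fps_subst.
Proof.
move=> f g; apply: fpsP => n; rewrite fps_coefD fps_coefN !fps_substE -sumrB.
by apply: eq_bigr => k _; rewrite fps_coefD fps_coefN rmorphB mulrBl.
Qed.

(** Coefficient n depends only on the truncations of f and g after order n, and on polynomials the
    composition is the ring morphism [polyv]. *)
Lemma fps_subst_monoid_morphism : monoid_morphism fps_subst.
Proof.
split=> [|f g]; apply: fpsP => n.
  rewrite fps_substE big_ord_recl big1 ?addr0 => [|i _].
    by rewrite fps_coef1 expr0 mulr1 rmorph1.
  by rewrite fps_coef1 rmorph0 mul0r fps_coef0.
pose t (f : fps A) : {poly A} := \poly_(i < n.+1) f i.
have tE (f' : fps A) i : (i <= n)%N -> fps_subst f' i = polyv (t f') i.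
  move=> i_n; rewrite polyv_coef; apply: eq_bigr => k _.
  by rewrite coef_poly (leq_trans (ltn_ord k)).
rewrite fps_coefM.
rewrite (eq_bigr (fun i : 'I_n.+1 => polyv (t f) i * polyv (t g) (n - i)%N)); last first.
  by move=> i _; rewrite !tE ?leq_subr // -ltnS.
rewrite -fps_coefM -rmorphM polyv_coef; apply: eq_bigr => k _; congr ((h _ * _) _).
rewrite fps_coefM coefM; apply: eq_bigr => i _.
by rewrite !coef_poly (leq_ltn_trans (leq_subr _ _)) ?ltn_ord // (leq_trans (ltn_ord i)).
Qed.

Definition fpsSubst : {rmorphism fps A -> fps B} :=
  rmorph_of fps_subst_zmod_morphism fps_subst_monoid_morphism.

Lemma fpsSubstC a : fpsSubst (fps_const a) = h a.
Proof.
apply: fpsP => n; rewrite [LHS]fps_substE big_ord_recl big1 ?addr0 ?expr0 ?mulr1 // => i _.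
by rewrite [fps_const a _]/= rmorph0 mul0r fps_coef0.
Qed.

Lemma fpsSubstX : fpsSubst (fps_var A) = v.
Proof.
apply: fpsP => -[|n].
  by rewrite [LHS]fps_substE big_ord_recl big_ord0 addr0 rmorph0 mul0r /= v0.
rewrite [LHS]fps_substE 2!big_ord_recl big1 ?addr0 => [|i _].
  by rewrite rmorph0 mul0r rmorph1 mul1r expr1 fps_coef0 add0r.
by rewrite rmorph0 mul0r fps_coef0.
Qed.

Lemma fpsSubst_coef0 f : (fpsSubst f) 0%N = h (f 0%N) 0%N.
Proof. by rewrite [LHS]fps_substE big_ord_recl big_ord0 addr0 expr0 mulr1. Qed.

End Substitution.

(** * The series (1 + c eps^N)^(-1/N) *)

Section RootSeries.
Variables (C : numFieldType) (N : nat).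
Hypothesis N0 : (0 < N)%N.

(* Binomial coefficients of [(1 + x)^(-1/N)]. *)
Fixpoint root_coef (k : nat) : C :=
  if k is j.+1 then root_coef j * ((- N%:R^-1 - j%:R) / j.+1%:R) else 1.

(** Successive ratios have modulus (1/N + j) / (j + 1), at most 1 because 1/N <= 1. *)
Lemma root_coef_bound k : `|root_coef k| <= 1.
Proof.
elim: k => [|k IH] /=; first by rewrite normr1.
rewrite normrM mulr_ile1 // normf_div -opprD normrN ger0_norm ?addr_ge0 ?invr_ge0 ?ler0n //.
rewrite normr_nat ler_pdivrMr ?ltr0n // mul1r -natr1 addrC lerD2l.
by rewrite invf_le1 ?ltr0n // ler1n.
Qed.

Let natN0 : N%:R != 0 :> C. Proof. by rewrite pnatr_eq0 -lt0n. Qed.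

Let F : fps C := Fps root_coef.

Let rootS k : root_coef k.+1 *+ k.+1 = root_coef k * (- N%:R^-1 - k%:R).
Proof.
rewrite -[LHS]mulr_natr -[root_coef k.+1]/(root_coef k * ((- N%:R^-1 - k%:R) / k.+1%:R)).
by rewrite -mulrA divfK ?pnatr_eq0.
Qed.

Let F_ode : (1 + fps_var C) * fps_deriv F *+ N = - F.
Proof.
rewrite mulrDl mul1r; apply: fpsP => k.
have mulrn_coef (f : fps C) m : (f *+ m) k = f k *+ m.
  by elim: m => [|m IH]; rewrite ?mulr0n ?fps_coef0 // !mulrS fps_coefD IH.
rewrite mulrn_coef fps_coefD fps_coefXM fps_coefN.
have -> : fps_deriv F k = root_coef k * (- N%:R^-1 - k%:R) by rewrite -rootS.
have -> : F k = root_coef k by [].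
case: k {mulrn_coef} => [|k].
  by rewrite -[LHS]mulr_natr /= subr0 addr0 mulrN mulNr divfK.
have -> : fps_deriv F k = root_coef k.+1 * k.+1%:R by rewrite mulr_natr.
by rewrite -[LHS]mulr_natr -mulrDr subrK mulrN mulNr divfK.
Qed.

(** The recurrence of the coefficients amounts to N (1 + x) F' = -F, so G = F^N satisfies (1 + x) G'
    = -G and G(0) = 1. Coefficient k of this equation reads (k + 1)(G_{k+1} + G_k) = 0, hence (1 +
    x) G = 1. *)
Lemma root_series_pow : F ^+ N * (1 + fps_var C) = 1.
Proof.
have [M NM] : exists M, N = M.+1 by exists N.-1; rewrite prednK.
have dG : (1 + fps_var C) * fps_deriv (F ^+ N) = - F ^+ N.
  rewrite [in fps_deriv _]NM fps_derivX -NM mulrnAr mulrCA -mulrnAr F_ode mulrN.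
  by rewrite [in RHS]NM exprSr.
have G0 : (F ^+ N) 0%N = 1.
  by rewrite -[LHS]/(fpsEval0 C (F ^+ N)) rmorphXn expr1n.
apply: fpsP => k; rewrite mulrC mulrDl mul1r fps_coefD fps_coefXM fps_coef1.
case: k => [|k]; first by rewrite addr0 G0.
have := congr1 (fun f : fps C => f k) dG.
rewrite /= -[X in X = _]/(((1 + fps_var C) * fps_deriv (F ^+ N)) k).
rewrite mulrDl mul1r fps_coefD fps_coefXM.
set G := F ^+ N => e.
have e' : (G k.+1 + G k) * k.+1%:R = 0.
  move: e; rewrite -[fps_deriv G k]/(G k.+1 *+ k.+1).
  case: k => [|k].
    rewrite addr0 mulr1n => e; have -> : G 1%N + G 0%N = 0 by rewrite e addNr.
    exact: mul0r.
  rewrite -[fps_deriv G k]/(G k.+1 *+ k.+1) => e.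
  rewrite mulrDl mulr_natr -[k.+2%:R]natr1 mulrDr mulr1 mulr_natr addrA e.
  by rewrite addNr.
by apply/eqP; have /eqP := e'; rewrite mulf_eq0 pnatr_eq0 orbF.
Qed.

End RootSeries.

Section EpsRoot.
Variables (R : realType) (n N : nat).
Hypothesis N0 : (0 < N)%N.
Local Notation C := (Cplx R).
Local Notation A := {mpoly C[n]}.
Implicit Types c : A.

Let hC : {rmorphism C -> fps A} := fpsPoly A \o (polyC \o @mpolyC n C).

Definition epsPow c : fps A := fps_const c * fps_var A ^+ N.

Let hCE a : hC a = fps_const a%:MP. Proof. exact: fpsPolyC. Qed.

Fact epsPow0 c : epsPow c 0%N = 0.
Proof. by rewrite /epsPow fps_coefCM fps_coefXn eq_sym (gtn_eqF N0) mulr0. Qed.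

Definition eps_root c : fps A := fpsSubst hC (epsPow0 c) (Fps (root_coef C N)).

Lemma eps_root_pow c : eps_root c ^+ N * (1 + epsPow c) = 1.
Proof.
rewrite /eps_root; have e := fpsSubstX hC (epsPow0 c).
move: (fpsSubst hC (epsPow0 c)) e => s e.
have -> : 1 + epsPow c = s (1 + fps_var C) by rewrite rmorphD rmorph1 e.
by rewrite -rmorphXn -rmorphM root_series_pow // rmorph1.
Qed.

Lemma eps_root_coef0 c : eps_root c 0%N = 1.
Proof.
rewrite /eps_root fpsSubst_coef0 [X in hC X](_ : _ = 1) //.
by rewrite (rmorph1 hC) fps_coef1.
Qed.

Lemma fps_constX (a : A) k : fps_const a ^+ k = fps_const (a ^+ k).
Proof. by rewrite -!(fpsPolyC) -rmorphXn -polyC_exp. Qed.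

(** At a point, coefficient k is a sum over i <= k in which only N i = k contributes, and the i-th
    term has modulus at most |c|^i by [root_coef_bound]. The sum of all |c|^i is at most (|c| + 1)^k
    by [sumX_le] with y = 1. *)
Lemma eps_root_growth c : bounded_growth (eps_root c).
Proof.
move=> a; pose x : R := complex.Re `|c.@[a]|.
have xE : `|c.@[a]| = real_complex _ x by rewrite /x RRe_real // normr_real.
have x0 : 0 <= x by rewrite -lecR -xE; exact: normr_ge0.
exists (x + 1) => [|k]; first by rewrite addr_ge0.
have -> : eps_root c k = \sum_(i < k.+1) (root_coef C N i)%:MP * (c ^+ i * (k == N * i)%N%:R).
  rewrite /eps_root -[LHS]/(fps_subst hC (epsPow c) (Fps (root_coef C N)) k) /fps_subst.
  apply: eq_bigr => i _; rewrite hCE fps_coefCM exprMn fps_constX fps_coefCM.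
  by rewrite -exprM fps_coefXn.
rewrite raddf_sum; apply: (le_trans (ler_norm_sum _ _ _)).
apply: (@le_trans _ _ (\sum_(i < k.+1) `|c.@[a]| ^+ i)).
  apply: ler_sum => i _; rewrite /= !mevalM mevalC rmorphXn /= normrM mulrC -[leRHS]mulr1.
  rewrite ler_pM ?normr_ge0 ?root_coef_bound // normrM normrX.
  rewrite -[leRHS]mulr1 ler_wpM2l ?exprn_ge0 ?normr_ge0 //.
  by case: eqP => _; rewrite ?rmorph1 ?rmorph0 ?normr1 ?normr0 ?ler01.
have -> : \sum_(i < k.+1) `|c.@[a]| ^+ i =
    real_complex _ (\sum_(i < k.+1) x ^+ i * 1 ^+ (k - i)).
  by rewrite rmorph_sum; apply: eq_bigr => i _; rewrite xE expr1n mulr1 rmorphXn.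
rewrite lecR (le_trans (sumX_le k x0 ler01)) // exprS -[leLHS]mul1r.
by rewrite ler_wpM2r ?exprn_ge0 ?addr_ge0 // lerDr.
Qed.

End EpsRoot.

(** * Lifts to the field of the new variables *)

(** rho is defined on maps rather than on words, by picking their lift; uniqueness of lifts makes it
    multiplicative whatever relations hold among the generators. *)
Lemma action_of_lifts (F L : fieldType) (X : (F -> F) -> Prop)
    (lift : (F -> F) -> (L -> L) -> Prop) :
  (forall w f, lift w f -> field_automorphism f) ->
  lift id id ->
  (forall v w f g, lift v f -> lift w g -> lift (v \o w) (f \o g)) ->
  (forall v w f, lift v f -> cancel v w -> cancel w v -> exists g, lift w g) ->
  (forall w f g, lift w f -> lift w g -> f = g) ->
  (forall w, X w -> exists f, lift w f) ->
  exists rho : (F -> F) -> L -> L, acts_by_automorphisms (generated X) rho /\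
    forall w, generated X w -> lift w (rho w).
Proof.
move=> liftA lift1 liftM liftV liftU liftX.
have liftG w : generated X w -> exists f, lift w f.
  elim=> {w} [w /liftX //||v w _ [f vf] _ [g wg]|v w _ [f vf] vw wv].
  - by exists id.
  - by exists (f \o g); apply: liftM.
  - exact: liftV vf vw wv.
pose rho w := if pselect (exists f, lift w f) is left h then projT1 (cid h) else id.
have rhoP w : generated X w -> lift w (rho w).
  by move=> /liftG h; rewrite /rho; case: pselect => // h'; case: (cid h').
exists rho; split=> //; split.
- by move=> w /rhoP/liftA.
- by apply: liftU lift1; apply/rhoP/generated_one.
- move=> v w gv gw; apply: (liftU (v \o w)); first exact/rhoP/generated_mul.
  by apply: liftM; apply: rhoP.
Qed.

Section RmorphOf.
Variables (F : fieldType) (f : F -> F).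
Lemma field_automorphism_rmorph : field_automorphism f ->
  exists g : {rmorphism F -> F}, g =1 f.
Proof. by case=> fB fM _; exists (rmorph_of fB fM). Qed.

Lemma field_automorphism_comp (g : F -> F) :
  field_automorphism f -> field_automorphism g -> field_automorphism (f \o g).
Proof.
move=> [fB [f1 fM] fbij] [gB [g1 gM] gbij]; split; last exact: bij_comp.
- by move=> x y /=; rewrite gB fB.
- by split=> [|x y] /=; rewrite ?g1 ?f1 ?gM ?fM.
Qed.

Lemma field_automorphism_inv : field_automorphism f ->
  exists g, [/\ cancel f g, cancel g f & field_automorphism g].
Proof.
move=> [fB [f1 fM] [g fg gf]]; exists g; split=> //; split.
- by move=> x y; apply: (can_inj fg); rewrite fB !gf.
- by split=> [|x y]; apply: (can_inj fg); rewrite ?f1 ?fM !gf.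
- by exists f.
Qed.
End RmorphOf.

Lemma ratfun_ext (B : idomainType) (F : fieldType) (f g : {rmorphism ratfun B -> F}) :
  (forall b, f (coefF b) = g (coefF b)) -> f (var_t B) = g (var_t B) ->
  f (var_q B) = g (var_q B) -> f (var_p B) = g (var_p B) -> f =1 g.
Proof.
move=> ec et eq ep x.
have ePB : (f \o toFrac {mpoly B[3]}) =1 (g \o toFrac {mpoly B[3]}).
  apply: (@mpoly_rmorph_ext 3 B F (f \o toFrac {mpoly B[3]}) (g \o toFrac {mpoly B[3]})).
    exact: ec.
  by move=> [[|[|[|?]]] h] //=.
case: (@fracE {mpoly B[3]} x) => -[n m] /= _ ->.
by rewrite !fmorph_div; congr (_ / _); apply: ePB.
Qed.

(** A specialization need only be checked on the generators of K_J. Denominators are harmless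
    because [g] is a morphism of fields and cannot kill them. *)
Lemma K_rmorph_spec (R : realType) J (L F : fieldType) (D : specData L F)
    (f : {rmorphism K R J -> L}) (g : {rmorphism K R J -> F}) :
  (forall c, spec D (f (constK R J c)) (g (constK R J c))) ->
  (forall j, (j <= rank J)%N -> spec D (f (al R J j)) (g (al R J j))) ->
  spec D (f (var_t _)) (g (var_t _)) -> spec D (f (var_q _)) (g (var_q _)) ->
  spec D (f (var_p _)) (g (var_p _)) ->
  forall x, spec D (f x) (g x).
Proof.
move=> sc sa st sq sp x.
have alE (k : 'I_(rank J)) : alpha R (lift ord0 k) = al R J k.+1.
  by congr (alpha R _); apply: val_inj; rewrite /= inordK // ltnS.
have coefE (M : fieldType) (h : {rmorphism K R J -> M}) (b : paramRing R J) :
    h (coefF b) = mmap (h \o constK R J) (fun k => h (alpha R (lift ord0 k))) b.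
  apply: (@mpoly_rmorph_ext _ _ M (h \o coefR (paramRing R J)) (mmap (h \o constK R J) _)).
  - by move=> c; rewrite [RHS]mmapC.
  - by move=> i; rewrite [RHS]mmapXU /= /alpha /param liftK.
have polyE (M : fieldType) (h : {rmorphism K R J -> M}) n : h (ratfun_of n) =
    mmap (h \o coefR (paramRing R J)) (vec3 (h (var_t _)) (h (var_q _)) (h (var_p _))) n.
  apply: (@mpoly_rmorph_ext _ _ M (h \o (toFrac _ : {rmorphism _ -> K R J})) (mmap _ _)).
  - by move=> c; rewrite [RHS]mmapC.
  - move=> i; rewrite [RHS]mmapXU /=.
    by case: i => -[|[|[|?]]] //= hi; rewrite /vec3 /=; congr (h (ratfun_of 'X__));
      apply: val_inj.
have sn n : spec D (f (ratfun_of n)) (g (ratfun_of n)).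
  rewrite (polyE L f n) (polyE F g n); apply: spec_mmap => [b|i]; last exact: spec_vec3.
  suff : spec D (f (coefF b)) (g (coefF b)) by [].
  rewrite (coefE L f b) (coefE F g b).
  by apply: spec_mmap => [c|k]; [apply: sc|rewrite alE; apply: sa].
case: (@fracE {mpoly (paramRing R J)[3]} x) => -[n m] /= m0 ->.
rewrite !fmorph_div; apply: specM; first exact: sn.
apply: specV; last exact: sn.
by rewrite fmorph_eq0 toFrac_eq0.
Qed.

Section FpsExt.
Variables (A B : comNzRingType).

(** Continuity is automatic: the image of the variable has no constant term, so both morphisms send
    multiples of its (n+1)-st power to series without terms of order <= n, and coefficient n of an
    image depends only on a polynomial truncation. *)
Lemma fps_rmorph_ext (f g : {rmorphism fps A -> fps B}) :
  (forall a, f (fps_const a) = g (fps_const a)) ->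
  f (fps_var A) = g (fps_var A) -> f (fps_var A) 0%N = 0 -> f =1 g.
Proof.
move=> ec ev f0 x; apply: fpsP => n.
pose p : {poly A} := \poly_(i < n.+1) x i.
have [y ->] : exists y, x = fpsPoly A p + fps_var A ^+ n.+1 * y.
  exists (Fps (fun k => (x - fpsPoly A p) (n.+1 + k)%N)).
  rewrite -fps_XnM ?subrKC // => k kn.
  by rewrite fps_coefD fps_coefN /= coef_poly kn subrr.
have vE : f (fps_var A) = fps_var B ^+ 1 * Fps (fun k => f (fps_var A) (1 + k)%N).
  by apply: fps_XnM => -[].
have low (h : {rmorphism fps A -> fps B}) : h (fps_var A) = f (fps_var A) ->
    h (fps_var A ^+ n.+1 * y) n = 0.
  move=> hv; rewrite rmorphM rmorphXn hv vE expr1 exprMn -mulrA fps_coefXnM.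
  by rewrite ltnn.
rewrite !rmorphD !fps_coefD !low //; congr (_ + _); congr (fps_coef _ n).
apply: (@poly_rmorph_ext _ _ (f \o fpsPoly A) (g \o fpsPoly A)).
- by move=> c; rewrite /= -[fps_poly _]/(fpsPoly A _) fpsPolyC.
- by rewrite /= -[fps_poly _]/(fpsPoly A _) fpsPolyX.
Qed.

End FpsExt.

Lemma fps_varX_neq0 (A : idomainType) n : fps_var A ^+ n != 0.
Proof.
apply/eqP => v0; have := congr1 (fun h : fps A => h n) v0.
by rewrite fps_coefXn eqxx fps_coef0 => /eqP; rewrite oner_eq0.
Qed.

(** The cofactor of x - y in x^(n+1) - y^(n+1) has constant term n + 1 and is therefore nonzero. *)
Lemma fps_pow_inj (A : idomainType) n (x y : fps A) : n.+1%:R != 0 :> A ->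
  x 0%N = 1 -> y 0%N = 1 -> x ^+ n.+1 = y ^+ n.+1 -> x = y.
Proof.
move=> n0 x0 y0 /eqP; rewrite -subr_eq0 subrXX mulf_eq0 => /orP[/eqP/subr0_eq //|/eqP e].
have := congr1 (fun f : fps A => fpsEval0 A f) e.
rewrite rmorph0 rmorph_sum (eq_bigr (fun=> 1)) => [|i _].
  by rewrite sumr_const card_ord => /eqP; rewrite (negPf n0).
by rewrite rmorphM !rmorphXn /= x0 y0 !expr1n mulr1.
Qed.

(* [S_i] maps [eps ^- N] to [eps ^- N + A_i *~ eps_shift d i], where [N = eps_order d]. *)
Definition eps_shift (d : degeneration) (i : nat) : int :=
  nth 0 match d with
  | V_IV => [:: 2; 0; -2]
  | IV_II | III_II => [:: -4; 4]
  | _ => [::]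
  end i.

(** The identity that dictates [eps_shift]: reflecting A by s_i of the target and shifting eps^-N
    reproduces the action of S_i on all old parameters at once. *)
Lemma old_al_S (F : fieldType) d i (A A' : nat -> F) (e e' : F) :
  2 != 0 :> F -> ~~ birational d -> (i <= rank (target d))%N ->
  (forall j, (j <= rank (target d))%N -> A' j = A j - A i *~ cartan (target d) i j) ->
  e'^-1 ^+ eps_order d = e^-1 ^+ eps_order d + A i *~ eps_shift d i ->
  forall j, (j <= rank (source d))%N ->
  nth 0 (old_al d A' e') j = S_al d i (nth 0 (old_al d A e)) j.
Proof.
move=> n2; have n4 : 4 != 0 :> F by have -> : 4 = 2 * 2 :> F; [ring|rewrite mulf_neq0].
have mz (x : F) : (x *~ (-1) = - x) * (x *~ (- 2)%R = - (2 * x)) * (x *~ 2 = 2 * x)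
    * (x *~ 0 = 0) * (x *~ 1 = x) * (x *~ 4 = 4 * x) * (x *~ (-4) = - (4 * x)).
  by rewrite !mulrNz mulr1z mulr0z !mulrz_nat !mulr_natl.
rewrite /old_al /eps_order; case: d => //= _; do 4?[case: i => [|i] //]; move=> _ AA;
  rewrite ?exprVn /eps_shift /= => ee j.
all: have A0 := AA 0%N isT; have A1 := AA 1%N isT; try have A2 := AA 2%N isT.
all: do 5?[case: j => [|j] //]; move=> _ /=.
all: rewrite ?ee ?A0 ?A1 ?A2 /= ?mz.
all: move: {ee} (e ^- _) => x.
all: try (by field; nz_tac).
all: ring.
Qed.

Section EpsRing.
Variables (R : realType) (d : degeneration).
Hypothesis bd : ~~ birational d.
Local Notation CA := (paramRing R (target d)).
Local Notation B := (epsRing R d).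

(** Inverse of [epsSeries] off the birational cases; the constant term taken in the other branch is
    a placeholder. *)
Definition fpsToEps : {rmorphism fps CA -> B} :=
  if birational d as b
    return {rmorphism fps CA -> (if b then {poly CA} : idomainType else fps CA)}
  then polyC \o fpsEval0 CA else idfun.

Lemma fpsToEpsK : cancel fpsToEps (epsSeries R d).
Proof. by rewrite /fpsToEps /epsSeries /epsRing; case: (birational d) bd. Qed.

Lemma epsSeriesK : cancel (epsSeries R d) fpsToEps.
Proof. by rewrite /fpsToEps /epsSeries /epsRing; case: (birational d) bd. Qed.

Lemma fpsToEpsC a : fpsToEps (fps_const a) = eps_const a.
Proof.
apply: (can_inj epsSeriesK).
by rewrite fpsToEpsK -epsPolyC epsSeries_poly fpsPolyC.
Qed.

Lemma fpsToEpsX : fpsToEps (fps_var CA) = eps_var R d.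
Proof.
apply: (can_inj epsSeriesK).
by rewrite fpsToEpsK -epsPolyX epsSeries_poly fpsPolyX.
Qed.
End EpsRing.

(** * Reflections acting on A and on power series in eps *)

Section ParamReflection.
Variables (R : realType) (J : painleve) (i : 'I_(rank J).+1).
Local Notation CA := (paramRing R J).

Definition refl_param (j : 'I_(rank J).+1) : CA := param R j - param R i *~ cartan J i j.

Definition reflA : {rmorphism CA -> CA} :=
  mmap (@mpolyC (rank J) (Cplx R)) (fun k => refl_param (lift ord0 k)).

Lemma reflA_C c : reflA (c%:MP : {mpoly (Cplx R)[rank J]}) = (c%:MP : {mpoly (Cplx R)[rank J]}).
Proof. exact: mmapC. Qed.

Lemma reflA_param j : reflA (param R j) = refl_param j.
Proof.
apply: (@param_image R J {mpoly (Cplx R)[rank J]} (@mpolyC (rank J) (Cplx R)) refl_param).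
apply: (@coefF_inj CA); rewrite -[LHS]/(coefR CA _) -[RHS]/(coefR CA 1) rmorph1.
rewrite -(s_param_normalization R i) rmorph_sum; apply: eq_bigr => k _.
by rewrite rmorphMn rmorphB rmorphMz.
Qed.

Lemma reflA_param_diag : reflA (param R i) = - param R i.
Proof.
by rewrite reflA_param /refl_param cartan_diag mulrz_nat mulr2n opprD addrA subrr sub0r.
Qed.

Lemma reflAK : involutive reflA.
Proof.
pose f : {rmorphism CA -> CA} := reflA \o reflA; pose g : {rmorphism CA -> CA} := idfun.
suff fg : f =1 g by move=> a; have := fg a; rewrite /f /g /= => E; rewrite E.
apply: (@mpoly_rmorph_ext (rank J) (Cplx R) CA f g).
- by move=> c; rewrite /f /g /= !reflA_C.
- move=> k; have -> : 'X_k = param R (lift ord0 k) by rewrite /param liftK.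
  rewrite /f /g /= reflA_param /refl_param rmorphB rmorphMz reflA_param_diag reflA_param.
  by rewrite /refl_param mulNrz opprK subrK.
Qed.

End ParamReflection.

Section SeriesReflection.
Variables (R : realType) (J : painleve) (i : 'I_(rank J).+1) (N : nat) (z : int).
Hypothesis N0 : (0 < N)%N.
Local Notation CA := (paramRing R J).

Let c : CA := param R i *~ z.
Definition refl_root : fps CA := eps_root N0 c.

Definition reflC : {rmorphism CA -> fps CA} := fpsPoly CA \o (polyC \o reflA R i).

Lemma reflCE a : reflC a = fps_const (reflA R i a).
Proof. exact: fpsPolyC. Qed.

Fact refl_eps0 : (fps_var CA * refl_root) 0%N = 0.
Proof. by rewrite fps_coefXM. Qed.

(* [A |-> s_i(A)] and [eps ^- N |-> eps ^- N + A_i *~ z]. *)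
Definition reflS : {rmorphism fps CA -> fps CA} := fpsSubst reflC refl_eps0.

Lemma reflSC a : reflS (fps_const a) = fps_const (reflA R i a).
Proof. by rewrite /reflS fpsSubstC reflCE. Qed.

Lemma reflSX : reflS (fps_var CA) = fps_var CA * refl_root.
Proof. exact: fpsSubstX. Qed.

Lemma refl_root_pow : refl_root ^+ N * (1 + epsPow N c) = 1.
Proof. exact: eps_root_pow. Qed.

Let reflS_c : reflS (fps_const c) = - fps_const c.
Proof.
rewrite reflSC /c rmorphMz reflA_param_diag mulNrz -fpsPolyC -[in RHS]fpsPolyC.
by rewrite -rmorphN polyCN.
Qed.

Lemma reflS_coef0 f : (reflS f) 0%N = reflA R i (f 0%N).
Proof. by rewrite /reflS fpsSubst_coef0 reflCE. Qed.

(** Applying the reflection to U^N (1 + c eps^N) = 1 turns c into -c and eps^N into eps^N U^N. As 1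
    - c eps^N U^N = U^N, the product of U and its image has N-th power 1, and its constant term 1
    forces it to be 1. *)
Let rootM : reflS refl_root * refl_root = 1.
Proof.
have e := refl_root_pow; have e2 := congr1 reflS e.
move: e2; rewrite rmorphM rmorphD !rmorph1 rmorphXn.
rewrite /epsPow rmorphM reflS_c rmorphXn reflSX exprMn mulNr mulrA.
have -> : 1 - fps_const c * fps_var CA ^+ N * refl_root ^+ N = refl_root ^+ N.
  rewrite -[1 in LHS]e /epsPow mulrDr mulr1 [X in _ - X]mulrC.
  by rewrite addrK.
rewrite -exprMn => e3; case: (N) N0 e3 => // M _ e3.
apply: (@fps_pow_inj _ M); last by rewrite e3 expr1n.
- by rewrite -(rmorph_nat (@mpolyC (rank J) (Cplx R))) mpolyC_eq0 pnatr_eq0.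
- have r0 : refl_root 0%N = 1 := eps_root_coef0 N0 c.
  have s0 : (reflS refl_root) 0%N = 1.
    by apply: (etrans (reflS_coef0 _)); rewrite r0 rmorph1.
  exact: etrans (fps_coef0M _ _) (etrans (congr2 *%R s0 r0) (mulr1 _)).
- by rewrite fps_coef1.
Qed.

Lemma reflSK : involutive reflS.
Proof.
move=> f; apply: (@fps_rmorph_ext _ _ (reflS \o reflS) idfun).
- by move=> a; rewrite -[LHS]/(reflS (reflS _)) !reflSC reflAK.
- rewrite -[LHS]/(reflS (reflS _)) reflSX rmorphM reflSX -mulrA.
  by rewrite [refl_root * _]mulrC rootM mulr1.
- rewrite -[fps_coef _ _]/(reflS (reflS (fps_var CA)) 0%N) reflSX rmorphM reflSX -mulrA.
  exact: fps_coefXM.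
Qed.

End SeriesReflection.

Lemma eq_new_A (F : fieldType) d (a a' : nat -> F) j :
  (forall k, (k <= rank (source d))%N -> a k = a' k) -> new_A d a j = new_A d a' j.
Proof. by move=> aa; rewrite /new_A; case: d aa => /= aa; rewrite !aa. Qed.

Lemma rmorph_new_A (L F : fieldType) (f : {rmorphism L -> F}) d (a : nat -> L) j :
  f (new_A d a j) = new_A d (fun k => f (a k)) j.
Proof.
rewrite /new_A; case: d; do 5?[case: j => [|j] //=]; rewrite ?nth_nil ?rmorph0 //.
all: by rewrite ?(rmorph_nat, rmorphD, rmorphM, fmorphV).
Qed.

Lemma eq_eps_inv (F : fieldType) d (a a' : nat -> F) :
  (forall k, (k <= rank (source d))%N -> a k = a' k) -> eps_inv d a = eps_inv d a'.
Proof. by move=> aa; rewrite /eps_inv; case: d aa => /= aa; rewrite !aa. Qed.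

Lemma rmorph_eps_inv (L F : fieldType) (f : {rmorphism L -> F}) d (a : nat -> L) :
  f (eps_inv d a) = eps_inv d (fun k => f (a k)).
Proof.
rewrite /eps_inv; case: d => /=; rewrite ?rmorphN ?rmorphM ?rmorph_nat //.
Qed.

Lemma eps_inv_old (F : fieldType) d (A : nat -> F) e : 2 != 0 :> F ->
  eps_inv d (nth 0 (old_al d A e)) = e^-1 ^+ eps_order d.
Proof.
move=> n2; have n4 : 4 != 0 :> F by have -> : 4 = 2 * 2 :> F; [ring|rewrite mulf_neq0].
rewrite /eps_inv /old_al; case: d => //=; rewrite ?exprVn ?expr1 //.
- by rewrite mulrN opprK mulVKf.
- by rewrite mulVKf.
- by rewrite mulVKf.
Qed.

Lemma rmorph_new_tqp (L F : fieldType) (f : {rmorphism L -> F}) d A e tau t q p r2 :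
  let n := new_tqp d A e tau t q p r2 in
  (f n.1.1, f n.1.2, f n.2) =
    new_tqp d (fun j => f (A j)) (f e) (f tau) (f t) (f q) (f p) (f r2).
Proof.
rewrite /new_tqp; case: d => /=.
all: by rewrite ?(rmorph_nat, rmorphXn, rmorph1, rmorphD, rmorphN, rmorphM, fmorphV).
Qed.

(** * Lifts: definition and stability *)

Section EpsMultiple.
Variable CA : comNzRingType.

Definition eps_multiple (s : {rmorphism fps CA -> fps CA}) : Prop :=
  exists2 u : fps CA, s (fps_var CA) = fps_var CA * u & u 0%N = 1.

(** [s] sends multiples of eps to multiples of eps, so it cannot disturb the constant term 1; this
    makes the normalization stable under composition. *)
Lemma eps_multiple_coef0 s (u : fps CA) : eps_multiple s -> u 0%N = 1 -> (s u) 0%N = 1.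
Proof.
move=> [v sv v0] u0.
have -> : u = 1 + fps_var CA ^+ 1 * Fps (fun k => (u - 1) (1 + k)%N).
  rewrite -fps_XnM ?subrKC // => -[] // _.
  by rewrite fps_coefD fps_coefN fps_coef1 u0 subrr.
rewrite rmorphD rmorph1 expr1 rmorphM sv -mulrA fps_coefD fps_coef1.
by rewrite fps_coefXM addr0.
Qed.

Lemma eps_multiple_comp s s' : eps_multiple s -> eps_multiple s' -> eps_multiple (s \o s').
Proof.
move=> ms [u su u0]; have [v sv v0] := ms; exists (v * s u).
  by rewrite /= su rmorphM sv mulrA.
by rewrite fps_coef0M v0 eps_multiple_coef0 ?mulr1.
Qed.

End EpsMultiple.

Section Lifts.
Variables (R : realType) (d : degeneration).
Local Notation C := (Cplx R).
Local Notation CA := (paramRing R (target d)).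
Local Notation B := (epsRing R d).
Local Notation EE := (E R d).
Local Notation KS := (K R (source d)).
Variable iota : {rmorphism KS -> EE}.
Hypothesis iotaP : substitutes_old iota.

Let iota_al j : (j <= rank (source d))%N -> iota (al R (source d) j) = oldA R d j.
Proof. by case: iotaP => _ h *; apply: h. Qed.
Let iota_t : iota (var_t _) = (oldE R d).1.1. Proof. by case: iotaP. Qed.
Let iota_q : iota (var_q _) = (oldE R d).1.2. Proof. by case: iotaP. Qed.
Let iota_p : iota (var_p _) = (oldE R d).2. Proof. by case: iotaP. Qed.

Let e := eps R d.
Let r2 : EE := constE d (sqrtC 2).
Let n2 : 2 != 0 :> EE := natE_neq0 R d 1.

Definition tauE : EE := tau_of d (eps R d) (T_ R d).

Lemma new_tqpE : new_tqp d (AE R d) (eps R d) tauE (iota (var_t _)) (iota (var_q _))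
    (iota (var_p _)) (constE d (sqrtC 2)) = (T_ R d, Q_ R d, P_ R d) /\
  new_ok d (eps R d) tauE (iota (var_t _)) (iota (var_q _)) /\
  tau_rel d tauE (iota (var_t _)).
Proof.
have [h1 h2 h3] := new_oldK (AE R d) (P_ R d) n2 (sqrt2E R d) (old_okE R d).
by rewrite iota_t iota_q iota_p.
Qed.

Lemma iota_new_A j : (j <= rank (target d))%N ->
  iota (new_A d (al R (source d)) j) = AE R d j.
Proof.
move=> jr; rewrite rmorph_new_A.
by rewrite (eq_new_A _ iota_al) new_A_old.
Qed.

Lemma iota_eps_inv : iota (eps_inv d (al R (source d))) = e^-1 ^+ eps_order d.
Proof. by rewrite rmorph_eps_inv (eq_eps_inv iota_al) eps_inv_old. Qed.

(** [new_tqp] writes T, Q, P rationally in A, eps, tau and the images of the old variables. *)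
Lemma E_rmorph_ext (f g : {rmorphism EE -> EE}) :
  (forall x, f (iota x) = g (iota x)) -> f e = g e -> f tauE = g tauE ->
  (forall b, f (coefF b) = g (coefF b)) -> f =1 g.
Proof.
move=> fgi fge fgt fgc; have [ne [ok _]] := new_tqpE.
have fA : (fun j => f (AE R d j)) = (fun j => g (AE R d j)).
  by apply/funext => j; rewrite /AE /A_ fgc.
have fr : f r2 = g r2 by rewrite /r2 /constE fgc.
have := rmorph_new_tqp f d (AE R d) e tauE (iota (var_t _)) (iota (var_q _))
    (iota (var_p _)) r2.
have := rmorph_new_tqp g d (AE R d) e tauE (iota (var_t _)) (iota (var_q _))
    (iota (var_p _)) r2.
move=> hg; rewrite fA fr fge fgt !fgi -hg; move: ne; rewrite -/e -/r2 => -> [fT fQ fP].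
exact: ratfun_ext.
Qed.

(** [s] is the action of phi on the coefficient ring. Its inverse [s'] is recorded with its own
    normalization so that inverses of lifts are lifts. *)
Definition substitutive (phi : EE -> EE) : Prop :=
  exists s s' : {rmorphism fps CA -> fps CA},
    [/\ forall b, phi (coefF b) = coefF (fpsToEps R d (s (epsSeries R d b))),
        cancel s s', cancel s' s, eps_multiple s & eps_multiple s'].

(* Off the birational cases a lift of [w] to the power series is pinned down by its
   action on [eps], up to a root of unity fixed by [eps_multiple]. *)
Definition lifts (w : KS -> KS) (phi : EE -> EE) : Prop :=
  [/\ field_automorphism phi, forall x, phi (iota x) = iota (w x), phi tauE = tauE
    & ~~ birational d -> substitutive phi].

Lemma lifts_id : lifts id id.
Proof.
split=> //.
- by split=> //; exists id.
- move=> bd; exists idfun, idfun; split=> //.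
  + by move=> b; rewrite /= epsSeriesK.
  + by exists 1; rewrite ?mulr1 ?fps_coef1.
  + by exists 1; rewrite ?mulr1 ?fps_coef1.
Qed.

Lemma lifts_comp v w f g : lifts v f -> lifts w g -> lifts (v \o w) (f \o g).
Proof.
move=> [fa fi ft fs] [ga gi gt gs]; split.
- exact: field_automorphism_comp.
- by move=> x /=; rewrite gi fi.
- by rewrite /= gt ft.
- move=> bd; have [s [s' [sE ss' s's ms ms']]] := fs bd.
  have [z [z' [zE zz' z'z mz mz']]] := gs bd.
  exists (s \o z), (z' \o s'); split.
  + by move=> b; rewrite /= zE sE fpsToEpsK.
  + exact: can_comp.
  + exact: can_comp.
  + exact: eps_multiple_comp.
  + exact: eps_multiple_comp.
Qed.

Lemma lifts_inv v w f : lifts v f -> cancel v w -> cancel w v -> exists g, lifts w g.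
Proof.
move=> [fa fi ft fs] vw wv; have [g [fg gf ga]] := field_automorphism_inv fa.
exists g; split=> //.
- by move=> x; rewrite -{1}[x]wv -fi fg.
- by rewrite -[in LHS]ft fg.
- move=> bd; have [s [s' [sE ss' s's ms ms']]] := fs bd.
  exists s', s; split=> // b; apply: (can_inj fg); rewrite gf sE fpsToEpsK // s's.
  by rewrite epsSeriesK.
Qed.

End Lifts.

Lemma mmap_closed (L : comNzRingType) (B : nzRingType) n (S : L -> Prop)
    (c : B -> L) (h : 'I_n -> L) :
  S 0 -> S 1 -> (forall x y, S x -> S y -> S (x + y)) ->
  (forall x y, S x -> S y -> S (x * y)) ->
  (forall b, S (c b)) -> (forall i, S (h i)) -> forall p, S (mmap c h p).
Proof.
move=> S0 S1 SD SM Sc Sh p; apply: (big_ind S); [exact: S0|exact: SD|] => m _.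
apply: (SM); first exact: Sc.
apply: (big_ind S); [exact: S1|exact: SM|] => i _.
elim: (m i : nat) => [|k IH]; first by rewrite expr0.
by rewrite exprS; apply: SM.
Qed.

(** * Lifts in the birational cases, and uniqueness in all cases *)

Section LiftExistence.
Variables (R : realType) (d : degeneration).
Local Notation C := (Cplx R).
Local Notation CA := (paramRing R (target d)).
Local Notation B := (epsRing R d).
Local Notation EE := (E R d).
Local Notation KS := (K R (source d)).
Variable iota : {rmorphism KS -> EE}.
Hypothesis iotaP : substitutes_old iota.

Local Notation e := (eps R d).
Local Notation r2 := (constE d (sqrtC 2) : EE).
Local Notation tau := (tauE R d).

(** In the birational cases N = 1 and tau = 1, so eps, A and then T, Q, P are recovered from images
    of old coordinates by [eps_inv], [new_A] and [new_tqp]. *)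
Lemma iota_surjective : birational d -> forall x, exists y, iota y = x.
Proof.
move=> bd; pose S x := exists y, iota y = x.
have ic c : iota (constK R (source d) c) = cE R d c by case: iotaP.
have S0 : S 0 by exists 0; rewrite rmorph0.
have S1 : S 1 by exists 1; rewrite rmorph1.
have SD x y : S x -> S y -> S (x + y).
  by move=> [x' <-] [y' <-]; exists (x' + y'); rewrite rmorphD.
have SM x y : S x -> S y -> S (x * y).
  by move=> [x' <-] [y' <-]; exists (x' * y'); rewrite rmorphM.
have SV x : S x -> S x^-1 by move=> [x' <-]; exists x'^-1; rewrite fmorphV.
have N1 : eps_order d = 1%N by case: (d) bd.
have Se : S e.
  rewrite -[e]invrK; apply: SV; exists (eps_inv d (al R (source d))).
  by rewrite (iota_eps_inv iotaP) N1.
pose y j : KS := new_A d (al R (source d)) (inord j : 'I_(rank (target d)).+1).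
have yE : (fun j => iota (y j)) = AE R d.
  apply/funext => j; apply: etrans (AE_ord R (inord j)).
  by apply: (iota_new_A iotaP); rewrite -ltnS.
have [e' e'E] := Se.
have [y1 y1E] : exists y1, iota y1 = tau.
  by exists 1; rewrite rmorph1 /tauE /tau_of; case: (d) bd.
have r2E : r2 = iota (constK R (source d) (sqrtC 2)) by rewrite ic cE_E.
have [ne _] := new_tqpE iotaP.
pose o := new_tqp d y e' y1 (var_t _) (var_q _) (var_p _) (constK R (source d) (sqrtC 2)).
have := rmorph_new_tqp iota d y e' y1 (var_t _) (var_q _) (var_p _) (constK R (source d) (sqrtC 2)).
rewrite yE e'E y1E -r2E ne => -[ST SQ SP].
have SA (a : CA) : S (polyE R d a%:P).
  have -> : polyE R d a%:P = mmap (cE R d) (fun k => AE R d k.+1) a.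
    apply: (@mpoly_rmorph_ext _ C EE (polyE R d \o polyC) (mmap (cE R d) _)).
    - by move=> c; rewrite [RHS]mmapC.
    - move=> k; rewrite [RHS]mmapXU /= -[RHS]polyE_C /param.
      by rewrite (_ : inord k.+1 = lift ord0 k) ?liftK //; apply: val_inj; rewrite /= inordK // ltnS.
  apply: mmap_closed => // [c|k]; first by exists (constK R (source d) c).
  by rewrite -yE; exists (y k.+1).
have Sp (p : {poly CA}) : S (polyE R d p).
  rewrite -[p]coefK poly_def rmorph_sum; apply: (big_ind S); [exact: S0|exact: SD|] => i _.
  rewrite -mul_polyC rmorphM; apply: (SM); first exact: SA.
  rewrite rmorphXn polyE_X; elim: (i : nat) => [|k IH]; first by rewrite expr0.
  by rewrite exprS; apply: SM.
have Sb (b : B) : S (coefF b).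
  have [p <-] : exists p, epsPoly R d p = b.
    by move: b; rewrite /epsPoly /epsRing; case: (birational d) bd => // _ b; exists b.
  exact: Sp.
have Sn (n : {mpoly B[3]}) : S (ratfun_of n).
  rewrite -mmap_ratfun; apply: mmap_closed => // i.
  by case: i => -[|[|[|?]]] // hi; rewrite /vec3 /=; [exists o.1.1|exists o.1.2|exists o.2].
move=> x; case: (@fracE {mpoly B[3]} x) => -[n m] /= _ ->.
by apply: SM; [apply: Sn|apply: SV; apply: Sn].
Qed.

Lemma lifts_exists_birational w : birational d -> field_automorphism w ->
  exists phi, lifts iota w phi.
Proof.
move=> bd [wB [w1 wM] [w' ww' w'w]].
have tau1 : tau = 1 by rewrite /tauE /tau_of; case: (d) bd.
pose g x := projT1 (cid (iota_surjective bd x)).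
have gK : cancel g iota by move=> x; rewrite /g; case: cid.
have iK : cancel iota g by move=> x; apply: (fmorph_inj iota); rewrite gK.
exists (iota \o w \o g); split.
- split.
  + move=> x y /=; rewrite -(rmorphB iota) -wB; congr (iota (w _)).
    by apply: (fmorph_inj iota); rewrite rmorphB !gK.
  + split=> [|x y] /=; first by rewrite -(rmorph1 iota) iK w1.
    rewrite -(rmorphM iota) -wM; congr (iota (w _)).
    by apply: (fmorph_inj iota); rewrite rmorphM !gK.
  + exists (iota \o w' \o g) => x /=; first by rewrite iK ww' gK.
    by rewrite iK w'w gK.
- by move=> x /=; rewrite iK.
- by rewrite tau1 /= -(rmorph1 iota) iK w1.
- by rewrite bd.
Qed.

(** In the birational cases [iota] is surjective. Otherwise A and eps^-N lie in its image, so both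
    lifts agree there; the two images of eps have equal N-th powers and are eps times series of
    constant term 1, hence coincide by [fps_pow_inj]. Agreement on A and eps extends to all series,
    then to E by [E_rmorph_ext]. *)
Lemma lifts_uniq w f g : lifts iota w f -> lifts iota w g -> f = g.
Proof.
move=> [fa fi ft fs] [ga gi gt gs]; apply/funext => x.
have [bd|bd] := boolP (birational d).
  by have [y <-] := iota_surjective bd x; rewrite fi gi.
have [s [_ [sE _ _ [u su u0] _]]] := fs bd.
have [s' [_ [s'E _ _ [u' su' u'0] _]]] := gs bd.
have [f' f'E] := field_automorphism_rmorph fa.
have [g' g'E] := field_automorphism_rmorph ga.
have fgi y : f (iota y) = g (iota y) by rewrite fi gi.
have coefI y y' : coefF (fpsToEps R d y) = coefF (fpsToEps R d y') -> y = y'.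
  by move=> /(@coefF_inj B)/(can_inj (fpsToEpsK bd)).
have sfE y : f (coefF (fpsToEps R d y)) = coefF (fpsToEps R d (s y)).
  by rewrite sE fpsToEpsK.
have s'gE y : g (coefF (fpsToEps R d y)) = coefF (fpsToEps R d (s' y)).
  by rewrite s'E fpsToEpsK.
have key z y : coefF (fpsToEps R d z) = iota y -> s z = s' z.
  by move=> zy; apply: coefI; rewrite -sfE -s'gE zy.
have sC (a : CA) : s (fpsPoly CA a%:P) = s' (fpsPoly CA a%:P).
  apply: (@mpoly_rmorph_ext _ C (fps CA) (s \o (fpsPoly CA \o polyC)) (s' \o (fpsPoly CA \o polyC))).
  - move=> c; apply: (key (fpsPoly CA (c%:MP)%:P) (constK R (source d) c)).
    by rewrite fpsPolyC fpsToEpsC //; case: iotaP => -> _ _ _ _; rewrite cE_E.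
  - move=> k; apply: (key (fpsPoly CA ('X_k)%:P) (new_A d (al R (source d)) k.+1)).
    rewrite fpsPolyC fpsToEpsC // (iota_new_A iotaP) // ?ltn_ord //.
    rewrite /AE /A_ /param (_ : inord k.+1 = lift ord0 k) ?liftK //.
    by apply: val_inj; rewrite /= inordK // ltnS.
have N0 : exists M, eps_order d = M.+1 by case: (d); eexists.
have [M NM] := N0.
have fge : f e ^+ M.+1 = g e ^+ M.+1.
  have fX k : f (e^-1 ^+ k) = (f e)^-1 ^+ k by rewrite -f'E rmorphXn fmorphV f'E.
  have gX k : g (e^-1 ^+ k) = (g e)^-1 ^+ k by rewrite -g'E rmorphXn fmorphV g'E.
  have := fgi (eps_inv d (al R (source d))).
  by rewrite (iota_eps_inv iotaP) fX gX NM !exprVn => /invr_inj.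
have eE : e = coefF (fpsToEps R d (fps_var CA)) by rewrite fpsToEpsX.
have svar : s (fps_var CA) = s' (fps_var CA).
  have pE (h h' : fps CA) n : coefF (fpsToEps R d h) ^+ n = coefF (fpsToEps R d h') ^+ n ->
      h ^+ n = h' ^+ n.
    by rewrite -!coefRE -!rmorphXn => /coefI.
  have := fge; rewrite eE sfE s'gE su su' => /pE; rewrite !exprMn => /mulfI uu.
  have M0 : M.+1%:R != 0 :> CA.
    by rewrite -(rmorph_nat (@mpolyC (rank (target d)) C)) mpolyC_eq0 pnatr_eq0.
  by rewrite (fps_pow_inj M0 u0 u'0 (uu (fps_varX_neq0 CA M.+1))).
have ss' : s =1 s'.
  have sC' a : s (fps_const a) = s' (fps_const a).
    by have := sC a; rewrite fpsPolyC.
  have s0 : s (fps_var CA) 0%N = 0 := etrans (congr1 (fun f : fps CA => f 0%N) su) (fps_coefXM u 0).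
  exact: (fps_rmorph_ext sC' svar s0).
rewrite -f'E -g'E; apply: (E_rmorph_ext iotaP) => [y|||b]; rewrite f'E g'E //.
- by rewrite eE sfE s'gE ss'.
- by rewrite ft gt.
- by rewrite sE s'E ss'.
Qed.

End LiftExistence.

Lemma eps_order_gt0 d : (0 < eps_order d)%N. Proof. by case: d. Qed.

Lemma root_shift (F : fieldType) (e U a : F) N : e != 0 ->
  U ^+ N * (1 + a * e ^+ N) = 1 -> (e * U)^-1 ^+ N = e^-1 ^+ N + a.
Proof.
move=> e0 UN; have U0 : U ^+ N != 0.
  by apply/eqP => U0; have /eqP := UN; rewrite U0 mul0r eq_sym oner_eq0.
have eN0 : e ^+ N != 0 by rewrite expf_neq0.
rewrite invfM exprMn !exprVn; apply: (mulfI U0); rewrite mulrC divfK //.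
by apply: (mulIf eN0); rewrite mulVf // -mulrA mulrDl mulVf // UN.
Qed.

Lemma S_tqp_t (F : fieldType) d i (a : nat -> F) (t q p : F) : ~~ birational d ->
  (S_tqp d i a t q p).1.1 = t.
Proof. by case: d => //= _; do 4?[case: i => [|i] //=]. Qed.

Lemma eq_S_al (F : fieldType) d i (a a' : nat -> F) j : (i <= rank (target d))%N ->
  (j <= rank (source d))%N -> (forall k, (k <= rank (source d))%N -> a k = a' k) ->
  S_al d i a j = S_al d i a' j.
Proof.
move=> ir jr aa; rewrite /S_al.
case: d aa ir jr => /= aa; do 5?[case: i => [|i] //]; move=> _ jr /=; rewrite ?aa //.
Qed.

Lemma rmorph_S_al (L F : fieldType) (f : {rmorphism L -> F}) d i (a : nat -> L) j :
  f (S_al d i a j) = S_al d i (fun k => f (a k)) j.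
Proof.
rewrite /S_al; case: d; do 5?[case: i => [|i] /=]; rewrite ?rmorphB ?rmorphMz //.
all: do 6?[case: j => [|j] //=]; rewrite ?nth_nil ?rmorph0 //.
all: by rewrite ?(rmorph_nat, rmorphN, rmorphD, rmorphM).
Qed.

Lemma var_q_nondeg (R : realType) d (F : fieldType) (f : {rmorphism K R (source d) -> F}) :
  match d with
  | V_IV => f (var_q _) - 1 != 0
  | III_II => f (var_q _) != 0
  | _ => true
  end.
Proof.
case: d f => //= f.
- by rewrite -(rmorph1 f) -rmorphB fmorph_eq0; exact: (s_den_neq0 R PV 3).
- by rewrite fmorph_eq0; exact: (s_den_neq0 R PIII 1).
Qed.

Lemma new_ok_change (F : fieldType) d (e e' tau t q q' : F) : ~~ birational d -> e' != 0 ->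
  match d with V_IV => q' - 1 != 0 | III_II => q' != 0 | _ => true end ->
  new_ok d e tau t q -> new_ok d e' tau t q'.
Proof. by rewrite /new_ok; case: d => //= _ -> // q0 /andP[_ /andP[_ ->]]; rewrite q0. Qed.

(** * Existence of lifts off the birational cases *)

Section NonBirational.
Variables (R : realType) (d : degeneration).
Hypothesis bd : ~~ birational d.
Local Notation C := (Cplx R).
Local Notation CA := (paramRing R (target d)).
Local Notation B := (epsRing R d).
Local Notation EE := (E R d).
Local Notation KS := (K R (source d)).
Variable iota : {rmorphism KS -> EE}.
Hypothesis iotaP : substitutes_old iota.
Variable i : nat.
Hypothesis ir : (i <= rank (target d))%N.

Local Notation e := (eps R d).
Local Notation r2 := (constE d (sqrtC 2) : EE).
Local Notation tau := (tauE R d).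
Let N0 := eps_order_gt0 d.
Let io : 'I_(rank (target d)).+1 := inord i.
Let z := eps_shift d i.
Let sig : {rmorphism fps CA -> fps CA} := reflS R io z N0.
Let root : fps CA := refl_root R io z N0.
Let sB : {rmorphism B -> B} := fpsToEps R d \o (sig \o epsSeries R d).

Let ofE (x : fps CA) : EE := coefF (fpsToEps R d x).

Let ofE_rmorph : {rmorphism fps CA -> EE} := coefR B \o fpsToEps R d.

Let ofE_C a : ofE (fps_const a) = coefF (eps_const a).
Proof. by rewrite /ofE fpsToEpsC. Qed.

Let ofE_X : ofE (fps_var CA) = e. Proof. by rewrite /ofE fpsToEpsX. Qed.

Let sBK : involutive sB.
Proof.
move=> b; rewrite -[LHS]/(fpsToEps R d (sig (epsSeries R d (fpsToEps R d (sig (epsSeries R d b)))))).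
by rewrite fpsToEpsK // reflSK epsSeriesK.
Qed.

Let c : {rmorphism B -> EE} := coefR B \o sB.

Let cE_ofE x : c (fpsToEps R d x) = ofE (sig x).
Proof.
rewrite -[LHS]/(ofE (sig (epsSeries R d (fpsToEps R d x)))).
by rewrite fpsToEpsK.
Qed.

Let A' j : EE := AE R d j - AE R d i *~ cartan (target d) i j.
Let U : EE := ofE root.
Let e' : EE := e * U.

Let c_A j : (j <= rank (target d))%N ->
  c (eps_const (param R (inord j : 'I_(rank (target d)).+1))) = A' j.
Proof.
move=> jr; rewrite -fpsToEpsC // cE_ofE /sig reflSC reflA_param ofE_C -polyE_C.
pose pC : {rmorphism CA -> EE} := polyE R d \o polyC.
rewrite -[LHS]/(pC (refl_param R io (inord j))) /refl_param rmorphB rmorphMz.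
have pCA k : pC (param R k) = A_ R k by rewrite A_polyE.
by rewrite !pCA !inordK.
Qed.

Let c_const a : c (eps_const (a%:MP : {mpoly C[rank (target d)]})) = cE R d a.
Proof.
by rewrite -fpsToEpsC // cE_ofE /sig reflSC reflA_C ofE_C cE_E.
Qed.

Let c_eps : c (eps_var R d) = e'.
Proof.
rewrite -fpsToEpsX // cE_ofE /sig reflSX -[ofE _]/(ofE_rmorph _) rmorphM.
by rewrite -[ofE_rmorph (fps_var CA)]/(ofE (fps_var CA)) ofE_X.
Qed.

Let U_pow : U ^+ eps_order d * (1 + AE R d i *~ z * e ^+ eps_order d) = 1.
Proof.
have := congr1 ofE_rmorph (refl_root_pow R io z N0).
rewrite rmorphM rmorphXn rmorphD !rmorph1 /epsPow rmorphM rmorphXn.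
rewrite -[ofE_rmorph (fps_var CA)]/(ofE (fps_var CA)) ofE_X.
rewrite -[ofE_rmorph (fps_const _)]/(ofE (fps_const _)) ofE_C -polyE_C.
pose pC : {rmorphism CA -> EE} := polyE R d \o polyC.
have pCA k : pC (param R k) = A_ R k by rewrite A_polyE.
by rewrite -[polyE R d _]/(pC _) rmorphMz pCA.
Qed.

Let e'_neq0 : e' != 0.
Proof.
rewrite mulf_neq0 ?eps_neq0 //; apply/eqP => U0; have /eqP := U_pow.
by rewrite U0 expr0n eqn0Ngt N0 mul0r eq_sym oner_eq0.
Qed.

Let e'E : e'^-1 ^+ eps_order d = e^-1 ^+ eps_order d + AE R d i *~ z.
Proof.
exact: root_shift (eps_neq0 R d) U_pow.
Qed.

Let w : {rmorphism KS -> KS} := degK R d i.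
(** The forced images of T, Q, P under a lift of w that sends A to A', eps to e' and fixes tau. *)
Let n := new_tqp d A' e' tau (iota (w (var_t _))) (iota (w (var_q _))) (iota (w (var_p _))) r2.

Let w_t : w (var_t _) = var_t _.
Proof.
have := degK_tqp R ir; case E : (S_tqp _ _ _ _ _ _) => [[t' q'] p'] [wt _ _].
by rewrite /w wt -(S_tqp_t i (al R (source d)) (var_t _) (var_q _) (var_p _) bd) E.
Qed.

Let wK : involutive w. Proof. exact: degK_involutive. Qed.

Let new_ok_w : new_ok d e' tau (iota (w (var_t _))) (iota (w (var_q _))).
Proof.
have [_ [ok _]] := new_tqpE iotaP.
rewrite w_t; apply: (new_ok_change bd e'_neq0 _ ok).
exact: (var_q_nondeg (iota \o w)).
Qed.

Let tau_rel_w : tau_rel d tau (iota (w (var_t _))).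
Proof. by rewrite w_t; case: (new_tqpE iotaP) => _ []. Qed.

Let n2 : 2 != 0 :> EE := natE_neq0 R d 1.

Let old_n : [/\ old_tqp d A' e' n.1.1 n.1.2 n.2 r2 =
    (iota (w (var_t _)), iota (w (var_q _)), iota (w (var_p _))),
  old_ok d e' n.1.1 n.1.2 & tau_of d e' n.1.1 = tau].
Proof. exact: (old_newK A' (iota (w (var_p _))) n2 (sqrt2E R d) new_ok_w tau_rel_w). Qed.

Let D : specData EE EE := evalSpec c n.1.1 n.1.2 n.2.

Let D_A j : (j <= rank (target d))%N -> spec D (AE R d j) (A' j).
Proof. by move=> jr; rewrite -(c_A jr); apply: evalSpec_coef. Qed.

Let D_eps : spec D e e'.
Proof. by rewrite -c_eps; apply: evalSpec_coef. Qed.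

Let D_const a : spec D (cE R d a) (cE R d a).
Proof. by rewrite -{2}c_const cE_E; apply: evalSpec_coef. Qed.

Let D_r2 : spec D r2 r2. Proof. by rewrite -cE_E; apply: D_const. Qed.

Let D_inv b : spec D (c b) (coefF b).
Proof. by rewrite -{2}[b]sBK; apply: evalSpec_coef. Qed.

Let D_iota x : spec D (iota x) (iota (w x)).
Proof.
have r20 : r2 != 0.
  by apply: contra_neq n2 => r20; rewrite -(sqrt2E R d) r20 expr0n.
have [oldE_n okn _] := old_n.
have [D1 D2 D3] := spec_old_tqp n2 D_A r20 okn D_eps (evalSpec_t _ _ _ _)
  (evalSpec_q _ _ _ _) (evalSpec_p _ _ _ _) D_r2.
move: D1 D2 D3; rewrite oldE_n => D1 D2 D3.
have [ic ia it iq ip] := iotaP.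
apply: (@K_rmorph_spec R _ _ _ D iota (iota \o w)).
- by move=> a; rewrite /= /w wordK_const ic.
- move=> j jr; rewrite /= /w degK_al // ia //.
  have -> : iota (S_al d i (al R (source d)) j) = nth 0 (old_al d A' e') j.
    rewrite (@old_al_S _ d i (AE R d) A' e e' n2 bd ir _ e'E j jr) //.
    have -> : iota (S_al d i (al R (source d)) j) =
        S_al d i (fun k => iota (al R (source d) k)) j by exact: rmorph_S_al.
    exact: eq_S_al.
  exact: spec_old_al.
- by rewrite /= it.
- by rewrite /= iq.
- by rewrite /= ip.
Qed.

(** By [ratfun_involution]. Substituting a second time sends A' to A, e' to eps, keeps tau, and
    sends iota (w x) to iota (w (w x)) = iota x; so [n] becomes [new_tqp] of the original data,
    which is (T, Q, P). On the coefficients the required involution is [reflSK]. *)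
Lemma lifts_exists : exists phi : {rmorphism EE -> EE}, lifts iota (degK R d i) phi /\
  exists u : fps CA, [/\ phi e = e * coefF (fpsToEps R d u), u 0%N = 1,
    bounded_growth u &
    coefF (fpsToEps R d u) ^+ eps_order d *
      (1 + AE R d i *~ eps_shift d i * e ^+ eps_order d) = 1].
Proof.
have [ne [ok _]] := new_tqpE iotaP.
have [oldE_n okn tauE_n] := old_n.
have D_tau : spec D tau (tau_of d e' n.1.1).
  by apply: spec_tau_of; [exact: n2|exact: e'_neq0|exact: D_eps|exact: evalSpec_t].
move: D_tau; rewrite tauE_n => D_tau.
have D_A' j : (j <= rank (target d))%N -> spec D (A' j) (AE R d j).
  by move=> jr; rewrite -c_A //; apply: D_inv.
have D_e' : spec D e' e by rewrite -c_eps; apply: D_inv.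
have D_w x : spec D (iota (w x)) (iota x) by rewrite -{2}[x]wK; apply: D_iota.
have [N1 N2 N3] := spec_new_tqp n2 D_A' ok D_e' D_tau (D_w (var_t _)) (D_w (var_q _))
  (D_w (var_p _)) D_r2.
move: N1 N2 N3; rewrite -/n ne /= => N1 N2 N3.
have [s [sc [st sq] sp sK sD]] := ratfun_involution D_inv N1 N2 N3.
exists s; split; last first.
  exists root; split; [|exact: eps_root_coef0|exact: eps_root_growth|exact: U_pow].
  by rewrite -[LHS]/(s (coefF _)) sc c_eps.
have ms : eps_multiple sig by exists root; [exact: reflSX|exact: eps_root_coef0].
split.
- by apply: rmorph_field_automorphism; exists s.
- by move=> x; apply: sD; apply: D_iota.
- exact: sD D_tau.
- move=> _; exists sig, sig; split=> //.
  + exact: reflSK.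
  + exact: reflSK.
Qed.

End NonBirational.

(** * Limits *)

Section NewS.
Variable F : fieldType.

(** S_i in the new variables: pass to the old ones, apply S_i, and return with the transformed A',
    e'. The tau used on the way back comes from the untransformed eps and T because lifts fix it. *)
Definition newS d i (A A' : nat -> F) (e e' T Q P r2 : F) : F * F * F :=
  let o := old_tqp d A e T Q P r2 in
  let s := S_tqp d i (nth 0 (old_al d A e)) o.1.1 o.1.2 o.2 in
  new_tqp d A' e' (tau_of d e T) s.1.1 s.1.2 s.2 r2.

(** The abbreviations are factors of what S_0 divides by: q - t = z / x, f = - x b, q' - 1 = c / b,
    q' - t = g / b. At eps = 0, z becomes 1, c and g become P + T, and no division by eps is
    left. *)
Lemma newS_VI_V0 (A A' : nat -> F) (e e' T Q P r2 : F) :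
  let x := Q - 1 in let z := 1 - e * T * x in
  let c := P + T / z in let b := A 0%N + x * c in let g := c - e * T * b in
  A' 2%N = A 2%N -> e'^-1 = e^-1 - A 0%N ->
  e != 0 -> x != 0 -> z != 0 -> b != 0 -> c != 0 -> g != 0 ->
  newS VI_V 0 A A' e e' T Q P r2 =
    (T * (1 - A 0%N * e), 1 + b / c, c * (c - T - e * x * c * T) / g).
Proof.
move=> x z c b g A2 e'E e0 x0 z0 b0 c0 g0.
rewrite /newS /new_tqp /S_tqp /old_tqp /old_al /= A2 -/x.
have t1 : (1 + e * T - 1) / e' = T * (1 - A 0%N * e) by rewrite e'E; field; nz_tac.
have q1 : 1 + x^-1 - 1 = x^-1 by ring.
have qt : 1 + x^-1 - (1 + e * T) = z / x by rewrite /z; field; nz_tac.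
have r : e^-1 + A 2%N + (A 0%N - A 2%N - e^-1) = A 0%N by ring.
have fE : (- A 2%N - x * P) * x - (A 0%N - A 2%N - e^-1) / x^-1 - e^-1 / (z / x) = - (x * b).
  by rewrite /b /c; rewrite /z in z0 *; field; nz_tac.
rewrite t1 q1 qt r fE.
have q'1 : 1 + x^-1 + A 0%N / - (x * b) - 1 = c / b.
  have -> : c = (b - A 0%N) / x by rewrite /b; field; nz_tac.
  by field; nz_tac.
have q't : 1 + x^-1 + A 0%N / - (x * b) - (1 + e * T) = g / b.
  by rewrite -[LHS]/(_ - (1 + e * T)) opprD addrA q'1 /g; field; nz_tac.
rewrite q't q'1 invf_div; congr (_, _, _).
(* With A_0 eliminated, b and c can be treated as free variables, which keeps the last identity
   small. *)
have -> : A 0%N = b - x * c by rewrite /b; ring.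
rewrite /g in g0 *; clearbody b c; clear fE q'1 q't.
by field; nz_tac.
Qed.

Lemma newS_VI_V1 (A A' : nat -> F) (e e' T Q P r2 : F) :
  A' 2%N = A 2%N + A 1%N -> e'^-1 = e^-1 ->
  e != 0 -> Q - 1 != 0 -> Q != 0 ->
  newS VI_V 1 A A' e e' T Q P r2 = (T, Q, P - A 1%N / Q).
Proof.
move=> A2 e'E e0 x0 Q0; rewrite /newS /new_tqp /S_tqp /old_tqp /old_al /= A2 e'E.
have -> : 1 + (Q - 1)^-1 - 1 = (Q - 1)^-1 by ring.
have -> : 1 + (Q - 1)^-1 = Q / (Q - 1) by field; nz_tac.
by congr (_, _, _); field; nz_tac.
Qed.

Lemma newS_VI_V2 (A A' : nat -> F) (e e' T Q P r2 : F) :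
  A' 2%N = - A 2%N -> e'^-1 = e^-1 + A 2%N ->
  e != 0 -> Q - 1 != 0 -> P != 0 -> A 2%N + (Q - 1) * P != 0 ->
  newS VI_V 2 A A' e e' T Q P r2 = (T * (1 + A 2%N * e), Q + A 2%N / P, P).
Proof.
move=> A2 e'E e0 x0 P0 b0; rewrite /newS /new_tqp /S_tqp /old_tqp /old_al /= A2 e'E.
set b := A 2%N + _ in b0.
have -> : - A 2%N - (Q - 1) * P = - b by rewrite /b; ring.
have q1 : 1 + (Q - 1)^-1 + A 2%N / (- b * (Q - 1)) - 1 = P / b.
  have -> : P = (b - A 2%N) / (Q - 1) by rewrite /b; field; nz_tac.
  by field; nz_tac.
rewrite q1 invf_div; congr (_, _, _); rewrite /b in b0 *; field; nz_tac.
Qed.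

Lemma newS_VI_V3 (A A' : nat -> F) (e e' T Q P r2 : F) :
  A' 2%N = A 2%N + A 3%N -> e'^-1 = e^-1 ->
  e != 0 -> Q - 1 != 0 ->
  newS VI_V 3 A A' e e' T Q P r2 = (T, Q, P - A 3%N / (Q - 1)).
Proof.
move=> A2 e'E e0 x0; rewrite /newS /new_tqp /S_tqp /old_tqp /old_al /= A2 e'E.
have -> : 1 + (Q - 1)^-1 - 1 = (Q - 1)^-1 by ring.
by congr (_, _, _); field; nz_tac.
Qed.

(** In [S_tqp], f g - alpha_3 = m / (2 eps z) and f g + alpha_0 = n / (2 eps z): the terms in eps^-2
    cancel, and m and n both tend to 2 P - Q - 2 T, the denominator of s_0 for P_IV. *)
Lemma newS_V_IV0 (A A' : nat -> F) (e U T Q P r2 : F) :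
  let z := 1 - e * Q in let w := z * P - e * A 2%N in
  let m := 2 * w * z - 2 * T - Q in let n := m + 2 * e * A 0%N * z in
  2 != 0 :> F -> A' 2%N = A 2%N + A 0%N -> U ^+ 2 * (1 + 2 * A 0%N * e ^+ 2) = 1 ->
  e != 0 -> U != 0 -> z != 0 -> m != 0 -> n != 0 ->
  newS V_IV 0 A A' e (e * U) T Q P r2 =
    (U * (T - A 0%N * e), (Q * m + 2 * A 0%N * z) / (U * n),
     U * n * (e * m * A 2%N + w * n + A 0%N * z) / (z * m ^+ 2)).
Proof.
move=> z w m n n2 A2 UE e0 U0 z0 m0 n0.
rewrite /newS /new_tqp /S_tqp /old_tqp /old_al /= A2 -/z.
have rE : A 0%N + 2^-1 * e ^- 2 - 2^-1 * e ^- 2 = A 0%N by rewrite addrK.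
have pE : P - e * (A 2%N + Q * P) = w by rewrite /w /z; ring.
have q1 : - (e * Q / z) - 1 = - z^-1 by rewrite /z; field; nz_tac.
have fE : - (e^-1 * z * w) + 2^-1 * e ^- 2 * (1 + 2 * e * T) = (z - e * m) / (2 * e ^+ 2).
  by rewrite /m /z; field; nz_tac.
rewrite rE pE q1 fE.
have f1 : (z - e * m) / (2 * e ^+ 2) * - z^-1 - - (2^-1 * e ^- 2) = m / (2 * e * z).
  by field; nz_tac.
have f2 : (z - e * m) / (2 * e ^+ 2) * - z^-1 + (A 0%N + 2^-1 * e ^- 2) = n / (2 * e * z).
  by rewrite /n; field; nz_tac.
rewrite f1 f2.
have q'1 : - (e * Q / z) + A 0%N * - z^-1 / (m / (2 * e * z)) - 1 = - (n / (z * m)).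
  by rewrite addrAC q1 /n; field; nz_tac.
have q'1' : 1 - (- (e * Q / z) + A 0%N * - z^-1 / (m / (2 * e * z))) = n / (z * m).
  by rewrite -[LHS]opprB q'1 opprK.
have q'E : - (e * Q / z) + A 0%N * - z^-1 / (m / (2 * e * z)) =
  - (e * (Q * m + 2 * A 0%N * z) / (z * m)) by field; nz_tac.
rewrite q'1 q'1' q'E.
congr (_, _, _).
(* The subtracted 1 is written as U^2 (1 + 2 A_0 eps^2), after which eps can be divided out. *)
- have -> : 2 * (e * U) ^+ 2 * (2^-1 * e ^- 2 * (1 + 2 * e * T)) - 1 =
      U ^+ 2 * (1 + 2 * e * T) - U ^+ 2 * (1 + 2 * A 0%N * e ^+ 2).
    by rewrite UE; field; nz_tac.
  by field; nz_tac.
- by field; nz_tac.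
- rewrite [X in _ = U * n * (_ + _ + X) / _](_ : _ = (A 0%N * (z - e * m) + e * m * A 0%N)); last by ring.
  by field; nz_tac.
Qed.

Lemma newS_V_IV1 (A A' : nat -> F) (e T Q P r2 : F) : 2 != 0 :> F ->
  A' 2%N = A 2%N + A 1%N -> e != 0 -> 1 - e * Q != 0 -> Q != 0 ->
  newS V_IV 1 A A' e e T Q P r2 = (T, Q, P - A 1%N / Q).
Proof.
move=> n2 A2 e0 z0 Q0; rewrite /newS /new_tqp /S_tqp /old_tqp /old_al /= A2.
set z := 1 - e * Q in z0 *.
have q1 : - (e * Q / z) - 1 = - z^-1 by rewrite /z; field; nz_tac.
have q1' : 1 - - (e * Q / z) = z^-1 by rewrite -[LHS]opprB q1 opprK.
rewrite q1 q1'; congr (_, _, _); try by field; nz_tac.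
by rewrite /z in z0 *; field; nz_tac.
Qed.

Lemma newS_V_IV2 (A A' : nat -> F) (e U T Q P r2 : F) :
  let z := 1 - e * Q in let w := z * P - e * A 2%N in
  2 != 0 :> F -> A' 2%N = - A 2%N -> U ^+ 2 * (1 - 2 * A 2%N * e ^+ 2) = 1 ->
  e != 0 -> U != 0 -> z != 0 -> w != 0 -> P != 0 ->
  newS V_IV 2 A A' e (e * U) T Q P r2 =
    (U * (T + A 2%N * e), (Q + A 2%N / P) / U, U * P).
Proof.
move=> z w n2 A2 UE e0 U0 z0 w0 P0.
rewrite /newS /new_tqp /S_tqp /old_tqp /old_al /= A2 -/z.
have pE : P - e * (A 2%N + Q * P) = w by rewrite /w /z; ring.
have q'1 : - (e * Q / z) + A 2%N / - (e^-1 * z * w) - 1 = - (P / w).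
  have -> : P = (w + e * A 2%N) / z by rewrite /w; field; nz_tac.
  have -> : Q = (1 - z) / e by rewrite /z; field; nz_tac.
  by field; nz_tac.
rewrite pE q'1 -[1 - _]opprB q'1 opprK.
have q'E : - (e * Q / z) + A 2%N / - (e^-1 * z * w) = - (e * (Q * P + A 2%N) / w).
  rewrite -[LHS](subrK 1) q'1; have -> : A 2%N = (z * P - w) / e by rewrite /w; field; nz_tac.
  have -> : Q = (1 - z) / e by rewrite /z; field; nz_tac.
  by field; nz_tac.
rewrite q'E; congr (_, _, _).
- have -> : 2 * (e * U) ^+ 2 * (2^-1 * e ^- 2 * (1 + 2 * e * T)) - 1 =
      U ^+ 2 * (1 + 2 * e * T) - U ^+ 2 * (1 - 2 * A 2%N * e ^+ 2).
    by rewrite UE; field; nz_tac.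
  by field; nz_tac.
- by field; nz_tac.
- have -> : A 2%N = (z * P - w) / e by rewrite /w; field; nz_tac.
  by field; nz_tac.
Qed.

Lemma newS_V_III0 (A A' : nat -> F) (e e' T Q P r2 : F) :
  e'^-1 = e^-1 + A 0%N -> e != 0 -> T != 0 -> P != 0 ->
  newS V_III 0 A A' e e' T Q P r2 = (T * (1 + A 0%N * e), Q + A 0%N / P, P).
Proof.
move=> e'E e0 T0 P0; rewrite /newS /new_tqp /S_tqp /old_tqp /old_al /= e'E.
by congr (_, _, _); field; nz_tac.
Qed.

Lemma newS_V_III1 (A A' : nat -> F) (e e' T Q P r2 : F) :
  e'^-1 = - e^-1 -> e != 0 -> T != 0 -> Q != 0 -> Q + e * T != 0 ->
  newS V_III 1 A A' e e' T Q P r2 =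
    (- T, Q, P - 2 * A 1%N / Q + T / (Q * (Q + e * T))).
Proof.
move=> e'E e0 T0 Q0 d0; rewrite /newS /new_tqp /S_tqp /old_tqp /old_al /= e'E.
have -> : 1 + Q / (e * T) = (Q + e * T) / (e * T) by field; nz_tac.
have -> : (Q + e * T) / (e * T) - 1 = Q / (e * T) by field; nz_tac.
by congr (_, _, _); field; nz_tac.
Qed.

Lemma newS_V_III2 (A A' : nat -> F) (e e' T Q P r2 : F) :
  e'^-1 = e^-1 + A 2%N -> e != 0 -> T != 0 -> P - 1 != 0 ->
  newS V_III 2 A A' e e' T Q P r2 = (T * (1 + A 2%N * e), Q + A 2%N / (P - 1), P).
Proof.
move=> e'E e0 T0 P0; rewrite /newS /new_tqp /S_tqp /old_tqp /old_al /= e'E.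
have -> : e * T * P - e * T = e * T * (P - 1) by ring.
by congr (_, _, _); field; nz_tac.
Qed.
End NewS.

Section NewSPII.
Variable F : fieldType.
Hypothesis F2 : 2 != 0 :> F.

Let F4 : 4 != 0 :> F.
Proof. by have -> : 4 = 2 * 2 :> F; [ring|rewrite mulf_neq0]. Qed.

(** Replacing eps by eps U leaves a defect 1 - U^3 = eps^6 V, which is divided by eps^4 in T and by
    eps^2 in Q and so vanishes in the limit. The collected denominators of [S_tqp] are g / eps^2 and
    h / eps^2, with g and h tending to P - 2 Q^2 - T. *)
Lemma newS_IV_II0 (A A' : nat -> F) (e U V T Q P r2 : F) :
  let x := 1 + 2 * e ^+ 2 * Q in let g := x * (P - T) - 2 * Q ^+ 2 in
  let h := g + 2 * e ^+ 2 * A 0%N in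
  r2 ^+ 2 = 2 -> U ^+ 3 = 1 - e ^+ 6 * V ->
  e != 0 -> U != 0 -> g != 0 -> h != 0 ->
  newS IV_II 0 A A' e (e * U) T Q P r2 =
    (T / U + e ^+ 2 * V / U ^+ 4,
     U * (Q * g + x * A 0%N) / g - e ^+ 4 * V / (2 * U ^+ 2),
     P / U + 2 * A 0%N * ((2 * Q - e ^+ 2 * (P - T)) * g + A 0%N * x) / (U * g * h)).
Proof.
move=> x g h r22 UE e0 U0 g0 h0.
have r20 : r2 != 0 by apply: contra_neq F2 => r20; rewrite -r22 r20 expr0n.
have VE : V = (1 - U ^+ 3) / e ^+ 6 by rewrite UE; field; nz_tac.
rewrite /newS /new_tqp /S_tqp /old_tqp /old_al /= -/x.
have rE : A 0%N - 4^-1 * e ^- 6 + 4^-1 * e ^- 6 = A 0%N by rewrite subrK.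
(* The old 2 p - q - 2 t is y / (r2 eps^3). As x y = 1 + 2 eps^4 g, the leading term eps^-6 / 2 of
   its product with q cancels against 2 alpha_1. *)
pose y := 1 - 2 * e ^+ 2 * Q + 2 * e ^+ 4 * (P - T).
have fE : 2 * (r2^-1 * e * P) - r2^-1 * e ^- 3 * x
    - 2 * - (r2^-1 * e ^- 3 * (1 - e ^+ 4 * T)) = y / (r2 * e ^+ 3).
  by rewrite /x /y; field; nz_tac.
have xy : x * y = 1 + 2 * e ^+ 4 * g by rewrite /g /x /y; ring.
rewrite rE fE.
have d1 : y / (r2 * e ^+ 3) * (r2^-1 * e ^- 3 * x) - 2 * (4^-1 * e ^- 6) = g / e ^+ 2.
  rewrite (_ : y / _ * _ = x * y / (r2 ^+ 2 * e ^+ 6)); last by field; nz_tac.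
  by rewrite xy r22; field; nz_tac.
have d2 : y / (r2 * e ^+ 3) * (r2^-1 * e ^- 3 * x) + 2 * (A 0%N - 4^-1 * e ^- 6) = h / e ^+ 2.
  by rewrite /h mulrBr addrCA d1; field; nz_tac.
rewrite d1 d2 VE; congr (_, _, _).
- by field; nz_tac.
- have -> : Q * g + x * A 0%N = (x * h - g) / (2 * e ^+ 2).
    by rewrite /h /x; field; nz_tac.
  by field; nz_tac.
- have -> : (2 * Q - e ^+ 2 * (P - T)) * g + A 0%N * x = (x * h - y * g) / (2 * e ^+ 2).
    by rewrite /h /x /y; field; nz_tac.
  rewrite (_ : r2 * _ / (e * U) = P / U + r2 ^+ 2 * A 0%N * (x * h - y * g) /
     (r2 ^+ 2 * e ^+ 2 * U * g * h)); last by field; nz_tac.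
  by rewrite r22; field; nz_tac.
Qed.

Lemma newS_IV_II1 (A A' : nat -> F) (e U V T Q P r2 : F) :
  r2 ^+ 2 = 2 -> U ^+ 3 = 1 - e ^+ 6 * V -> e != 0 -> U != 0 -> P != 0 ->
  newS IV_II 1 A A' e (e * U) T Q P r2 =
    (T / U + e ^+ 2 * V / U ^+ 4, U * (Q + A 1%N / P) - e ^+ 4 * V / (2 * U ^+ 2), P / U).
Proof.
move=> r22 UE e0 U0 P0.
have r20 : r2 != 0 by apply: contra_neq F2 => r20; rewrite -r22 r20 expr0n.
have VE : V = (1 - U ^+ 3) / e ^+ 6 by rewrite UE; field; nz_tac.
rewrite /newS /new_tqp /S_tqp /old_tqp /old_al /= VE; congr (_, _, _).
- by field; nz_tac.
- rewrite (_ : (_ - 1) / _ = (U ^+ 3 * (1 + 2 * e ^+ 2 * Q) + r2 ^+ 2 * e ^+ 2 * U ^+ 3 * A 1%N / P - 1)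
     / (2 * (e * U) ^+ 2)); last by field; nz_tac.
  by rewrite r22; field; nz_tac.
- by field; nz_tac.
Qed.

Lemma newS_III_II1 (A A' : nat -> F) (e U T Q P r2 : F) :
  let h := 1 + e ^+ 2 * T in let x := 1 + 2 * e * Q in
  let b := 2 * e * A 1%N + x * P in
  A' 1%N = - A 1%N -> U ^+ 3 * (1 + 4 * A 1%N * e ^+ 3) = 1 ->
  e != 0 -> U != 0 -> h != 0 -> x != 0 -> b != 0 -> P != 0 ->
  newS III_II 1 A A' e (e * U) T Q P r2 =
    (U * (T - 4 * A 1%N * e), (Q + A 1%N / P) / U, U * P).
Proof.
move=> h x b A1 UE e0 U0 h0 x0 b0 P0.
rewrite /newS /new_tqp /S_tqp /old_tqp /old_al /tau_of /= A1 -/h -/x.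
have pE : x / (h / (4 * e ^+ 3)) * (A 1%N + x * (P / (2 * e))) = 2 * e ^+ 2 * x * b / h.
  by rewrite /b; field; nz_tac.
have q'E : - (h / (4 * e ^+ 3) / x) + A 1%N / (2 * e ^+ 2 * x * b / h) = - (h * P / (4 * e ^+ 3 * b)).
  have -> : P = (b - 2 * e * A 1%N) / x by rewrite /b; field; nz_tac.
  by field; nz_tac.
rewrite pE q'E; congr (_, _, _).
- rewrite (_ : _ - 1 = U ^+ 3 * h - U ^+ 3 * (1 + 4 * A 1%N * e ^+ 3)).
    by rewrite /h; field; nz_tac.
  by rewrite UE; field; nz_tac.
- rewrite (_ : - (_ / _) - 1 = b / P - 1); last by field; nz_tac.
  by rewrite /b /x; field; nz_tac.
- have -> : A 1%N = (b - x * P) / (2 * e) by rewrite /b; field; nz_tac.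
  by field; nz_tac.
Qed.

(** At eps = 0, g and m become 2 (P - 2 Q^2 - T) and X becomes s_0(q). The last component tends to g
    / 2 + 2 X^2 + T, which is s_0(p) because p - 2 q^2 - t is invariant under s_0 of P_II. *)
Lemma newS_III_II0 (A A' : nat -> F) (e U T Q P r2 : F) :
  let h := 1 + e ^+ 2 * T in let x := 1 + 2 * e * Q in
  let g := 4 * e * x * A 1%N + 2 * x ^+ 2 * P - 4 * Q ^+ 2 - T * (x ^+ 2 + 1) in
  let m := g - 4 * e * A 0%N * x in
  let X := (Q * g + 2 * A 0%N * x) / m in let x' := 1 + 2 * e * X in
  A' 1%N = A 1%N + 2 * A 0%N -> U ^+ 3 * (1 - 4 * A 0%N * e ^+ 3) = 1 ->
  e != 0 -> U != 0 -> h != 0 -> x != 0 -> g != 0 -> m != 0 ->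
  newS III_II 0 A A' e (e * U) T Q P r2 =
    (U * (T + 4 * A 0%N * e), X / U,
     U * (g + 4 * X ^+ 2 + T * (1 + x' ^+ 2) - 4 * e * A 1%N * x') / (2 * x' ^+ 2)).
Proof.
move=> h x g m X x' A1 UE e0 U0 h0 x0 g0 m0.
have x'E : x' = x * g / m.
  rewrite /x' /X; have -> : Q = (x - 1) / (2 * e) by rewrite /x; field; nz_tac.
  have -> : A 0%N = (g - m) / (4 * e * x) by rewrite /m; field; nz_tac.
  by field; nz_tac.
have x'0 : x' != 0 by rewrite x'E !mulf_neq0 ?invr_eq0.
rewrite /newS /new_tqp /S_tqp /old_tqp /old_al /tau_of /= A1 -/h -/x.
set tau := h / (4 * e ^+ 3).
have tau0 : tau != 0 by rewrite /tau !mulf_neq0 ?invr_eq0 ?mulf_neq0 ?expf_neq0.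
have rE : 2 * (4^-1 * e ^- 3) + (A 0%N - 2^-1 * e ^- 3) = A 0%N by field; nz_tac.
have rE' : 4^-1 * e ^- 3 + (A 0%N - 2^-1 * e ^- 3) = A 0%N - 4^-1 * e ^- 3 by field; nz_tac.
have p1 : x / tau * (A 1%N + x * (P / (2 * e))) - 2 * (4^-1 * e ^- 3) / - (tau / x)
    + - tau ^+ 2 / (- (tau / x)) ^+ 2 = 1 + e ^+ 2 * g / h.
  by rewrite /g /tau; rewrite /h /x in h0 x0 *; field; nz_tac.
rewrite rE rE' p1.
have q' : - (tau / x) + A 0%N / (1 + e ^+ 2 * g / h - 1) = - (tau / x').
  rewrite x'E; have -> : A 0%N = (g - m) / (4 * e * x) by rewrite /m; field; nz_tac.
  by rewrite [1 + _]addrC addrK /tau; field; nz_tac.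
rewrite q'; congr (_, _, _).
- rewrite (_ : _ - 1 = U ^+ 3 * h - U ^+ 3 * (1 - 4 * A 0%N * e ^+ 3)).
    by rewrite /h; field; nz_tac.
  by rewrite UE /tau; field; nz_tac.
- have -> : - (tau / - (tau / x')) = x' by rewrite invrN mulrN opprK invf_div mulrC divfK.
  by rewrite /x'; field; nz_tac.
- have -> : X = (x' - 1) / (2 * e) by rewrite /x'; field; nz_tac.
  have -> : T = (h - 1) / e ^+ 2 by rewrite /h; field; nz_tac.
  clearbody h x g m x'; rewrite /tau; field; nz_tac.
Qed.
End NewSPII.

(** Limits of the denominators in the [newS_*] formulas. For VI -> V some of them, such as A_0 + (q
    - 1)(p + t), are not denominators of any s_i. *)
Definition target_nondeg (F : fieldType) d (a : nat -> F) (t q p : F) : Prop :=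
  match d with
  | VI_V => [/\ [/\ q != 0, q - 1 != 0, p != 0 & p + t != 0],
                a 0%N + (q - 1) * (p + t) != 0 & a 2%N + (q - 1) * p != 0]
  | V_IV => [/\ q != 0, p != 0 & 2 * p - q - 2 * t != 0]
  | V_III => [/\ q != 0, p != 0 & p - 1 != 0]
  | IV_II | III_II => p != 0 /\ p - 2 * q ^+ 2 - t != 0
  end.

Lemma spec_eq (L F : fieldType) (D : specData L F) f g g' :
  spec D f g -> g = g' -> spec D f g'.
Proof. by move=> fg <-. Qed.

(** The limit is computed by recursion on the expression and compared with the expected value
    afterwards; hypotheses are tried first, so a subexpression of known limit is not taken apart. *)
Ltac lim_step := lazymatch goal with |- spec _ ?f _ =>
  first [ eassumption
  | lazymatch f with
    | GRing.add _ _ => eapply specD; [lim_step|lim_step]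
    | GRing.opp _ => eapply specN; lim_step
    | GRing.mul _ _ => eapply specM; [lim_step|lim_step]
    | GRing.inv _ => eapply specV; [|lim_step]
    | GRing.exp _ _ => eapply specX; lim_step
    | GRing.natmul (GRing.one _) _ => eapply spec_nat
    | GRing.one _ => eapply spec1
    | GRing.zero _ => eapply spec0
    end ] end.
Ltac lim_tac := eapply spec_eq; [lim_step|].

(** * Limits of the closed forms *)

Section SpecNewS.
Variables (L F : fieldType) (D : specData L F).
Hypotheses (L2 : 2 != 0 :> L) (F2 : 2 != 0 :> F).
Variables (A A' : nat -> L) (e T Q P r2 : L) (a : nat -> F) (t q p : F).
Hypotheses (e0 : e != 0) (es : spec D e 0).
Hypotheses (Ts : spec D T t) (Qs : spec D Q q) (Ps : spec D P p).

Let mz (x : L) : (x *~ (-1) = - x) * (x *~ (- 2)%R = - (2 * x)) * (x *~ 2 = 2 * x)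
    * (x *~ 0 = 0) * (x *~ 1 = x) * (x *~ 4 = 4 * x) * (x *~ (-4) = - (4 * x)).
Proof. by rewrite !mulrNz mulr1z mulr0z !mulrz_nat !mulr_natl. Qed.

Local Notation A_spec d := (forall j, (j <= rank (target d))%N -> spec D (A j) (a j)).
Local Notation A_refl d i :=
  (forall j, (j <= rank (target d))%N -> A' j = A j - A i *~ cartan (target d) i j).
Local Notation limits d i e' :=
  (let n := newS d i A A' e e' T Q P r2 in let s := s_tqp (target d) i (a i) t q p in
   [/\ spec D n.1.1 s.1.1, spec D n.1.2 s.1.2 & spec D n.2 s.2]).

Lemma spec_newS_VI_V i e' : (i <= rank (target VI_V))%N -> A_spec VI_V -> A_refl VI_V i ->
  e'^-1 = eps_inv VI_V (S_al VI_V i (nth 0 (old_al VI_V A e))) ->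
  target_nondeg VI_V a t q p -> limits VI_V i e'.
Proof.
move=> ir As A'E e'E [[q0 q1 p0 pt] b0 b2].
have As0 := As 0%N isT; have As1 := As 1%N isT.
have As2 := As 2%N isT; have As3 := As 3%N isT; clear As.
have A2' := A'E 2%N isT; clear A'E.
have x0 : Q - 1 != 0 by apply: (@spec_neq0 _ _ D _ (q - 1)) => //; spec_tac.
have Q0 : Q != 0 by apply: spec_neq0 Qs q0.
have P0 : P != 0 by apply: spec_neq0 Ps p0.
case: i ir A2' e'E => [|[|[|[|i]]]] // _ A2' e'E;
  rewrite /eps_inv /S_al /old_al /= ?mz in A2' e'E.
- have zs : spec D (1 - e * T * (Q - 1)) 1 by lim_tac; ring.
  have z0 := spec_neq0 zs (oner_neq0 _).
  have cs : spec D (P + T / (1 - e * T * (Q - 1))) (p + t).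
    by lim_tac; rewrite ?divr1 ?oner_neq0.
  have c0 := spec_neq0 cs pt.
  have bs : spec D (A 0%N + (Q - 1) * (P + T / (1 - e * T * (Q - 1)))) (a 0%N + (q - 1) * (p + t)).
    by lim_tac.
  have B0 := spec_neq0 bs b0.
  have gs : spec D (P + T / (1 - e * T * (Q - 1)) -
      e * T * (A 0%N + (Q - 1) * (P + T / (1 - e * T * (Q - 1))))) (p + t).
    by lim_tac; ring.
  have g0 := spec_neq0 gs pt.
  have -> := newS_VI_V0 r2 _ _ e0 x0 z0 B0 c0 g0.
  + split; rewrite /=; lim_tac => //; field; nz_tac.
  + by rewrite A2'; ring.
  + by rewrite e'E; ring.
- rewrite (@newS_VI_V1 _ A A' e e' T Q P r2) //; last 2 first.
  + by rewrite A2'; ring.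
  + by rewrite e'E; ring.
  by split; rewrite /=; lim_tac.
- have Bs : spec D (A 2%N + (Q - 1) * P) (a 2%N + (q - 1) * p) by lim_tac.
  have B0 := spec_neq0 Bs b2.
  rewrite (@newS_VI_V2 _ A A' e e' T Q P r2) //; last 2 first.
  + by rewrite A2'; ring.
  + by rewrite e'E; ring.
  by split; rewrite /=; lim_tac => //; ring.
- rewrite (@newS_VI_V3 _ A A' e e' T Q P r2) //; last 2 first.
  + by rewrite A2'; ring.
  + by rewrite e'E; ring.
  by split; rewrite /=; lim_tac.
Qed.

Lemma spec_newS_V_III i e' : (i <= rank (target V_III))%N -> A_spec V_III ->
  e'^-1 = eps_inv V_III (S_al V_III i (nth 0 (old_al V_III A e))) -> T != 0 ->
  target_nondeg V_III a t q p -> limits V_III i e'.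
Proof.
move=> ir As e'E T0 [q0 p0 p1].
have As0 := As 0%N isT; have As1 := As 1%N isT; have As2 := As 2%N isT; clear As.
have Q0 : Q != 0 by apply: spec_neq0 Qs q0.
have P0 : P != 0 by apply: spec_neq0 Ps p0.
case: i ir e'E => [|[|[|i]]] // _ e'E; rewrite /eps_inv /S_al /old_al /= ?mz in e'E.
- rewrite (@newS_V_III0 _ A A' e e' T Q P r2) //; last by rewrite e'E; ring.
  by split; rewrite /=; lim_tac => //; ring.
- have ds : spec D (Q + e * T) q by lim_tac; ring.
  have d0 := spec_neq0 ds q0.
  rewrite (@newS_V_III1 _ A A' e e' T Q P r2) //.
  by split; rewrite /=; lim_tac => //; rewrite ?mulf_neq0.
- have Ps1 : spec D (P - 1) (p - 1) by lim_tac.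
  have P10 := spec_neq0 Ps1 p1.
  rewrite (@newS_V_III2 _ A A' e e' T Q P r2) //; last by rewrite e'E; ring.
  by split; rewrite /=; lim_tac => //; ring.
Qed.

Section SpecNewSRoot.
Variable U : L.
Hypothesis Us : spec D U 1.
Local Notation root_eq d i :=
  (U ^+ eps_order d * (1 + A i *~ eps_shift d i * e ^+ eps_order d) = 1).

Let U0 : U != 0. Proof. exact: spec_neq0 Us (oner_neq0 _). Qed.

Lemma spec_newS_V_IV i : (i <= rank (target V_IV))%N -> A_spec V_IV -> A_refl V_IV i ->
  root_eq V_IV i -> target_nondeg V_IV a t q p -> i != 1%N \/ U = 1 ->
  limits V_IV i (e * U).
Proof.
move=> ir As A'E UE [q0 p0 f0] U1.
have As0 := As 0%N isT; have As1 := As 1%N isT; have As2 := As 2%N isT; clear As.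
have A2' := A'E 2%N isT; clear A'E.
have Q0 : Q != 0 by apply: spec_neq0 Qs q0.
have P0 : P != 0 by apply: spec_neq0 Ps p0.
have zs : spec D (1 - e * Q) 1 by lim_tac; ring.
have z0 := spec_neq0 zs (oner_neq0 _).
have ws : spec D ((1 - e * Q) * P - e * A 2%N) p by lim_tac; ring.
have w0 := spec_neq0 ws p0.
case: i ir A2' UE U1 => [|[|[|i]]] // _ A2' UE U1; rewrite /eps_shift /= ?mz in A2' UE.
- have ms : spec D (2 * ((1 - e * Q) * P - e * A 2%N) * (1 - e * Q) - 2 * T - Q)
      (2 * p - q - 2 * t) by lim_tac; ring.
  have m0 := spec_neq0 ms f0.
  have ns : spec D (2 * ((1 - e * Q) * P - e * A 2%N) * (1 - e * Q) - 2 * T - Q +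
      2 * e * A 0%N * (1 - e * Q)) (2 * p - q - 2 * t) by lim_tac; ring.
  have n0 := spec_neq0 ns f0.
  rewrite (@newS_V_IV0 _ A A' e U T Q P r2) //; last by rewrite A2'; ring.
  split; rewrite /=; lim_tac => //; rewrite ?mulf_neq0 ?expf_neq0 ?oner_neq0 //.
  + by ring.
  + by field; nz_tac.
  + by field; nz_tac.
- case: U1 => // U1; rewrite U1 mulr1.
  rewrite (@newS_V_IV1 _ A A' e T Q P r2) //; last by rewrite A2'; ring.
  by split; rewrite /=; lim_tac.
- rewrite (@newS_V_IV2 _ A A' e U T Q P r2) //; last 2 first.
  + by rewrite A2'; ring.
  + by rewrite -[RHS]UE; ring.
  split; rewrite /=; lim_tac => //; rewrite ?oner_neq0 //.
  + by ring.
  + by rewrite divr1.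
  + by ring.
Qed.

Lemma spec_newS_III_II i : (i <= rank (target III_II))%N -> A_spec III_II -> A_refl III_II i ->
  root_eq III_II i -> target_nondeg III_II a t q p -> limits III_II i (e * U).
Proof.
move=> ir As A'E UE [p0 f0].
have As0 := As 0%N isT; have As1 := As 1%N isT; clear As.
have A1' := A'E 1%N isT; clear A'E.
have P0 : P != 0 by apply: spec_neq0 Ps p0.
have hs : spec D (1 + e ^+ 2 * T) 1 by lim_tac; ring.
have h0 := spec_neq0 hs (oner_neq0 _).
have xs : spec D (1 + 2 * e * Q) 1 by lim_tac; ring.
have x0 := spec_neq0 xs (oner_neq0 _).
have f20 : 2 * (p - 2 * q ^+ 2 - t) != 0 by rewrite mulf_neq0.
case: i ir A1' UE => [|[|i]] // _ A1' UE; rewrite /eps_shift /= ?mz in A1' UE.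
- set g := 4 * e * (1 + 2 * e * Q) * A 1%N + 2 * (1 + 2 * e * Q) ^+ 2 * P - 4 * Q ^+ 2
    - T * ((1 + 2 * e * Q) ^+ 2 + 1).
  have gs : spec D g (2 * (p - 2 * q ^+ 2 - t)) by rewrite /g; lim_tac; ring.
  have g0 := spec_neq0 gs f20.
  have ms : spec D (g - 4 * e * A 0%N * (1 + 2 * e * Q)) (2 * (p - 2 * q ^+ 2 - t)).
    by lim_tac; ring.
  have m0 := spec_neq0 ms f20.
  rewrite (@newS_III_II0 _ L2 A A' e U T Q P r2) //; last 2 first.
  + by rewrite A1'; ring.
  + by rewrite -[RHS]UE; ring.
  rewrite /= -/g; set X := (Q * g + _) / _.
  have Xs : spec D X (q + a 0%N / (p - 2 * q ^+ 2 - t)).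
    by rewrite /X; lim_tac => //; field; nz_tac.
  have x's : spec D (1 + 2 * e * X) 1 by lim_tac; ring.
  split; lim_tac => //; rewrite ?mulf_neq0 ?expf_neq0 ?oner_neq0 //.
  + by ring.
  + by rewrite divr1.
  + by field; nz_tac.
- have bs : spec D (2 * e * A 1%N + (1 + 2 * e * Q) * P) p by lim_tac; ring.
  have b0 := spec_neq0 bs p0.
  rewrite (@newS_III_II1 _ L2 A A' e U T Q P r2) //; last by rewrite A1'; ring.
  split; rewrite /=; lim_tac => //; rewrite ?oner_neq0 //.
  + by ring.
  + by rewrite divr1.
  + by ring.
Qed.

Hypothesis r22 : r2 ^+ 2 = 2.

Lemma spec_newS_IV_II i : (i <= rank (target IV_II))%N -> A_spec IV_II ->
  root_eq IV_II i -> target_nondeg IV_II a t q p -> limits IV_II i (e * U).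
Proof.
move=> ir As UE [p0 f0].
have As0 := As 0%N isT; have As1 := As 1%N isT.
have P0 : P != 0 by apply: spec_neq0 Ps p0.
have [V [v Vs VE]] : exists V, exists2 v, spec D V v & U ^+ 3 = 1 - e ^+ 6 * V.
  have U3s : spec D (1 + U ^+ 3) 2 by lim_tac; ring.
  have U30 := spec_neq0 U3s F2.
  (* With c = A_i times the shift, U^6 (1 + c eps^6) = 1 gives (1 - U^3)(1 + U^3) = c eps^6 U^6; V
     is obtained on dividing by 1 + U^3, whose limit is 2. *)
  exists (A i *~ eps_shift IV_II i * U ^+ 6 / (1 + U ^+ 3)).
  exists (a i *~ eps_shift IV_II i * 1 ^+ 6 / 2).
    apply: specM; [apply: specM|exact: specV].
      by apply: specMz; apply: As.
    exact: specX.
  move: UE; rewrite [eps_order _]/=; move: (A i *~ _) => c UE.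
  apply: (mulIf U30); rewrite mulrBl mul1r mulrA divfK //.
  by rewrite [1 in RHS](esym UE); ring.
case: i ir UE => [|[|i]] // _ UE.
- have gs : spec D ((1 + 2 * e ^+ 2 * Q) * (P - T) - 2 * Q ^+ 2) (p - 2 * q ^+ 2 - t).
    by lim_tac; ring.
  have g0 := spec_neq0 gs f0.
  have hs : spec D ((1 + 2 * e ^+ 2 * Q) * (P - T) - 2 * Q ^+ 2 + 2 * e ^+ 2 * A 0%N)
    (p - 2 * q ^+ 2 - t) by lim_tac; ring.
  have h0 := spec_neq0 hs f0.
  rewrite (@newS_IV_II0 _ L2 A A' e U V T Q P r2) //.
  split; rewrite /=; lim_tac => //; rewrite ?mulf_neq0 ?expf_neq0 ?oner_neq0 //.
  + by field; nz_tac.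
  + by field; nz_tac.
  + by field; nz_tac.
- rewrite (@newS_IV_II1 _ L2 A A' e U V T Q P r2) //.
  split; rewrite /=; lim_tac => //; rewrite ?mulf_neq0 ?expf_neq0 ?oner_neq0 //.
  + by field; nz_tac.
  + by field; nz_tac.
  + by rewrite divr1.
Qed.
End SpecNewSRoot.

Lemma spec_newS d i e' : r2 ^+ 2 = 2 -> (i <= rank (target d))%N -> A_spec d -> A_refl d i ->
  target_nondeg d a t q p -> old_ok d e T Q ->
  e'^-1 ^+ eps_order d = eps_inv d (S_al d i (nth 0 (old_al d A e))) ->
  (~~ birational d -> exists2 U, e' = e * U &
     [/\ spec D U 1, U ^+ eps_order d * (1 + A i *~ eps_shift d i * e ^+ eps_order d) = 1
       & eps_shift d i = 0 -> U = 1]) ->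
  limits d i e'.
Proof.
move=> r22; case: d => ir As A'E nd ok eI eU.
- exact: spec_newS_VI_V.
- have [//|U -> [Us UE U1]] := eU; apply: spec_newS_V_IV => //.
  by case: i {ir A'E eI eU UE} U1 => [|[|i]] U1; [left|right; apply: U1|left].
- by case/andP: ok => _ T0; apply: spec_newS_V_III.
- by have [//|U -> [Us UE _]] := eU; apply: spec_newS_IV_II.
- by have [//|U -> [Us UE _]] := eU; apply: spec_newS_III_II.
Qed.

End SpecNewS.

Lemma target_nondeg_al (R : realType) d :
  target_nondeg d (al R (target d)) (var_t _) (var_q _) (var_p _).
Proof.
have sp J : let D := @painleveSpec R J _ idfun (fun n => (n == 0%N)%:R) 0 2 5 in
    [/\ forall n, (n <= rank J)%N -> spec D (al R J n) (n == 0%N)%:R,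
     spec D (var_t _) 0, spec D (var_q _) 2 & spec D (var_p _) 5].
  move=> D; split; [|exact: evalSpec_t|exact: evalSpec_q|exact: evalSpec_p].
  move=> n nJ; have := @painleveSpec_alpha R J _ idfun (fun n => (n == 0%N)%:R) 0 2 5 _ (inord n).
  rewrite inordK //; apply; rewrite big_ord_recl mark0 big1 ?addr0 //.
  by move=> i _; rewrite mul0rn.
have gen (L : fieldType) (D : specData L (Cplx R)) (f : L) (g : Cplx R) n :
  spec D f g -> g = n.+1%:R -> f != 0.
  by move=> fg gn; apply: (spec_neq0 fg); rewrite gn pnatr_eq0.
case: d => /=.
- have [sa] := sp PV; move: (sa 0%N isT) (sa 2%N isT) => {sa} /=.
  move: (al _ _ _) (al _ _ _) (var_t _) (var_q _) (var_p _) => a2 a0 t q p.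
  set D := painleveSpec _ _ _ _ _ _ => sa0 sa2 st sq sp'; split; [split| |].
  + by apply: (@gen _ D _ 2 1%N).
  + by apply: (@gen _ D _ (2 - 1) 0%N); [spec_tac|ring].
  + by apply: (@gen _ D _ 5 4%N).
  + by apply: (@gen _ D _ (5 + 0) 4%N); [spec_tac|ring].
  + by apply: (@gen _ D _ (1 + (2 - 1) * (5 + 0)) 5%N); [spec_tac|ring].
  + by apply: (@gen _ D _ (0 + (2 - 1) * 5) 4%N); [spec_tac|ring].
- have [_] := sp PIV; move: (var_t _) (var_q _) (var_p _) => t q p.
  set D := painleveSpec _ _ _ _ _ _ => st sq sp'; split.
  + by apply: (@gen _ D _ 2 1%N).
  + by apply: (@gen _ D _ 5 4%N).
  + by apply: (@gen _ D _ (2 * 5 - 2 - 2 * 0) 7%N); [spec_tac|ring].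
- have [_] := sp PIII; move: (var_t _) (var_q _) (var_p _) => t q p.
  set D := painleveSpec _ _ _ _ _ _ => st sq sp'; split.
  + by apply: (@gen _ D _ 2 1%N).
  + by apply: (@gen _ D _ 5 4%N).
  + by apply: (@gen _ D _ (5 - 1) 3%N); [spec_tac|ring].
all: have [_] := sp PII; move: (var_t _) (var_q _) (var_p _) => t q p.
all: set D := painleveSpec _ _ _ _ _ _ => st sq sp'; split.
all: try by apply: (@gen _ D _ 5 4%N).
all: by rewrite -oppr_eq0; apply: (@gen _ D _ (- (5 - 2 * 2 ^+ 2 - 0)) 2%N); [spec_tac|ring].
Qed.

(** The combinations of old parameters equal to A_j transform under S_i as the simple roots of the
    target type; eps drops out, so no limit is involved. *)
Lemma new_A_S (F : fieldType) d i j (A : nat -> F) (e : F) :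
  2 != 0 :> F -> (i <= rank (target d))%N -> (j <= rank (target d))%N ->
  new_A d (S_al d i (nth 0 (old_al d A e))) j = A j - A i *~ cartan (target d) i j.
Proof.
move=> n2; have n4 : 4 != 0 :> F by have -> : 4 = 2 * 2 :> F; [ring|rewrite mulf_neq0].
have mz (x : F) : (x *~ (-1) = - x) * (x *~ (- 2)%R = - (2 * x)) * (x *~ 2 = 2 * x)
    * (x *~ 0 = 0) * (x *~ 1 = x).
  by rewrite !mulrNz mulr1z mulr0z !mulrz_nat !mulr_natl.
rewrite /new_A /old_al; case: d => /=.
all: do 5?[case: i => [|i] //]; move=> _.
all: do 5?[case: j => [|j] //]; move=> _ /=; rewrite ?mz.
all: try ring.
all: try (move: (e ^- _) => x; field; nz_tac).
all: try (move: (e^-1) => x; field; nz_tac).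
Qed.

Lemma eq_S_tqp (F : fieldType) d i (a a' : nat -> F) (t q p : F) :
  (i <= rank (target d))%N -> (forall k, (k <= rank (source d))%N -> a k = a' k) ->
  S_tqp d i a t q p = S_tqp d i a' t q p.
Proof.
move=> ir aa; rewrite /S_tqp; case: d aa ir => /= aa.
all: do 5?[case: i => [|i] //]; move=> _ /=; rewrite ?aa //.
Qed.

Lemma rmorph_S_tqp (L F : fieldType) (f : {rmorphism L -> F}) d i (a : nat -> L) t q p :
  let s := S_tqp d i a t q p in
  (f s.1.1, f s.1.2, f s.2) = S_tqp d i (fun k => f (a k)) (f t) (f q) (f p).
Proof.
rewrite /S_tqp; case: d; do 5?[case: i => [|i] /=] => //=.
all: by rewrite ?(rmorph_nat, rmorphXn, rmorph1, rmorphD, rmorphN, rmorphM, fmorphV).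
Qed.

(** * Limits of a lift *)

Section LiftLimits.
Variables (R : realType) (d : degeneration).
Local Notation C := (Cplx R).
Local Notation EE := (E R d).
Local Notation KS := (K R (source d)).
Local Notation D := (limSpec R d).
Variable iota : {rmorphism KS -> EE}.
Hypothesis iotaP : substitutes_old iota.
Variable i : nat.
Hypothesis ir : (i <= rank (target d))%N.
Variable phi : {rmorphism EE -> EE}.
Hypothesis phiP : lifts iota (degK R d i) phi.

Local Notation e := (eps R d).
Local Notation r2 := (constE d (sqrtC 2) : EE).
Let n2 : 2 != 0 :> EE := natE_neq0 R d 1.

Let phi_iota x : phi (iota x) = iota (degK R d i x). Proof. by case: phiP. Qed.

Let phi_al k : (k <= rank (source d))%N ->
  phi (iota (al R (source d) k)) = S_al d i (nth 0 (old_al d (AE R d) e)) k.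
Proof.
move=> kr; rewrite phi_iota degK_al // rmorph_S_al; apply: eq_S_al => // l lr.
by case: iotaP => _ ->.
Qed.

Lemma lift_A j : (j <= rank (target d))%N ->
  phi (AE R d j) = AE R d j - AE R d i *~ cartan (target d) i j.
Proof.
move=> jr; rewrite -[in LHS](iota_new_A iotaP) // !rmorph_new_A.
by rewrite (eq_new_A _ phi_al) new_A_S.
Qed.

Lemma lift_eps_inv :
  (phi e)^-1 ^+ eps_order d = eps_inv d (S_al d i (nth 0 (old_al d (AE R d) e))).
Proof.
rewrite -fmorphV -rmorphXn -(iota_eps_inv iotaP) !rmorph_eps_inv.
exact: eq_eps_inv phi_al.
Qed.

(** Every lift acts by [newS], since T, Q, P are rational in quantities whose images a lift
    prescribes. *)
Lemma lift_tqp : (phi (T_ R d), phi (Q_ R d), phi (P_ R d)) =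
  newS d i (AE R d) (fun j => phi (AE R d j)) e (phi e) (T_ R d) (Q_ R d) (P_ R d) r2.
Proof.
have [ne _] := new_tqpE iotaP; have [ic ia it iq ip] := iotaP.
have := rmorph_new_tqp phi d (AE R d) e (tauE R d) (iota (var_t _)) (iota (var_q _))
    (iota (var_p _)) r2.
have pr : phi r2 = r2 by rewrite -cE_E -ic phi_iota wordK_const.
have pt : phi (tauE R d) = tauE R d by case: phiP.
rewrite ne /= !phi_iota pr pt => ->.
have := rmorph_S_tqp iota d i (al R (source d)) (var_t _) (var_q _) (var_p _).
rewrite (eq_S_tqp _ _ _ ir ia) it iq ip -(degK_tqp R ir).
move=> /= sE; pose o := S_tqp d i (oldA R d) (oldE R d).1.1 (oldE R d).1.2 (oldE R d).2.
rewrite -[newS _ _ _ _ _ _ _ _ _ _]/(new_tqp d (fun j => phi (AE R d j)) (phi e) (tauE R d)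
  o.1.1 o.1.2 o.2 r2).
by rewrite /o -sE.
Qed.

Let s := s_tqp (target d) i (al R (target d) i) (var_t _) (var_q _) (var_p _).

Lemma lift_limits :
  [/\ spec D (phi (T_ R d)) s.1.1, spec D (phi (Q_ R d)) s.1.2 & spec D (phi (P_ R d)) s.2].
Proof.
have nd := target_nondeg_al R d.
have F2 : 2 != 0 :> K R (target d).
  by rewrite -(rmorph_nat (constK R (target d))) fmorph_eq0 pnatr_eq0.
have As j : (j <= rank (target d))%N -> spec D (AE R d j) (al R (target d) j).
  by move=> _; apply: limSpec_AE.
have es := limSpec_eps R d; have e0 := eps_neq0 R d.
have Ts := limSpec_T R d; have Qs := limSpec_Q R d; have Ps := limSpec_P R d.
have A' := lift_A; have eI := lift_eps_inv; have r22 := sqrt2E R d.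
suff : let n := newS d i (AE R d) (fun j => phi (AE R d j)) e (phi e) (T_ R d) (Q_ R d)
    (P_ R d) r2 in [/\ spec D n.1.1 s.1.1, spec D n.1.2 s.1.2 & spec D n.2 s.2].
  by rewrite -lift_tqp.
have bU : ~~ birational d -> exists2 U, phi e = e * U &
   [/\ spec D U 1, U ^+ eps_order d * (1 + AE R d i *~ eps_shift d i * e ^+ eps_order d) = 1
     & eps_shift d i = 0 -> U = 1].
  (* The given lift carries no explicit U; uniqueness identifies it with the one from
     [lifts_exists], where U can be read off. *)
  move=> bd; have [phi' [phi'P [u [ue u0 gu uE]]]] := lifts_exists bd iotaP ir.
  have pp := lifts_uniq iotaP phiP phi'P.
  exists (coefF (fpsToEps R d u)); first exact: etrans (congr1 (@^~ e) pp) ue.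
  split; [|exact: uE|].
  - have c1 : coefF (1 : paramRing R (target d)) = 1 := rmorph1 (coefR _).
    have := @limSpec_coef R d (fpsToEps R d u).
    by rewrite (fpsToEpsK bd u) u0 c1; apply; apply: gu.
  (* Without a shift U^N = 1, and the constant term 1 leaves U = 1; this is the case of s_1 in V ->
     IV. *)
  - move=> sh; move: uE; rewrite sh mulr0z mul0r addr0 mulr1.
    rewrite -coefRE -rmorphXn -rmorphXn -(rmorph1 (coefR (epsRing R d))) => /(@coefF_inj _).
    rewrite -(rmorph1 (fpsToEps R d)) => /(can_inj (fpsToEpsK bd)).
    case: (eps_order d) (eps_order_gt0 d) => // N _ uN.
    rewrite (@fps_pow_inj _ N u 1) ?expr1n ?fps_coef1 //.
    by rewrite -(rmorph_nat (@mpolyC (rank (target d)) C)) mpolyC_eq0 pnatr_eq0.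
exact: (spec_newS n2 F2 e0 es Ts Qs Ps r22 ir As A' nd (old_okE R d) eI bU).
Qed.
End LiftLimits.

Theorem mainTheorem1 (R : realType) (d : degeneration) :
  exists (iota : {rmorphism K R (source d) -> E R d})
         (S : 'I_(rank (target d)).+1 -> K R (source d) -> K R (source d))
         (rho : (K R (source d) -> K R (source d)) -> E R d -> E R d),
    let W_JK := generated (fun w => exists i, w = S i) in
    [/\ is_change_of_variables iota,
        forall i, W (S i),
        acts_by_automorphisms W_JK rho,
        forall w, W_JK w -> forall x, rho w (iota x) = iota (w x)
      & forall i, exists2 s : K R (target d) -> K R (target d), is_s i s &
          [/\ forall j, converges (rho (S i) (A_ R j)) (s (alpha R j)),
              converges (rho (S i) (T_ R d)) (s (var_t _)),
              converges (rho (S i) (Q_ R d)) (s (var_q _))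
            & converges (rho (S i) (P_ R d)) (s (var_p _))]].
Proof.
have [iota iotaP] := iota_exists R d.
pose S (i : 'I_(rank (target d)).+1) : K R (source d) -> K R (source d) := degK R d i.
have [rho [rho_act rho_lift]] :
    exists rho, acts_by_automorphisms (generated (fun w => exists i, w = S i)) rho /\
      forall w, generated (fun w => exists i, w = S i) w -> lifts iota w (rho w).
  apply: action_of_lifts.
  - by move=> w f [].
  - exact: lifts_id.
  - by move=> v w f g; apply: lifts_comp.
  - by move=> v w f; apply: lifts_inv.
  - by move=> w f g; apply: (lifts_uniq iotaP).
  - move=> w [i ->]; have [bd|bd] := boolP (birational d).
      apply: (lifts_exists_birational iotaP bd).
      exact: (@rmorph_field_automorphism _ (degK R d i) (wordK_aut R _ _)).
    have [phi [phiP _]] := lifts_exists bd iotaP (ltn_ord i : (i <= rank (target d))%N).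
    by exists phi.
exists iota, S, rho; split.
- exact: iota_change.
- by move=> i; apply: W_wordK.
- exact: rho_act.
- by move=> w /rho_lift[_ rho_iota _ _].
move=> i; have [s [sP _]] := s_exists R i; exists s; first exact: sP.
have ir : (i <= rank (target d))%N := ltn_ord i.
have rhoS : lifts iota (S i) (rho (S i)) by apply/rho_lift/generated_gen; exists i.
have [phi phiE] : exists phi : {rmorphism E R d -> E R d}, phi =1 rho (S i).
  by apply: field_automorphism_rmorph; case: rhoS.
have {}rhoS : lifts iota (degK R d i) phi by rewrite (funext phiE).
have alE (j : 'I_(rank (target d)).+1) : al R (target d) j = alpha R j by rewrite /al inord_val.
have [_ _ s_al s_v] := sP.
have [lT lQ lP] := lift_limits iotaP ir rhoS.
rewrite alE -s_v /= in lT lQ lP.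
split=> [j|||]; rewrite -phiE; apply: limSpec_converges; [|exact: lT|exact: lQ|exact: lP].
(* On the parameters the lift agrees with s_i before the limit, which merely replaces A_j by
   alpha_j. *)
rewrite s_al -(AE_ord R j) (lift_A iotaP ir rhoS (ltn_ord j : (j <= rank (target d))%N)).
rewrite /s_param -(alE j) -(alE i).
by apply: specD; [|apply/specN/specMz]; apply: limSpec_AE.
Qed.
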